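(* Let $\mathcal{Z}\subset\mathbb{K}^3$ be a rational affine surface with rational parametrization $\mathcal{Q}(t,s)=\left(\frac{N_1}{D_1},\frac{N_2}{D_2},\frac{N_3}{D_3}\right)$, and let $A=(a,b,c)\in\mathbb{K}^3$, subject to the standing assumptions described in the context. Let $\Phi_{2,3}(A)$ and $\mathfrak{g}^{\mathcal{Q},A}$ be as defined in the context. Then: 1. $\mathrm{mult}(A,\mathcal{Z})=\deg(\mathcal{Z})$ if and only if $\mathfrak{g}^{\mathcal{Q},A}\neq 1$. 2. $\mathrm{mult}(A,\mathcal{Z})<\deg(\mathcal{Z})$ if and only if $\mathfrak{g}^{\mathcal{Q},A}=1$. Furthermore, if $\mathfrak{g}^{\mathcal{Q},A}=1$, then $$\deg(\mathcal{Z})-\mathrm{mult}(A,\mathcal{Z})=\frac{\deg(\Phi_{2,3}(A))}{\deg(\mathcal{Q})}.$$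
   Context: $\mathbb{K}$ is an algebraically closed field of characteristic zero. $\mathcal{Z}\subset\mathbb{K}^3$ is a rational (irreducible, Zariski closed) affine surface which is not a plane parallel to one of the coordinate planes, and $\mathcal{Q}(t,s)=\left(\frac{N_1(t,s)}{D_1(t,s)},\frac{N_2(t,s)}{D_2(t,s)},\frac{N_3(t,s)}{D_3(t,s)}\right)$ is a rational parametrization of $\mathcal{Z}$ (i.e. a dominant rational map $\mathbb{K}^2\dashrightarrow\mathcal{Z}$), not necessarily proper, in reduced form ($N_i,D_i\in\mathbb{K}[t,s]$, $\gcd(N_i,D_i)=1$). $\deg(\mathcal{Z})$ is the degree of the defining polynomial $f$ of $\mathcal{Z}$; $\mathrm{mult}(A,\mathcal{Z})$ is the multiplicity of $A$ on $\mathcal{Z}$, i.e. the lowest degree of a nonzero homogeneous component of $f(x+a,y+b,z+c)$ (so it is $0$ if $A\notin\mathcal{Z}$). For a dominant rational map between varieties of the same dimension, $\deg$ denotes the degree of the map (the cardinality of a generic fibre); $\deg(\mathcal{Q})$ is the degree of the rational map $\mathbb{K}^2\dashrightarrow\mathcal{Z}$ induced by $\mathcal{Q}$. For $A=(a,b,c)\in\mathbb{K}^3$ let $$\Phi_{2,3}(A)(t,s)=(\chi_1^A(t,s),\chi_2^A(t,s))=\left(\frac{N_2-bD_2}{N_1-aD_1}\cdot\frac{D_1}{D_2},\ \frac{N_3-cD_3}{N_1-aD_1}\cdot\frac{D_1}{D_3}\right),$$ viewed as a rational map $\mathbb{K}^2\dashrightarrow\mathbb{K}^2$. With new variables $h_1,h_2$,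 let $\mathfrak{g}_i^{\mathcal{Q},A}(t,s,h_1,h_2)$ be the numerator (in reduced form) of $\chi_i^A(t,s)-\chi_i^A(h_1,h_2)$, $i=1,2$, and let $K=\gcd(\mathfrak{g}_1^{\mathcal{Q},A},\mathfrak{g}_2^{\mathcal{Q},A})$ computed in $\mathbb{K}[h_1,h_2][t,s]$. Define $\mathfrak{g}^{\mathcal{Q},A}=K$ if $\deg_{\{t,s\}}(K)>0$ and $\mathfrak{g}^{\mathcal{Q},A}=1$ if $\deg_{\{t,s\}}(K)=0$. Standing assumptions on the parameters: (i) none of the projective curves in $\mathbb{P}^2(\mathbb{K})$ (coordinates $(t:s:v)$) defined by the homogenizations of the non-constant polynomials among $N_1,N_2,N_3,D_1,D_2,D_3$ passes through $(0:1:0)$; (ii) for the point $A=(a,b,c)$ under consideration, none of the projective curves defined by the homogenizations of the non-constant polynomials among $N_1-aD_1,\ N_2-bD_2,\ N_3-cD_3$ passes through $(0:1:0)$. *)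

(* Defs.v *)
From HB Require Import structures.
From mathcomp Require Import all_boot all_order all_algebra.
From mathcomp Require Import boolp classical_sets cardinality.
From mathcomp.multinomials Require Import mpoly.

Set Implicit Arguments.
Unset Strict Implicit.
Unset Printing Implicit Defensive.

Import GRing.Theory.
Local Open Scope card_scope.
Local Open Scope classical_set_scope.
Local Open Scope ring_scope.

Local Notation "x %:F" := (@FracField.tofrac _ x).

(* Divisibility in an integral domain R; polynomial rings {mpoly K[n]} come
   without division or gcd. *)

Definition divides (R : idomainType) (p q : R) : Prop := exists r, q = r * p.

Definition coprime_elts (R : idomainType) (p q : R) : Prop :=
  forall d, divides d p -> divides d q -> d \is a GRing.unit.

Definition irreducible_elt (R : idomainType) (p : R) : Prop :=
  [/\ p != 0, p \isn't a GRing.unit &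
      forall q r, p = q * r -> q \is a GRing.unit \/ r \is a GRing.unit].

Definition is_gcd (R : idomainType) (p q d : R) : Prop :=
  [/\ divides d p, divides d q &
      forall e, divides e p -> divides e q -> divides e d].

(* Some gcd; in a UFD it exists and is unique up to a unit. *)
Definition gcd_elt (R : idomainType) (p q : R) : R :=
  xget 0 [set d | is_gcd p q d].

Definition is_reduced_form (R : idomainType) (x : {fraction R}) (nd : R * R) :=
  [/\ nd.2 != 0, coprime_elts nd.1 nd.2 & x = nd.1%:F / nd.2%:F].

(* In a UFD the reduced form exists and is unique up to a common unit factor.
   (The projections \n_x and \d_x of the library are not in lowest terms.) *)
Definition reduced_form (R : idomainType) (x : {fraction R}) : R * R :=
  xget (0, 1) [set nd | is_reduced_form x nd].

Definition rnum (R : idomainType) (x : {fraction R}) : R := (reduced_form x).1.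
Definition rden (R : idomainType) (x : {fraction R}) : R := (reduced_form x).2.

Definition affpt (K : fieldType) (n : nat) := {ffun 'I_n -> K}.

Definition zeros (K : fieldType) n (f : {mpoly K[n]}) : set (affpt K n) :=
  [set v | f.@[v] = 0].

Definition coord_plane (K : fieldType) n (i : 'I_n) (c : K) : set (affpt K n) :=
  [set v | v i = c].

Definition zariski_closed (K : fieldType) n (C : set (affpt K n)) : Prop :=
  exists S : set {mpoly K[n]}, C = [set v | forall p, S p -> p.@[v] = 0].

Definition zariski_open (K : fieldType) n (U : set (affpt K n)) : Prop :=
  zariski_closed (~` U).

Definition ratmap (K : fieldType) (m n : nat) := 'I_n -> {fraction {mpoly K[m]}}.

Definition ratmap_dom (K : fieldType) m n (phi : ratmap K m n) :
    set (affpt K m) :=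
  [set v | forall i, (rden (phi i)).@[v] != 0].

Definition ratmap_val (K : fieldType) m n (phi : ratmap K m n)
    (v : affpt K m) : affpt K n :=
  [ffun i => (rnum (phi i)).@[v] / (rden (phi i)).@[v]].

Definition fibre (K : fieldType) m n (phi : ratmap K m n) (p : affpt K n) :
    set (affpt K m) :=
  [set v | ratmap_dom phi v /\ ratmap_val phi v = p].

(* phi maps its domain of definition into Z, with Zariski dense image in Z. *)
Definition dominant_onto (K : fieldType) m n (phi : ratmap K m n)
    (Z : set (affpt K n)) : Prop :=
  (ratmap_val phi @` ratmap_dom phi `<=` Z) /\
  (forall C, zariski_closed C ->
     ratmap_val phi @` ratmap_dom phi `<=` C -> Z `<=` C).

Definition generic_fibre_card (K : fieldType) m n (phi : ratmap K m n)
    (Z : set (affpt K n)) (d : nat) : Prop :=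
  exists U, [/\ zariski_open U, Z `&` U !=set0 &
    forall p, (Z `&` U) p -> fibre phi p #= `I_d].

(* For Z irreducible, d is unique. The value is 0 when the generic fibre over Z
   is empty (image not dense in Z) or has no finite cardinality; it is thus
   positive only for a genuine degree. *)
Definition map_degree (K : fieldType) m n (phi : ratmap K m n)
    (Z : set (affpt K n)) : nat :=
  xget 0%N [set d | generic_fibre_card phi Z d].

(* msize is the total degree plus one. *)
Definition total_degree (K : fieldType) n (f : {mpoly K[n]}) : nat :=
  (msize f).-1.

Definition translate (K : fieldType) n (A : affpt K n) (f : {mpoly K[n]}) :
    {mpoly K[n]} :=
  f \mPo [tuple 'X_i + (A i)%:MP | i < n].

(* The components of degree < msize exhaust those of a polynomial, so find
   returns the lowest degree of a nonzero component. *)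
Definition multiplicity (K : fieldType) n (A : affpt K n) (f : {mpoly K[n]}) :
    nat :=
  let g := translate A f in
  find (fun d => pihomog mdeg d g != 0) (iota 0 (msize g)).

(* Homogenization of P(t,s) in the coordinates (t : s : v). *)
Definition homogenize (K : fieldType) (P : {mpoly K[2]}) : {mpoly K[3]} :=
  \sum_(m <- msupp P)
    P@_m *: ('X_0 ^+ m 0 * 'X_1 ^+ m 1 * 'X_2 ^+ (total_degree P - mdeg m)).

Definition avoids_010 (K : fieldType) (P : {mpoly K[2]}) : Prop :=
  (0 < total_degree P)%N ->
  (homogenize P).@[fun i : 'I_3 => (i == 1)%:R] != 0.

Definition param (K : fieldType) (N D : 'I_3 -> {mpoly K[2]}) : ratmap K 2 3 :=
  fun i => (N i)%:F / (D i)%:F.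

(* Phi_{2,3}(A) = (chi_1^A, chi_2^A): lift ord0 sends the index k = 0, 1 of a
   component to the index 1, 2 of the coordinate it comes from. *)
Definition Phi23 (K : fieldType) (N D : 'I_3 -> {mpoly K[2]}) (A : affpt K 3) :
    ratmap K 2 2 :=
  fun k => let j := lift ord0 k in
    (N j - A j *: D j)%:F / (N 0 - A 0 *: D 0)%:F * ((D 0)%:F / (D j)%:F).

(* K[h_1,h_2][t,s] is {mpoly {mpoly K[2]}[2]}, so that msize there measures
   the degree in t, s only. *)

Definition in_ts (K : fieldType) (p : {mpoly K[2]}) : {mpoly {mpoly K[2]}[2]} :=
  map_mpoly (@mpolyC 2 K) p.

Definition in_h (K : fieldType) (p : {mpoly K[2]}) : {mpoly {mpoly K[2]}[2]} :=
  p%:MP.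

(* x(t,s) - x(h_1,h_2) *)
Definition ts_minus_h (K : fieldType) (x : {fraction {mpoly K[2]}}) :
    {fraction {mpoly {mpoly K[2]}[2]}} :=
  (in_ts (rnum x))%:F / (in_ts (rden x))%:F
  - (in_h (rnum x))%:F / (in_h (rden x))%:F.

Definition gpoly (K : fieldType) (phi : ratmap K 2 2) :
    {mpoly {mpoly K[2]}[2]} :=
  let G := gcd_elt (rnum (ts_minus_h (phi 0))) (rnum (ts_minus_h (phi 1))) in
  if (1 < msize G)%N then G else 1.

(* Main.v *)
From HB Require Import structures.
Require Import Defs.
From mathcomp Require Import all_boot all_order all_algebra.
From mathcomp Require Import separable mxpoly ring.
From mathcomp Require Import boolp classical_sets cardinality.
From mathcomp.multinomials Require Import mpoly.

Set Implicit Arguments.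
Unset Strict Implicit.
Unset Printing Implicit Defensive.

Import GRing.Theory.
Local Open Scope classical_set_scope.
Local Open Scope ring_scope.

(** Write [mu] for the multiplicity of [A] and [d] for the degree of the surface.
    Through a direction [(1, u)], the line [A + lambda (1, u)] meets the surface at
    the roots of [f(A + lambda (1, u))], which is [lambda^mu h(u, lambda)] with [h] of
    degree [d - mu] in [lambda] and [h(u, 0)] not identically zero
    ([multiplicity_chart]). The map [Phi_{2,3}(A)] sends a parameter to the direction
    of the line from [A] to its image: it is [chi = pi o Q] for the projection [pi]
    from [A] ([Phi23_projection]). Hence a general fibre of [chi] is the disjoint union of the
    fibres of [Q] over the [d - mu] points of the surface outside [A] on a line
    through [A] ([projection_fibre], [degree_formula]).

    For this count, [h] must have [d - mu] distinct nonzero roots for general [u].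
    With [x = Q_0 - a], the polynomial [h] generates the relations satisfied by [x]
    over [K(chi)], because such a relation, homogenized, is an equation of the
    surface ([chart_factor_divides]); this rests on the Nullstellensatz for the
    hypersurface [f = 0] ([vanishing_divides]). Being minimal, [h] is separable in
    characteristic zero. The fibres of [Q] themselves have constant cardinality,
    [deg Q], by the primitive element theorem: [K(t, s)] is generated over [K(Q)] by
    one element, whose minimal polynomial specializes to a separable polynomial with
    roots in bijection with the fibre ([generic_fibre]).

    The degenerate case [mu = d] is the one where [h] does not involve [lambda], that
    is, where the surface is a cone and the two components of [chi] are algebraically
    dependent ([multiplicity_eq_degree]). It remains to see that this is what the gcd
    of the numerators of [chi_i(t,s) - chi_i(h)] detects. If [chi_1, chi_2] are
    independent, both [t] and [s] are algebraic over [K(chi)]; on a common factor of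
    the numerators [chi(t,s)] equals [chi(h)], so [t] satisfies there an equation with
    coefficients in [h] only, the factor is free of [s], and likewise of [t]
    ([common_factor_misses_variable]). If they are dependent, the numerators of
    [y(t,s) - y(h)] and [x(t,s) - x(h)], for [y = chi_1], [x = chi_2], both vanish on
    the diagonal; a relation [F(y, x) = 0] shows that they have there a common
    component ([dependent_common_factor]). The gcds themselves exist by Gauss's lemma
    ([gcd_domain_poly]). *)

(** * Divisibility and gcds *)

Definition gcd_domain (R : idomainType) : Prop :=
  forall p q : R, exists d, is_gcd p q d.

Section Divides.
Variable R : idomainType.
Implicit Types p q r d e : R.

Lemma divides_refl p : divides p p.
Proof. by exists 1; rewrite mul1r. Qed.

Lemma divides_trans q p r : divides p q -> divides q r -> divides p r.
Proof. by move=> [x ->] [y ->]; exists (y * x); rewrite mulrA. Qed.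

Lemma divides0 p : divides p 0.
Proof. by exists 0; rewrite mul0r. Qed.

Lemma divides_mull p q r : divides p q -> divides p (r * q).
Proof. by move=> [x ->]; exists (r * x); rewrite mulrA. Qed.

Lemma divides_mulr p q r : divides p q -> divides p (q * r).
Proof. by rewrite mulrC; apply: divides_mull. Qed.

Lemma divides_mulll p q : divides p (q * p).
Proof. by exists q. Qed.

Lemma divides_mullr p q : divides p (p * q).
Proof. by exists q; rewrite mulrC. Qed.

Lemma dividesD p q r : divides p q -> divides p r -> divides p (q + r).
Proof. by move=> [x ->] [y ->]; exists (x + y); rewrite mulrDl. Qed.

Lemma dividesN p q : divides p q -> divides p (- q).
Proof. by move=> [x ->]; exists (- x); rewrite mulNr. Qed.

Lemma dividesB p q r : divides p q -> divides p r -> divides p (q - r).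
Proof. by move=> pq pr; apply: dividesD => //; apply: dividesN. Qed.

Lemma divides_sum (I : Type) (s : seq I) (P : pred I) (F : I -> R) p :
  (forall i, P i -> divides p (F i)) -> divides p (\sum_(i <- s | P i) F i).
Proof.
by move=> pF; apply: big_ind => //; [apply: divides0 | apply: dividesD].
Qed.

Lemma divides_mul p q p' q' :
  divides p q -> divides p' q' -> divides (p * p') (q * q').
Proof. by move=> [x ->] [y ->]; exists (x * y); rewrite mulrACA. Qed.

Lemma divides_mul2l r p q : r != 0 -> divides (r * p) (r * q) -> divides p q.
Proof.
by move=> r0 [x]; rewrite mulrCA => /(mulfI r0) ->; exists x.
Qed.

Lemma divides_unit p q : divides p q -> q \is a GRing.unit ->
  p \is a GRing.unit.
Proof. by move=> [x ->]; rewrite unitrM => /andP[]. Qed.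

Lemma unit_divides p q : p \is a GRing.unit -> divides p q.
Proof. by move=> Up; exists (q / p); rewrite divrK. Qed.

Lemma divides_rmorph (S : idomainType) (f : {rmorphism R -> S}) p q :
  divides p q -> divides (f p) (f q).
Proof. by move=> [x ->]; exists (f x); rewrite rmorphM. Qed.

Lemma coprime_eltsC p q : coprime_elts p q -> coprime_elts q p.
Proof. by move=> c d dq dp; apply: c. Qed.

Lemma is_gcdC p q d : is_gcd p q d -> is_gcd q p d.
Proof. by move=> [dp dq dM]; split=> // e eq ep; apply: dM. Qed.

Lemma is_gcd_mul r p q d e :
  is_gcd p q d -> is_gcd (r * p) (r * q) e -> divides e (r * d).
Proof.
move=> [dp dq dM] [ep eq eM].
have [->|r0] := eqVneq r 0; first by rewrite mul0r; apply: divides0.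
have [d0|d0] := eqVneq d 0; first by rewrite d0 mulr0; apply: divides0.
have [x Ex] : divides (r * d) e by apply: eM; apply: divides_mul => //;
  apply: divides_refl.
have xd_p : divides (x * d) p.
  by apply: (divides_mul2l r0); rewrite mulrCA -Ex.
have xd_q : divides (x * d) q.
  by apply: (divides_mul2l r0); rewrite mulrCA -Ex.
have [y] := dM _ xd_p xd_q; rewrite mulrA -{1}[d]mul1r => /(mulIf d0) E.
by rewrite Ex; exists y; rewrite mulrA -E mul1r.
Qed.

End Divides.

Section GcdDomain.
Variable R : idomainType.
Hypothesis gcdR : gcd_domain R.
Implicit Types p q r d e : R.

(** Euclid's lemma; [r] times a gcd of [p] and [q] is a gcd of [r p] and
    [r q]. *)
Lemma coprime_divides p q r : coprime_elts p q -> divides p (q * r) ->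
  divides p r.
Proof.
move=> cpq pqr; have [d gd] := gcdR p q; have [e ge] := gcdR (r * p) (r * q).
have erd := is_gcd_mul gd ge.
have Ud : d \is a GRing.unit by case: gd => dp dq _; apply: cpq.
have pe : divides p e.
  by case: ge => _ _; apply; [apply: divides_mulll | rewrite mulrC].
have [x E] := divides_trans pe erd.
by exists (x / d); rewrite mulrAC -E mulrK.
Qed.

Lemma coprime_mul p q r : coprime_elts p q -> coprime_elts p r ->
  coprime_elts p (q * r).
Proof.
move=> cq cr d dp dqr; apply: (cr) => //.
apply: coprime_divides dqr => e ed eq; apply: cq => //.
exact: divides_trans ed dp.
Qed.

Lemma coprime_exp p q n : coprime_elts p q -> coprime_elts p (q ^+ n).
Proof.
move=> cq; elim: n => [|n IH]; last by rewrite exprS; apply: coprime_mul.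
by move=> d _ /divides_unit; apply; rewrite expr0 unitr1.
Qed.

Lemma irreducible_coprime p q : irreducible_elt p ->
  ~ divides p q -> coprime_elts p q.
Proof.
move=> [p0 nUp irr] npq d [x Ep] dq.
have [Ux|//] := irr _ _ Ep; case: npq; apply: divides_trans dq.
by exists x^-1; rewrite Ep mulKr.
Qed.

Lemma irreducible_prime p q r : irreducible_elt p ->
  divides p (q * r) -> divides p q \/ divides p r.
Proof.
move=> irr pqr; have [?|/irreducible_coprime] := EM (divides p q).
  by left.
by move=> /(_ irr) c; right; apply: coprime_divides pqr.
Qed.

Lemma gcd_cofactors p q d : is_gcd p q d -> d != 0 ->
  exists p' q', [/\ p = d * p', q = d * q' & coprime_elts p' q'].
Proof.
move=> [[p' Ep] [q' Eq] dM] d0; exists p', q'; split; rewrite 1?mulrC //.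
move=> e [x Ex] [y Ey].
have [z] : divides (d * e) d.
  by apply: dM; [rewrite Ep Ex | rewrite Eq Ey]; rewrite -mulrA [e * d]mulrC;
     apply: divides_mulll.
rewrite mulrCA -{1}[d]mulr1 => /(mulfI d0) E.
by apply/unitrP; exists z; rewrite -E mulrC E.
Qed.

Lemma fraction_quotient (x : {fraction R}) : exists n d, d != 0 /\
  x = FracField.tofrac n / FracField.tofrac d.
Proof.
elim/quotW: x => r; exists \n_r, \d_r; split; first exact: denom_ratioP.
apply: (canRL (mulfK _)); first by rewrite tofrac_eq0 denom_ratioP.
unlock FracField.tofrac; rewrite -[LHS]FracField.pi_mul.
apply/eqmodP; rewrite /= FracField.equivfE /FracField.mulf.
by rewrite !numden_Ratio ?mulf_neq0 ?oner_eq0 ?denom_ratioP // !mulr1 mulrC.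
Qed.

Lemma reduced_form_exists (x : {fraction R}) : exists nd, is_reduced_form x nd.
Proof.
have [n [d [d0 ->]]] := fraction_quotient x.
have [g gg] := gcdR n d.
have g0 : g != 0.
  by case: gg => _ [y Ed] _; apply: contraNneq d0 => g0; rewrite Ed g0 mulr0.
have [n' [d' [En Ed c]]] := gcd_cofactors gg g0.
have d'0 : d' != 0 by apply: contraNneq d0 => d'0; rewrite Ed d'0 mulr0.
exists (n', d'); split=> //=; rewrite En Ed !rmorphM /= -mulf_div divff ?mul1r //.
by rewrite tofrac_eq0.
Qed.

Lemma reduced_formP (x : {fraction R}) : is_reduced_form x (rnum x, rden x).
Proof.
have [nd H] := reduced_form_exists x.
have : is_reduced_form x (reduced_form x) by apply: xgetI; exact: H.
by rewrite /rnum /rden -surjective_pairing.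
Qed.

Lemma gcd_eltP p q : is_gcd p q (gcd_elt p q).
Proof. by have [d gd] := gcdR p q; apply: xgetI; exact: gd. Qed.

End GcdDomain.

(** * Gauss's lemma: polynomials over a gcd domain *)

Section Gauss.
Variable R : idomainType.
Hypothesis gcdR : gcd_domain R.
Implicit Types (c d : R) (p q : {poly R}).

Definition primitive p := forall c, divides c%:P p -> c \is a GRing.unit.

Lemma divides_polyC c p : divides c%:P p <-> forall i, divides c p`_i.
Proof.
split=> [[q ->] i|cp]; first by exists q`_i; rewrite coefMC.
have /choice[f Ef] : forall i, exists x, p`_i = x * c by move=> i; apply: cp.
exists (\poly_(i < size p) f i); apply/polyP => i; rewrite coefMC coef_poly.
by case: ltnP => [_|/leq_sizeP/(_ i (leqnn i))->]; rewrite ?mul0r.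
Qed.

Lemma content_exists p : exists c, divides c%:P p /\
  forall d, divides d%:P p -> divides d c.
Proof.
elim/poly_ind: p => [|p a [c [cp cM]]].
  exists 0; split; first by exists 0; rewrite mul0r.
  by move=> d _; apply: divides0.
have [e [ec ea eM]] := gcdR c a; exists e; split.
  apply/divides_polyC => i; rewrite coefD coefMX coefC.
  case: i => [|i] /=; first by rewrite add0r.
  by rewrite addr0; move/divides_polyC: cp => /(_ i); apply: divides_trans.
move=> d /divides_polyC dp; apply: eM.
  apply: cM; apply/divides_polyC => i.
  by have := dp i.+1; rewrite coefD coefMX coefC /= addr0.
by have := dp 0%N; rewrite coefD coefMX coefC /= add0r.
Qed.

Lemma primitive_part p : p != 0 -> exists c q, [/\ p = c *: q, primitive q &
  forall d, divides d%:P p -> divides d c].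
Proof.
move=> p0; have [c [[q Ep] cM]] := content_exists p.
have c0 : c != 0 by apply: contraNneq p0 => c0; rewrite Ep c0 mulr0.
exists c, q; split=> //; first by rewrite Ep mulrC mul_polyC.
move=> d [r Eq]; have : divides (d * c) c.
  by apply: cM; rewrite Ep Eq -mulrA -polyCM; apply: divides_mulll.
move=> [x]; rewrite mulrA -{1}[c]mul1r => /(mulIf c0) E.
by apply/unitrP; exists x; rewrite -E mulrC E.
Qed.

Lemma primitive_neq0 p : primitive p -> p != 0.
Proof.
move=> pp; apply/eqP => p0; have := pp 0; rewrite unitr0 => H.
by have := H _; rewrite p0; case/(_ (divides0 _))/notF.
Qed.

Lemma primitive_divides_scale p c d :
  primitive p -> divides d%:P (c *: p) -> divides d c.
Proof.
move=> pp /divides_polyC dcp; have [g gg] := gcdR d c.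
have [g0|g0] := eqVneq g 0.
  by case: gg => _; rewrite g0 => -[x ->] _; rewrite mulr0; apply: divides0.
have [d' [c' [Ed Ec cop]]] := gcd_cofactors gg g0.
have Ud' : d' \is a GRing.unit.
  apply: pp; apply/divides_polyC => i; apply: (coprime_divides gcdR cop).
  by apply: (divides_mul2l g0); rewrite -Ed mulrA -Ec -coefZ.
by rewrite Ed Ec; apply: divides_mul; [apply: divides_refl|apply: unit_divides].
Qed.

(** If a constant [d] divides [p q] and the leading coefficient of [p], it divides
    [(p - r) q] for the leading term [r] of [p], hence [p - r] by induction, hence
    [p], and is a unit. So a constant dividing [p q] is prime to both leading
    coefficients, while it divides their product. *)
Lemma primitive_mul p q : primitive p -> primitive q -> primitive (p * q).
Proof.
move: {2}(size p + size q)%N (leqnn (size p + size q)) => n.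
elim: n p q => [|n IH] p q sz pp pq c cpq.
  move: sz; rewrite leqn0 addn_eq0 size_poly_eq0 => /andP[/eqP p0 _].
  by have := primitive_neq0 pp; rewrite p0 eqxx.
have key (p' q' : {poly R}) d : (size p' + size q' <= n.+1)%N -> primitive p' ->
    primitive q' -> divides d%:P (p' * q') -> divides d (lead_coef p') ->
    d \is a GRing.unit.
  move=> sz' pp' pq' dpq dlp; apply: (pp').
  have E := addrNK (lead_coef p' *: 'X^((size p').-1)) p'.
  set r := p' - _ in E.
  have dlX : divides d%:P (lead_coef p' *: 'X^((size p').-1)).
    by rewrite -mul_polyC; apply: divides_mulr; case: dlp => x ->; exists x%:P;
       rewrite polyCM.
  rewrite -E; apply: dividesD => //.
  have [->|r0] := eqVneq r 0; first exact: divides0.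
  have [e [r' [Er pr' eM]]] := primitive_part r0.
  have sr : (size r < size p')%N.
    have p'0 := primitive_neq0 pp'.
    rewrite -[leqRHS]prednK ?lt0n ?size_poly_eq0 // ltnS.
    apply/leq_sizeP => j lej; rewrite coefB coefZ coefXn.
    move: lej; rewrite leq_eqVlt => /predU1P[<-|ltj].
      by rewrite eqxx mulr1 -lead_coefE subrr.
    rewrite gtn_eqF // mulr0 subr0; apply/leq_sizeP: ltj.
    by rewrite prednK ?lt0n ?size_poly_eq0.
  have e0 : e != 0 by apply: contraNneq r0 => e0; rewrite Er e0 scale0r.
  have pr'q : primitive (r' * q').
    apply: IH => //; rewrite -ltnS; apply: leq_trans sz'; rewrite ltn_add2r.
    by rewrite -(size_scale r' e0) -Er.
  have drq : divides d%:P (r * q').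
    rewrite mulrBl; apply: dividesB => //; exact: divides_mulr.
  suff : divides d e.
    move=> de; rewrite Er -mul_polyC; apply: divides_mulr.
    exact: (divides_rmorph polyC).
  by apply: (primitive_divides_scale pr'q); rewrite scalerAl -Er.
have p0 := primitive_neq0 pp; have q0 := primitive_neq0 pq.
have lead_unit d : divides d c -> divides d (lead_coef p) ->
    d \is a GRing.unit.
  move=> dc dl; apply: (key p q) => //; apply: divides_trans cpq.
  exact: (divides_rmorph polyC).
have lead_unit' d : divides d c -> divides d (lead_coef q) ->
    d \is a GRing.unit.
  move=> dc dl; apply: (key q p) => //; rewrite 1?addnC // mulrC.
  apply: divides_trans cpq; exact: (divides_rmorph polyC).
apply: (coprime_mul gcdR lead_unit lead_unit') => //; first exact: divides_refl.
by rewrite -lead_coefM; move/divides_polyC: cpq; apply.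
Qed.

Lemma primitive_divides p q a : primitive p -> a != 0 ->
  divides p (a *: q) -> divides p q.
Proof.
move=> pp a0 [r Er].
have [r0|r0] := eqVneq r 0.
  move/eqP: Er; rewrite r0 mul0r scale_poly_eq0 (negPf a0) => /eqP ->.
  exact: divides0.
have [c [r' [Er' pr' _]]] := primitive_part r0.
have [x Ec] : divides a c.
  apply: (primitive_divides_scale (primitive_mul pr' pp)).
  by rewrite scalerAl -Er' -Er -mul_polyC; apply: divides_mullr.
exists (x *: r'); have aP0 : a%:P != 0 by rewrite polyC_eq0.
apply: (mulfI aP0); rewrite !mul_polyC Er Er' Ec.
by rewrite -!scalerAl scalerA mulrC.
Qed.

(** The gcd is the gcd of the contents times the primitive part of a gcd over
    the fraction field. *)
Lemma gcd_domain_poly : gcd_domain {poly R}.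
Proof.
move=> f g; have [->|f0] := eqVneq f 0.
  by exists g; split=> //; [apply: divides0 | apply: divides_refl].
have [->|g0] := eqVneq g 0.
  by exists f; split=> //; [apply: divides_refl | apply: divides0].
have [c [f1 [Ef pf cM]]] := primitive_part f0.
have [c' [g1 [Eg pg c'M]]] := primitive_part g0.
have e0 : gcdp f1 g1 != 0 by rewrite gcdp_eq0 (negPf (primitive_neq0 pf)).
have [k [e1 [Ee pe _]]] := primitive_part e0.
have dvd_divides (u v : {poly R}) : primitive u -> u %| v -> divides u v.
  move=> pu /Pdiv.Idomain.dvdpP[[a b] /= a0 E]; apply: (primitive_divides pu a0).
  by rewrite E; apply: divides_mulll.
have k0 : k != 0 by apply: contraNneq e0 => k0; rewrite Ee k0 scale0r.
have e1e : e1 %| gcdp f1 g1 by rewrite Ee dvdpZr.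
have e1f : divides e1 f1 by apply: dvd_divides => //; rewrite (dvdp_trans e1e) ?dvdp_gcdl.
have e1g : divides e1 g1 by apply: dvd_divides => //; rewrite (dvdp_trans e1e) ?dvdp_gcdr.
have [d [dc dc' dM]] := gcdR c c'.
have scale_mul (u : R) (v : {poly R}) : u *: v = u%:P * v by rewrite mul_polyC.
exists (d *: e1); split.
- by rewrite Ef !scale_mul; apply: divides_mul => //; apply: (divides_rmorph polyC).
- by rewrite Eg !scale_mul; apply: divides_mul => //; apply: (divides_rmorph polyC).
move=> w wf wg; have w0 : w != 0.
  by case: wf => x E; apply: contraNneq f0 => w0; rewrite E w0 mulr0.
have [a [w1 [Ew pw _]]] := primitive_part w0.
rewrite Ew !scale_mul; apply: divides_mul.
  apply: (divides_rmorph polyC); apply: dM; [apply: cM | apply: c'M].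
    by apply: divides_trans wf; rewrite Ew scale_mul; apply: divides_mullr.
  by apply: divides_trans wg; rewrite Ew scale_mul; apply: divides_mullr.
have w1w : divides w1 w by rewrite Ew scale_mul; apply: divides_mulll.
have prim_dvd (u v : {poly R}) (b : R) : b != 0 -> divides w1 (b *: u) -> w1 %| u.
  move=> b0 /(primitive_divides pw b0)[x ->]; exact: dvdp_mulIr.
have c0 : c != 0 by apply: contraNneq f0 => c0; rewrite Ef c0 scale0r.
have c'0 : c' != 0 by apply: contraNneq g0 => c0'; rewrite Eg c0' scale0r.
apply: dvd_divides => //; rewrite -(dvdpZr _ _ k0) -Ee dvdp_gcd.
apply/andP; split.
  by apply: (prim_dvd _ 0 c) => //; rewrite -Ef; apply: divides_trans wf.
by apply: (prim_dvd _ 0 c') => //; rewrite -Eg; apply: divides_trans wg.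
Qed.

End Gauss.

(** * Polynomials in several variables *)

Lemma mpoly_rmorph_ext n (R S : nzRingType) (f g : {rmorphism {mpoly R[n]} -> S}) :
  (forall c, f c%:MP = g c%:MP) -> (forall i, f 'X_i = g 'X_i) -> f =1 g.
Proof.
move=> fgC fgX p; rewrite (mpolyE p) !rmorph_sum; apply: eq_bigr => m _ /=.
rewrite -mul_mpolyC !rmorphM fgC mpolyXE_id !rmorph_prod; congr (_ * _).
by apply: eq_bigr => i _; rewrite !rmorphXn fgX.
Qed.

Lemma mmapXU n (R : nzRingType) (S : comNzRingType) (f : {rmorphism R -> S})
  (h : 'I_n -> S) i : mmap f h 'X_i = h i.
Proof. by rewrite mmapX mmap1U. Qed.

Section HeadPoly.
Variables (R : comNzRingType) (n : nat).

Let head_var (i : 'I_n.+1) : {poly {mpoly R[n]}} :=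
  if unlift ord0 i is Some j then ('X_j)%:P else 'X.

Definition head_poly : {mpoly R[n.+1]} -> {poly {mpoly R[n]}} :=
  mmap (polyC \o @mpolyC n R) head_var.

HB.instance Definition _ := GRing.RMorphism.copy head_poly
  (mmap (polyC \o @mpolyC n R) head_var).

Lemma head_polyC c : head_poly c%:MP = c%:MP%:P.
Proof. by rewrite /head_poly mmapC. Qed.

Lemma head_polyX0 : head_poly 'X_ord0 = 'X.
Proof. by rewrite /head_poly mmapXU /head_var unlift_none. Qed.

Lemma head_polyXl j : head_poly 'X_(lift ord0 j) = ('X_j)%:P.
Proof. by rewrite /head_poly mmapXU /head_var liftK. Qed.

Definition weaken : {mpoly R[n]} -> {mpoly R[n.+1]} :=
  mmap (@mpolyC n.+1 R) (fun j => 'X_(lift ord0 j)).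

HB.instance Definition _ := GRing.RMorphism.copy weaken
  (mmap (@mpolyC n.+1 R) (fun j => 'X_(lift ord0 j))).

Definition unhead : {poly {mpoly R[n]}} -> {mpoly R[n.+1]} :=
  horner_eval 'X_ord0 \o map_poly weaken.

HB.instance Definition _ := GRing.RMorphism.copy unhead
  (horner_eval 'X_ord0 \o map_poly weaken).

Lemma unheadC c : unhead c%:P = weaken c.
Proof. by rewrite /unhead /= map_polyC /horner_eval hornerC. Qed.

Lemma unheadX : unhead 'X = 'X_ord0.
Proof. by rewrite /unhead /= map_polyX /horner_eval hornerX. Qed.

Lemma head_polyK : cancel head_poly unhead.
Proof.
apply: (mpoly_rmorph_ext (f := unhead \o head_poly) (g := idfun)) => [c|i] /=.
  by rewrite head_polyC unheadC /weaken mmapC.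
case: (unliftP ord0 i) => [j|] ->.
  by rewrite head_polyXl unheadC /weaken mmapXU.
by rewrite head_polyX0 unheadX.
Qed.

Lemma head_weaken p : head_poly (weaken p) = p%:P.
Proof.
apply: (mpoly_rmorph_ext (f := head_poly \o weaken) (g := polyC)) => [c|i] /=.
  by rewrite /weaken mmapC head_polyC.
by rewrite /weaken mmapXU head_polyXl.
Qed.

Lemma unheadK : cancel unhead head_poly.
Proof.
elim/poly_ind => [|P c IH]; first by rewrite !rmorph0.
by rewrite !rmorphD !rmorphM /= IH unheadX head_polyX0 unheadC head_weaken.
Qed.

End HeadPoly.

(** The image under [g] of a gcd in [B] is a gcd in [A], since divisibility is
    carried over by [f] and [g]. *)
Lemma gcd_domain_retract (A B : idomainType) (f : {rmorphism A -> B})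
  (g : {rmorphism B -> A}) : cancel f g -> gcd_domain B -> gcd_domain A.
Proof.
move=> fK gcdB p q; have [d [dp dq dM]] := gcdB (f p) (f q).
exists (g d); split; first by rewrite -(fK p); apply: divides_rmorph.
  by rewrite -(fK q); apply: divides_rmorph.
move=> e ep eq; rewrite -(fK e).
by apply/divides_rmorph/dM; apply: divides_rmorph.
Qed.

Lemma gcd_domain_mpoly (R : idomainType) n :
  gcd_domain R -> gcd_domain {mpoly R[n]}.
Proof.
move=> gcdR; elim: n => [|n IH].
  apply: (@gcd_domain_retract _ _ (mcoeff 0%MM) (@mpolyC 0 R)) gcdR.
  exact: mpolyKC.
apply: (gcd_domain_retract (@head_polyK R n)); exact: gcd_domain_poly.
Qed.

Lemma gcd_domain_field (F : fieldType) : gcd_domain F.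
Proof.
move=> p q; have [->|p0] := eqVneq p 0.
  by exists q; split=> //; [apply: divides0 | apply: divides_refl].
exists 1; split; [exists p|exists q|]; rewrite ?mulr1 //.
move=> e [x Ep] _; apply: unit_divides; rewrite unitfE.
by apply: contraNneq p0 => e0; rewrite Ep e0 mulr0.
Qed.

Lemma gcd_domain_mpolyF (F : fieldType) n : gcd_domain {mpoly F[n]}.
Proof. exact/gcd_domain_mpoly/gcd_domain_field. Qed.

Definition cons_fun (T : Type) n (x : T) (v : 'I_n -> T) (i : 'I_n.+1) : T :=
  if unlift ord0 i is Some j then v j else x.

Lemma mmap_cons (R : comNzRingType) (S : comNzRingType) (k : {rmorphism R -> S}) n (x : S)
    (v : 'I_n -> S) (p : {mpoly R[n.+1]}) :
  mmap k (cons_fun x v) p = (map_poly (mmap k v) (head_poly p)).[x].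
Proof.
apply: (mpoly_rmorph_ext (f := mmap k (cons_fun x v))
  (g := horner_eval x \o map_poly (mmap k v) \o @head_poly R n)) => [c|i] /=.
  by rewrite head_polyC map_polyC /= !mmapC /horner_eval hornerC.
rewrite mmapXU /cons_fun /horner_eval; case: (unliftP ord0 i) => [j|] ->.
  by rewrite head_polyXl map_polyC /= mmapXU hornerC.
by rewrite head_polyX0 map_polyX hornerX.
Qed.

Definition cons_pt (K : fieldType) n (x : K) (v : affpt K n) : affpt K n.+1 :=
  [ffun i => cons_fun x v i].

Lemma meval_cons (K : fieldType) n (x : K) (v : affpt K n)
    (p : {mpoly K[n.+1]}) :
  p.@[cons_pt x v] = (map_poly (meval v) (head_poly p)).[x].
Proof. by rewrite -[RHS]mmap_cons; apply: meval_eq => i; rewrite ffunE. Qed.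

Lemma map_meval_eq0 (K : fieldType) n (v : affpt K n) (P : {poly {mpoly K[n]}}) :
  map_poly (meval v) P = 0 <-> forall i, (P`_i).@[v] = 0.
Proof.
split=> [E i|E]; last by apply/polyP => i; rewrite coef_map coef0 /= E.
by rewrite -(coef_map (meval v)) E coef0.
Qed.

Lemma mpoly_neq0_point (K : closedFieldType) n (p : {mpoly K[n]}) :
  p != 0 -> exists v : affpt K n, p.@[v] != 0.
Proof.
elim: n p => [|n IH] p p0.
  exists [ffun=> 0]; rewrite (nvar0_mpolyC p) mevalC.
  by apply: contraNneq p0 => E; rewrite (nvar0_mpolyC p) E.
have P0 : head_poly p != 0.
  by apply: contraNneq p0 => E; rewrite -(head_polyK p) E rmorph0.
have /IH[v Lv] : lead_coef (head_poly p) != 0 by rewrite lead_coef_eq0.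
have /closed_nonrootP[x nrx] : map_poly (meval v) (head_poly p) != 0.
  by apply: contraNneq Lv => /map_meval_eq0; rewrite lead_coefE => ->.
by exists (cons_pt x v); rewrite meval_cons.
Qed.

Lemma mpoly_eq0_points (K : closedFieldType) n (p : {mpoly K[n]}) :
  (forall v : affpt K n, p.@[v] = 0) -> p = 0.
Proof.
move=> pv; apply/eqP; apply/negP => /negP /mpoly_neq0_point[v].
by rewrite pv eqxx.
Qed.

(** * The ideal of an irreducible hypersurface *)

Lemma irreducible_weaken (R : idomainType) n (c : {mpoly R[n]}) :
  irreducible_elt (weaken c) -> irreducible_elt c.
Proof.
have Uw (p : {mpoly R[n]}) : weaken p \is a GRing.unit -> p \is a GRing.unit.
  move=> Uwp; have : head_poly (weaken p) \is a GRing.unit.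
    exact: rmorph_unit.
  by rewrite head_weaken poly_unitE coefC eqxx /= => /andP[].
move=> [c0 nUc irr]; split.
- by apply: contraNneq c0 => ->; rewrite rmorph0.
- by apply: contraNN nUc => Uc; apply: rmorph_unit.
- move=> q r E; have : weaken c = weaken q * weaken r by rewrite E rmorphM.
  by case/irr => /Uw; [left|right].
Qed.

Lemma divides_head_poly (R : idomainType) n (p q : {mpoly R[n.+1]}) :
  divides (head_poly p) (head_poly q) <-> divides p q.
Proof.
split=> [[x E]|[x ->]]; last by exists (head_poly x); rewrite rmorphM.
by exists (unhead x); rewrite -(head_polyK q) E rmorphM /= head_polyK.
Qed.

(** Elimination of the variable: over the field of fractions, a constant gcd is a
    combination of [p] and [q]; the scalars come from clearing denominators. *)
Lemma common_factor_or_bezout (R : idomainType) (p q : {poly R}) : p != 0 ->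
  (exists (u v : {poly R}) (r : R), r != 0 /\ u * p + v * q = r%:P) \/
  (exists (e x y : {poly R}) (a b : R), [/\ (1 < size e)%N, a != 0, b != 0,
     a *: p = x * e & b *: q = y * e]).
Proof.
move=> p0; have e0 : gcdp p q != 0 by rewrite gcdp_eq0 (negPf p0).
case: (leqP (size (gcdp p q)) 1) => sz_e; [left | right]; last first.
  have /Pdiv.Idomain.dvdpP[[a x] /= a0 Ep] := dvdp_gcdl p q.
  have /Pdiv.Idomain.dvdpP[[b y] /= b0 Eq] := dvdp_gcdr p q.
  by exists (gcdp p q), x, y, a, b.
have [[u v] /= Euv] := Pdiv.Idomain.Bezoutp p q.
have /Pdiv.Idomain.eqpP[[c d] /= /andP[c0 d0] E] := Euv.
have Ee := size1_polyC sz_e; set r := (gcdp p q)`_0 in Ee.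
exists (c *: u), (c *: v), (d * r); split.
  by rewrite mulf_neq0 //; apply: contraNneq e0 => r0; rewrite Ee r0.
by rewrite -!scalerAl -scalerDr E Ee -mul_polyC polyCM.
Qed.

Lemma bezout_common_root (R S : comNzRingType) (h : {rmorphism R -> S})
    (u v p q : {poly R}) r x : u * p + v * q = r%:P ->
  (map_poly h p).[x] = 0 -> (map_poly h q).[x] = 0 -> h r = 0.
Proof.
move=> /(congr1 (map_poly h))/(congr1 (horner^~ x)).
rewrite rmorphD !rmorphM /= hornerD !hornerM map_polyC hornerC => <- -> ->.
by rewrite !mulr0 addr0.
Qed.

(** By induction on the number of variables: if [f] involves the first variable
    and does not divide [w], Bezout over the field of fractions of the others
    eliminates this variable, and a root of [f] above a point where the
    eliminant does not vanish is a zero of [f] but not of [w]. *)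
Lemma vanishing_divides (K : closedFieldType) n (f w : {mpoly K[n]}) :
  irreducible_elt f -> (forall v : affpt K n, f.@[v] = 0 -> w.@[v] = 0) ->
  divides f w.
Proof.
elim: n f w => [|n IH] f w irr fw.
  case: irr => f0 /negP[]; rewrite (nvar0_mpolyC f).
  apply: rmorph_unit; rewrite unitfE.
  by apply: contraNneq f0 => E; rewrite (nvar0_mpolyC f) E.
have gcdK := @gcd_domain_mpolyF K n.+1.
set F := head_poly f; set W := head_poly w.
apply/divides_head_poly; rewrite -/F -/W.
case: (leqP (size F) 1) => [/size1_polyC EF|szF].
  set c := F`_0 in EF.
  have Ef : f = weaken c by rewrite -(head_polyK f) -/F EF unheadC.
  have irrc : irreducible_elt c by apply: irreducible_weaken; rewrite -Ef.
  rewrite EF; apply/divides_polyC => i.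
  apply: IH => // v cv; apply: (map_meval_eq0 v W).1; apply/eqP/negPn/negP.
  move=> /closed_nonrootP[x]; rewrite /root -meval_cons fw ?eqxx //.
  by rewrite Ef meval_cons head_weaken map_polyC hornerC.
have F_prime P Q : divides F (P * Q) -> divides F P \/ divides F Q.
  rewrite -(unheadK P) -(unheadK Q) -rmorphM.
  move=> /divides_head_poly/(irreducible_prime gcdK irr)[] /divides_head_poly.
    by left.
  by right.
have F_scale c P : c != 0 -> divides F (c *: P) -> divides F P.
  rewrite -mul_polyC => c0 /F_prime[[Q EQ]|//].
  have := congr1 (fun P : {poly _} => size P) EQ; rewrite size_polyC c0.
  have Q0 : Q != 0.
    by apply: contraNneq c0 => Q0; rewrite -polyC_eq0 EQ Q0 mul0r.
  have F0 : F != 0 by rewrite -size_poly_gt0 ltnW.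
  rewrite size_mul //= -(prednK (_ : 0 < size Q)%N) ?size_poly_gt0 //.
  by case: (size F) szF => [|[|k]] //=; rewrite !addnS.
have F0 : F != 0 by rewrite -size_poly_gt0 ltnW.
case: (common_factor_or_bezout W F0) => [[u [v [r [r0 E]]]]|].
  have rL : r * lead_coef F != 0 by rewrite mulf_neq0 // lead_coef_eq0.
  have [pt] := mpoly_neq0_point rL.
  rewrite mevalM mulf_eq0 negb_or => /andP[rpt Lpt].
  have szFv : size (map_poly (meval pt) F) != 1%N.
    by rewrite size_map_poly_id0 // neq_ltn szF orbT.
  have /closed_rootP[x rx] := szFv.
  have f_pt : f.@[cons_pt x pt] = 0 by rewrite meval_cons; apply/eqP.
  have := fw _ f_pt; rewrite meval_cons -/W => Wx.
  case/negP: rpt; apply/eqP; apply: (bezout_common_root E _ Wx).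
  by apply/eqP.
move=> [e [q [q' [a [b [sz_e a0 b0 EF EW]]]]]].
have : divides F (q * e) by rewrite -EF -mul_polyC; apply: divides_mulll.
case/F_prime => [[s Es]|Fe].
  exfalso; move: sz_e; rewrite ltnNge => /negP; apply.
  have : a%:P * F = (s * e) * F by rewrite mul_polyC EF Es mulrAC.
  move/(mulIf F0) => Ea; have se0 : s * e != 0 by rewrite -Ea polyC_eq0.
  move: se0; rewrite mulf_eq0 negb_or => /andP[s0 e0].
  have : size (s * e) = 1%N by rewrite -Ea size_polyC a0.
  by rewrite size_mul // -(prednK (_ : 0 < size s)%N) ?size_poly_gt0 //= => <-;
     rewrite leq_addl.
by apply: (F_scale b) => //; rewrite EW; apply: divides_mull.
Qed.

(** * Specialization of rational functions at a point *)

Section Specialization.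
Variables (K M : fieldType) (k : {rmorphism K -> M}) (n : nat).
Variables (Q : 'I_n -> M) (p : 'I_n -> K).

(** The point [p] satisfies every polynomial relation between the [Q i]; then
    [Q i |-> p i] extends to the local ring of [p] in [k(Q)]. *)
Definition specializes := forall w, mmap k Q w = 0 -> w.@[p] = 0.

Definition spec_to (x : M) (c : K) := exists a b,
  [/\ b.@[p] != 0, x = mmap k Q a / mmap k Q b & c = a.@[p] / b.@[p]].

Hypothesis sQp : specializes.

Lemma specializes_neq0 b : b.@[p] != 0 -> mmap k Q b != 0.
Proof. by apply: contraNneq => /sQp ->. Qed.

Lemma spec_to_inj x c c' : spec_to x c -> spec_to x c' -> c = c'.
Proof.
move=> [a [b [b0 Ex ->]]] [a' [b' [b'0 Ex' ->]]].
apply/eqP; rewrite eqr_div // -subr_eq0 -!mevalM -mevalB; apply/eqP/sQp.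
move/eqP: Ex; rewrite Ex' eqr_div ?specializes_neq0 // => /eqP.
by rewrite rmorphB !rmorphM => ->; rewrite subrr.
Qed.

Lemma spec_to_mmap w : spec_to (mmap k Q w) w.@[p].
Proof.
by exists w, 1; rewrite meval1 rmorph1 !divr1; split=> //; apply: oner_neq0.
Qed.

Lemma spec_toC c : spec_to (k c) c.
Proof. by have := spec_to_mmap c%:MP; rewrite mmapC mevalC. Qed.

Lemma spec_toX i : spec_to (Q i) (p i).
Proof. by have := spec_to_mmap 'X_i; rewrite mmapXU mevalXU. Qed.

Lemma spec_toD x y c d : spec_to x c -> spec_to y d -> spec_to (x + y) (c + d).
Proof.
move=> [a [b [b0 -> ->]]] [a' [b' [b'0 -> ->]]].
exists (a * b' + a' * b), (b * b').
by rewrite mevalM mulf_neq0 // !addf_div ?specializes_neq0 // mevalD rmorphD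
           !mevalM !rmorphM.
Qed.

Lemma spec_toM x y c d : spec_to x c -> spec_to y d -> spec_to (x * y) (c * d).
Proof.
move=> [a [b [b0 -> ->]]] [a' [b' [b'0 -> ->]]].
exists (a * a'), (b * b').
by rewrite mevalM mulf_neq0 // !mulf_div !mevalM !rmorphM.
Qed.

Lemma spec_toV x c : c != 0 -> spec_to x c -> spec_to x^-1 c^-1.
Proof.
move=> c0 [a [b [b0 -> Ec]]]; exists b, a; rewrite Ec !invf_div; split=> //.
by apply: contraNneq c0 => a0; rewrite Ec a0 mul0r.
Qed.

Lemma spec_toN x c : spec_to x c -> spec_to (- x) (- c).
Proof.
by rewrite -mulN1r -[- c]mulN1r -(rmorphN1 k); apply: spec_toM; apply: spec_toC.
Qed.

Lemma spec_toB x y c d : spec_to x c -> spec_to y d -> spec_to (x - y) (c - d).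
Proof. by move=> xc yd; apply/spec_toD/spec_toN. Qed.

Lemma spec_to_div x y c d : d != 0 -> spec_to x c -> spec_to y d ->
  spec_to (x / y) (c / d).
Proof. by move=> d0 xc yd; apply/spec_toM/spec_toV. Qed.

Lemma spec_to_sum (I : Type) (r : seq I) (F : I -> M) (G : I -> K) :
  (forall i, spec_to (F i) (G i)) ->
  spec_to (\sum_(i <- r) F i) (\sum_(i <- r) G i).
Proof.
move=> FG; apply: big_ind2 => //; last by move=> *; exact: spec_toD.
by have := spec_toC 0; rewrite rmorph0.
Qed.

Lemma spec_to_prod (I : Type) (r : seq I) (F : I -> M) (G : I -> K) :
  (forall i, spec_to (F i) (G i)) ->
  spec_to (\prod_(i <- r) F i) (\prod_(i <- r) G i).
Proof.
move=> FG; apply: big_ind2 => //; last by move=> *; exact: spec_toM.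
by have := spec_toC 1; rewrite rmorph1.
Qed.

Lemma spec_toXn x c e : spec_to x c -> spec_to (x ^+ e) (c ^+ e).
Proof.
move=> xc; elim: e => [|e IH]; last by rewrite !exprS; apply: spec_toM.
by have := spec_toC 1; rewrite rmorph1.
Qed.

Lemma spec_to_mpoly m (y : 'I_m -> M) (c : 'I_m -> K) (P : {mpoly K[m]}) :
  (forall i, spec_to (y i) (c i)) -> spec_to (mmap k y P) P.@[c].
Proof.
move=> yc; rewrite mevalE /mmap; apply: spec_to_sum => e.
apply: spec_toM; first exact: spec_toC.
by apply: spec_to_prod => i; apply: spec_toXn.
Qed.

Lemma spec_to_horner m (y : 'I_m -> M) (c : 'I_m -> K) x d
    (P : {poly {mpoly K[m]}}) :
  (forall i, spec_to (y i) (c i)) -> spec_to x d ->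
  spec_to (map_poly (mmap k y) P).[x] (map_poly (meval c) P).[d].
Proof.
move=> yc xd; elim/poly_ind: P => [|P a IH].
  by have := spec_toC 0; rewrite !rmorph0 !horner0.
rewrite !rmorphD !rmorphM /= !map_polyX !map_polyC !hornerE.
apply: spec_toD; last exact: spec_to_mpoly.
exact: spec_toM.
Qed.

End Specialization.

Section RationalFunctions.
Variables (K : closedFieldType) (n : nat).
Local Notation M := {fraction {mpoly K[n]}}.
Local Notation "x %:F" := (@FracField.tofrac _ x).

Definition fracC : K -> M := @FracField.tofrac _ \o @mpolyC n K.
HB.instance Definition _ := GRing.RMorphism.copy fracC
  (@FracField.tofrac _ \o @mpolyC n K).

Definition fracX (i : 'I_n) : M := ('X_i)%:F.

Lemma mmap_fracX w : mmap fracC fracX w = w%:F.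
Proof.
apply: (mpoly_rmorph_ext (f := mmap fracC fracX) (g := @FracField.tofrac _)) => [c|i].
  by rewrite /= mmapC.
by rewrite /= mmapXU.
Qed.

Lemma fracX_specializes (v : 'I_n -> K) : specializes fracC fracX v.
Proof.
move=> w /eqP; rewrite mmap_fracX tofrac_eq0 => /eqP ->; exact: meval0.
Qed.

Lemma rnum_rdenP (x : M) : is_reduced_form x (rnum x, rden x).
Proof. apply: reduced_formP; exact: gcd_domain_mpolyF. Qed.

Lemma rden_neq0 (x : M) : rden x != 0.
Proof. by case: (rnum_rdenP x). Qed.

Lemma rnum_div_rden (x : M) : (rnum x)%:F / (rden x)%:F = x.
Proof. by case: (rnum_rdenP x). Qed.

(** The domain of definition of a rational function is its local ring: a fraction
    whose denominator does not vanish at [v] can be reduced. *)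
Lemma spec_to_rden (x : M) (v : affpt K n) c :
  spec_to fracC fracX v x c <->
  (rden x).@[v] != 0 /\ (rnum x).@[v] / (rden x).@[v] = c.
Proof.
split=> [[a [b [b0 Ex Ec]]]|[d0 Ec]]; last first.
  by exists (rnum x), (rden x); rewrite !mmap_fracX rnum_div_rden.
have [/= d0 cop Ex'] := rnum_rdenP x.
have bF0 : b != 0 by apply: contraNneq b0 => ->; rewrite meval0.
move: Ex; rewrite !mmap_fracX {1}Ex' => /eqP.
rewrite eqr_div ?tofrac_eq0 // -!rmorphM tofrac_eq /= => /eqP E.
have [r Er] : divides (rden x) b.
  apply: (coprime_divides (@gcd_domain_mpolyF K n) (coprime_eltsC cop)).
  by rewrite E; apply: divides_mulll.
have dv0 : (rden x).@[v] != 0.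
  by apply: contraNneq b0 => dv0; rewrite Er mevalM dv0 mulr0.
split=> //; rewrite Ec; apply/eqP; rewrite eqr_div //.
by rewrite -!mevalM E.
Qed.

Lemma fibreP m (phi : ratmap K n m) (q : affpt K m) (v : affpt K n) :
  fibre phi q v <-> forall i, spec_to fracC fracX v (phi i) (q i).
Proof.
split=> [[dv Ev] i|H].
  apply/spec_to_rden; split; first exact: dv.
  by rewrite -Ev ffunE.
split; first by move=> i; case/spec_to_rden: (H i).
by apply/ffunP => i; rewrite ffunE; case/spec_to_rden: (H i).
Qed.

End RationalFunctions.

(** * Algebraic dependence by counting dimensions *)

Lemma msizeM_bound (R : idomainType) n (p q : {mpoly R[n]}) i j :
  (msize p <= i.+1)%N -> (msize q <= j.+1)%N -> (msize (p * q) <= (i + j).+1)%N.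
Proof.
have [->|p0] := eqVneq p 0; first by rewrite mul0r msize0.
have [->|q0] := eqVneq q 0; first by rewrite mulr0 msize0.
move=> ip jq; rewrite msizeM //; apply: (@leq_trans (i.+1 + j.+1).-1).
  by rewrite -!subn1 leq_sub2r // leq_add.
by rewrite addnS.
Qed.

Lemma msizeXn_bound (R : idomainType) n (p : {mpoly R[n]}) i e :
  (msize p <= i.+1)%N -> (msize (p ^+ e) <= (e * i).+1)%N.
Proof.
move=> ip; elim: e => [|e IH]; first by rewrite expr0 msize1.
by rewrite exprS mulSn msizeM_bound.
Qed.

Lemma msize_prod_bound (R : idomainType) n (I : Type) (r : seq I)
    (F : I -> {mpoly R[n]}) (d : I -> nat) :
  (forall i, msize (F i) <= (d i).+1)%N ->
  (msize (\prod_(i <- r) F i) <= (\sum_(i <- r) d i).+1)%N.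
Proof.
move=> Fd; elim: r => [|i r IH]; first by rewrite !big_nil msize1.
by rewrite !big_cons msizeM_bound.
Qed.

Lemma common_denominator (R : idomainType) (I : finType) (y : I -> {fraction R}) :
  exists (q : R) (a : I -> R), q != 0 /\
    forall i, y i * FracField.tofrac q = FracField.tofrac (a i).
Proof.
have /choice[nd Hnd] : forall i, exists nd : R * R, nd.2 != 0 /\
    y i = FracField.tofrac nd.1 / FracField.tofrac nd.2.
  by move=> i; have [n [d [d0 E]]] := fraction_quotient (y i); exists (n, d).
exists (\prod_i (nd i).2), (fun i => (nd i).1 * \prod_(j | j != i) (nd j).2).
split=> [|i]; first by apply/prodf_neq0 => i _; case: (Hnd i).
have [d0 ->] := Hnd i; rewrite (bigD1 i) //= !rmorphM mulrA divfK //.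
by rewrite tofrac_eq0.
Qed.

Lemma left_kernel_exists (F : fieldType) m n (A : 'M[F]_(m, n)) :
  (n < m)%N -> exists2 u : 'rV_m, u != 0 & u *m A = 0.
Proof.
move=> nm; have kA : kermx A != 0.
  rewrite -mxrank_eq0 mxrank_ker subn_eq0 -ltnNge.
  by apply: leq_ltn_trans nm; apply: rank_leq_col.
have /rowV0Pn[u uk u0] := kA.
by exists u => //; apply/sub_kermxP.
Qed.

(** Over a common denominator, the monomials with all exponents below [b] are
    [b ^ n.+1] in number, while their values are polynomials of degree linear
    in [b], which form a space of dimension of order [b ^ n]; for large [b] some
    combination of the monomials vanishes at [y]. *)
Lemma algebraic_dependence (K : closedFieldType) n
    (y : 'I_n.+1 -> {fraction {mpoly K[n]}}) :
  exists2 P : {mpoly K[n.+1]}, P != 0 & mmap (@fracC K n) y P = 0.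
Proof.
have [q [a [q0 Ey]]] := common_denominator y.
pose c := (msize q + \max_i msize (a i))%N.
have qc : (msize q <= c.+1)%N by rewrite leqW // leq_addr.
have ac i : (msize (a i) <= c.+1)%N.
  by rewrite leqW // (leq_trans _ (leq_addl _ _)) // (bigmax_sup i).
(* [b * C] bounds the number [N * c + 1] of exponents in each variable of the
   values [T e], and [b] is large enough for [(b * C) ^ n < b ^ n.+1]. *)
pose C := (n.+1 * c + 1)%N; pose b := (C ^ n).+1; pose N := (n.+1 * b)%N.
pose T (e : {ffun 'I_n.+1 -> 'I_b}) : {mpoly K[n]} :=
  q ^+ (N - \sum_i e i) * \prod_i a i ^+ e i.
have sumN (e : {ffun 'I_n.+1 -> 'I_b}) : (\sum_i e i <= N)%N.
  apply: (@leq_trans (\sum_(i < n.+1) b)); last by rewrite sum_nat_const card_ord.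
  by apply: leq_sum => i _; apply: ltnW.
have szT e : (msize (T e) <= (N * c).+1)%N.
  have -> : (N * c = (N - \sum_i e i) * c + \sum_i e i * c)%N.
    by rewrite -big_distrl /= -mulnDl subnK.
  apply: msizeM_bound; first exact: msizeXn_bound.
  by apply: msize_prod_bound => i; apply: msizeXn_bound.
pose rowT (i : 'I_#|{ffun 'I_n.+1 -> 'I_b}|) := T (enum_val i).
pose mon (j : 'I_#|{ffun 'I_n -> 'I_(N * c).+1}|) : 'X_{1..n} :=
  [multinom (enum_val j i : nat) | i < n].
pose A : 'M[K]_(_, _) := \matrix_(i, j) (rowT i)@_(mon j).
have lt_card : (#|{ffun 'I_n -> 'I_(N * c).+1}| < #|{ffun 'I_n.+1 -> 'I_b}|)%N.
  rewrite !card_ffun !card_ord.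
  have le1 : ((N * c).+1 <= b * C)%N.
    by rewrite /N /C mulnDr muln1 -addn1 mulnCA mulnA leq_add2l.
  apply: (@leq_ltn_trans ((b * C) ^ n)).
    by case: (n) => [|n'] //; rewrite leq_exp2r.
  by rewrite expnMn expnSr ltn_pmul2l ?expn_gt0 // /b ltnS.
have [u u0 uA] := left_kernel_exists A lt_card.
pose mn (i : 'I_#|{ffun 'I_n.+1 -> 'I_b}|) : 'X_{1..n.+1} :=
  [multinom (enum_val i j : nat) | j < n.+1].
have mn_inj : injective mn.
  move=> i j /mnmP E; apply: enum_val_inj; apply/ffunP => l; apply: val_inj.
  by have := E l; rewrite !mnmE.
pose P := \sum_i u 0 i *: 'X_[mn i] : {mpoly K[n.+1]}.
exists P.
  have [i ui] : exists i, u 0 i != 0.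
    by move/rV0Pn: u0.
  apply: contraNneq ui => P0; have := congr1 (mcoeff (mn i)) P0.
  rewrite mcoeff0 raddf_sum /= (bigD1 i) //= mcoeffZ mcoeffX eqxx mulr1.
  rewrite big1 ?addr0 => [->//|j ji].
  by rewrite mcoeffZ mcoeffX (inj_eq mn_inj) (negPf ji) mulr0.
have sumT : \sum_i u 0 i *: rowT i = 0.
  apply/mpolyP => m; rewrite mcoeff0.
  have [lem|gtm] := boolP [forall i, m i < (N * c).+1]%N; last first.
    have [i] := forallPn gtm; rewrite -leqNgt => lei.
    rewrite raddf_sum /= big1 // => j _; rewrite mcoeffZ memN_msupp_eq0 ?mulr0 //.
    apply: msize_mdeg_ge; apply: leq_trans (szT _) _; apply: leq_trans lei _.
    by rewrite mdegE (bigD1 i) //= leq_addr.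
  pose g : {ffun 'I_n -> 'I_(N * c).+1} := [ffun i => inord (m i)].
  have Em : m = mon (enum_rank g).
    apply/mnmP => i; rewrite mnmE enum_rankK ffunE inordK //.
    by move/forallP: lem.
  have := congr1 (fun B : 'rV_ _ => B 0 (enum_rank g)) uA.
  rewrite !mxE raddf_sum /= => {2}<-; apply: eq_bigr => i _.
  by rewrite mxE mcoeffZ Em.
have qF0 : FracField.tofrac q != 0 by rewrite tofrac_eq0.
have valT i : mmap (@fracC K n) y 'X_[mn i] * FracField.tofrac q ^+ N =
    FracField.tofrac (rowT i).
  rewrite mmapX /mmap1 /rowT /T rmorphM rmorph_prod rmorphXn /=.
  rewrite -{1}(subnK (sumN (enum_val i))) exprD mulrCA; congr (_ * _).
  rewrite -prodrXr -big_split /=; apply: eq_bigr => j _.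
  by rewrite mnmE -exprMn Ey rmorphXn.
apply: (mulIf (expf_neq0 N qF0)); rewrite mul0r raddf_sum mulr_suml.
transitivity (FracField.tofrac (\sum_i u 0 i *: rowT i)); last first.
  by rewrite sumT rmorph0.
rewrite rmorph_sum /=.
by apply: eq_bigr => i _; rewrite mmapZ -mulrA valT -mul_mpolyC [RHS]rmorphM.
Qed.

(** * Clearing denominators *)

Lemma eq_mmap n (R S : nzRingType) (k : R -> S) (h h' : 'I_n -> S) p :
  h =1 h' -> mmap k h p = mmap k h' p.
Proof. by move=> hh; apply: eq_bigr => e _; rewrite (mmap1_eq _ hh). Qed.

Lemma cons_fun_eta (T : Type) n (v : 'I_n.+1 -> T) :
  cons_fun (v ord0) (fun j => v (lift ord0 j)) =1 v.
Proof. by move=> i; rewrite /cons_fun; case: unliftP => [j|] ->. Qed.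

(** The value [q ^+ N * P (p / q)], for [N] at least the degree of [P]. *)
Definition cleared (K : nzRingType) (A : comNzRingType) (k : K -> A) m
    (P : {mpoly K[m]}) (N : nat) (q : A) (p : 'I_m -> A) : A :=
  \sum_(e <- msupp P) k P@_e * mmap1 p e * q ^+ (N - mdeg e).

Section Cleared.
Variables (K : nzRingType) (m : nat) (P : {mpoly K[m]}) (N : nat).
Hypothesis PN : (msize P <= N.+1)%N.

Lemma cleared_rmorph (A B : comNzRingType) (j : {rmorphism A -> B}) (k : K -> A)
    q p : j (cleared k P N q p) = cleared (j \o k) P N (j q) (j \o p).
Proof.
rewrite rmorph_sum; apply: eq_bigr => e _; rewrite !rmorphM rmorphXn /=.
by congr (_ * _ * _); rewrite rmorph_prod; apply: eq_bigr => i _; rewrite rmorphXn.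
Qed.

Lemma eq_cleared (A : comNzRingType) (k k' : K -> A) q (p p' : 'I_m -> A) :
  k =1 k' -> p =1 p' -> cleared k P N q p = cleared k' P N q p'.
Proof.
by move=> kk pp; apply: eq_bigr => e _; rewrite kk (mmap1_eq _ pp).
Qed.

Lemma cleared_field (M : fieldType) (k : K -> M) q p : q != 0 ->
  cleared k P N q p = q ^+ N * mmap k (fun i => p i / q) P.
Proof.
move=> q0; rewrite mulr_sumr; apply: eq_big_seq => e eP.
have de : (mdeg e <= N)%N by rewrite -ltnS (leq_trans _ PN) // msize_mdeg_lt.
have -> : mmap1 p e = q ^+ mdeg e * mmap1 (fun i => p i / q) e.
  rewrite mdegE -prodrXr -big_split /=.
  by apply: eq_bigr => i _; rewrite -exprMn mulrC divfK.
by rewrite -{2}(subnK de) exprD; ring.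
Qed.

Lemma divides_congrM (A : idomainType) (g a b c d : A) :
  divides g (a - b) -> divides g (c - d) -> divides g (a * c - b * d).
Proof.
move=> gab gcd; have -> : a * c - b * d = (a - b) * c + b * (c - d).
  by rewrite mulrBl mulrBr addrA subrK.
by apply: dividesD; [apply: divides_mulr | apply: divides_mull].
Qed.

Lemma divides_congr_prod (A : idomainType) (g : A) n (a b : 'I_n -> A)
    (e : 'I_n -> nat) : (forall i, divides g (a i - b i)) ->
  divides g (\prod_i a i ^+ e i - \prod_i b i ^+ e i).
Proof.
move=> gab; apply: (big_ind2 (fun x y => divides g (x - y))).
- by rewrite subrr; apply: divides0.
- by move=> *; apply: divides_congrM.
move=> i _; elim: (e i) => [|k IH]; first by rewrite subrr; apply: divides0.
by rewrite !exprS; apply: divides_congrM.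
Qed.

Lemma cleared_congr (A : idomainType) (k : K -> A) g q q' p p' :
  (forall i, divides g (p i * q' - p' i * q)) ->
  divides g (q' ^+ N * cleared k P N q p - q ^+ N * cleared k P N q' p').
Proof.
move=> gpq; rewrite !mulr_sumr -sumrB [X in divides _ X]big_seq.
apply: divides_sum => e eP.
have de : (mdeg e <= N)%N by rewrite -ltnS (leq_trans _ PN) // msize_mdeg_lt.
have E (x y : A) (v : 'I_m -> A) : y ^+ N * (k P@_e * mmap1 v e * x ^+ (N - mdeg e)) =
    k P@_e * (x * y) ^+ (N - mdeg e) * \prod_i (v i * y) ^+ e i.
  rewrite -{1}(subnK de) exprD exprMn.
  have -> : \prod_i (v i * y) ^+ e i = mmap1 v e * y ^+ mdeg e.
    rewrite mdegE -prodrXr -big_split /=.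
    by apply: eq_bigr => i _; rewrite exprMn.
  by ring.
rewrite !E [q' * q]mulrC -mulrBr; apply: divides_mull.
exact: divides_congr_prod.
Qed.

End Cleared.

(** * The gcd of the numerators of chi(t,s) - chi(h) *)

Lemma closed_uniq_seq (K : closedFieldType) m :
  exists2 s : seq K, uniq s & size s = m.
Proof.
elim: m => [|m [s us ss]]; first by exists [::].
have /closed_nonrootP[x] : \prod_(z <- s) ('X - z%:P) != 0 :> {poly K}.
  by rewrite monic_neq0 // monic_prod_XsubC.
rewrite root_prod_XsubC => xs; exists (x :: s); rewrite /= ?ss //.
by rewrite us andbT.
Qed.

Lemma cancel_denominator (F : fieldType) (a b c d e : F) :
  d != 0 -> a * b * c * e = a * (e * d) * (b * (c / d)).
Proof. by move=> d0; field. Qed.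

Lemma clear_denominators (R : comNzRingType) (a g w t r D c U V : R) j :
  g * w * t = D * r -> c * U = D ^+ j * V ->
  w ^+ j * (a * g ^+ j * t ^+ j * V) = r ^+ j * c * (a * U).
Proof.
move=> E EV; transitivity (a * (g * w * t) ^+ j * V).
  by rewrite !exprMn; ring.
rewrite E exprMn (_ : r ^+ j * c * (a * U) = r ^+ j * a * (c * U)); last by ring.
by rewrite EV; ring.
Qed.

(** The rings [A] and [S] stand for [K[h_1,h_2]] and [K[h_1,h_2][t,s]], with the
    two copies [its] and [ih] of [A] in [S], restriction to the diagonal, and the
    exchange of the two copies. *)
Section Doubling.
Variables (K : closedFieldType) (A S : idomainType) (k : {rmorphism K -> A}).
Hypotheses (gcdA : gcd_domain A) (gcdS : gcd_domain S).
Variables (its ih : {rmorphism A -> S}) (diag : {rmorphism S -> A}).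
Variable (swap : {rmorphism S -> S}).
Hypotheses (diag_h : cancel ih diag) (diag_ts : cancel its diag).
Hypotheses (swap_h : forall a, swap (ih a) = its a)
  (swap_ts : forall a, swap (its a) = ih a) (swapK : involutive swap).
Hypothesis its_k : forall c, its (k c) = ih (k c).
Hypothesis its_ih : forall a b, its a = ih b -> exists c, a = k c.
Hypothesis divides_ih : forall (e : S) (c : A), c != 0 -> divides e (ih c) ->
  exists2 d, d != 0 & e = ih d.

Local Notation M := {fraction A}.
Local Notation "x %:F" := (@FracField.tofrac _ x).

Lemma its_eq0 p : (its p == 0) = (p == 0).
Proof.
apply/eqP/eqP => [E|->]; last exact: rmorph0.
by rewrite -(diag_ts p) E rmorph0.
Qed.

Lemma ih_eq0 p : (ih p == 0) = (p == 0).
Proof.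
apply/eqP/eqP => [E|->]; last exact: rmorph0.
by rewrite -(diag_h p) E rmorph0.
Qed.

(** The exchange turns a common divisor of [its p] and [its q] into one of [ih p]
    and [ih q]; the divisors of [ih q] are of the form [ih d], and then [d]
    divides [p] and [q]. *)
Lemma its_coprime p q : q != 0 -> coprime_elts p q ->
  coprime_elts (its p) (its q).
Proof.
move=> q0 cop e /(divides_rmorph swap) + /(divides_rmorph swap).
rewrite !swap_ts => ep eq; have [d d0 Ee] := divides_ih q0 eq.
have d_divides a : divides (swap e) (ih a) -> divides d a.
  by rewrite Ee => /(divides_rmorph diag); rewrite !diag_h.
have Ud : d \is a GRing.unit by apply: cop; apply: d_divides.
by rewrite -(swapK e) Ee swap_h; apply: rmorph_unit.
Qed.

Lemma rdenA_neq0 (x : M) : rden x != 0.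
Proof. by case: (reduced_formP gcdA x). Qed.

Definition diff_num (x : M) : S :=
  its (rnum x) * ih (rden x) - ih (rnum x) * its (rden x).

Definition doubled_diff (x : M) : {fraction S} :=
  (its (rnum x))%:F / (its (rden x))%:F - (ih (rnum x))%:F / (ih (rden x))%:F.

Lemma doubled_diffE x :
  doubled_diff x = (diff_num x)%:F / (its (rden x) * ih (rden x))%:F.
Proof.
rewrite /doubled_diff -mulNr addf_div ?tofrac_eq0 ?its_eq0 ?ih_eq0 ?rdenA_neq0 //.
by rewrite mulNr -!rmorphM -rmorphB.
Qed.

Lemma rnum_diff x : rnum (doubled_diff x) * (its (rden x) * ih (rden x)) =
  diff_num x * rden (doubled_diff x).
Proof.
have [/= d0 _ E] := reduced_formP gcdS (doubled_diff x).
move/eqP: E; rewrite {1}doubled_diffE eqr_div ?tofrac_eq0 ?mulf_neq0 //;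
  rewrite ?its_eq0 ?ih_eq0 ?rdenA_neq0 //.
by rewrite -!rmorphM tofrac_eq => /eqP.
Qed.

Lemma rnum_diff_divides x : divides (rnum (doubled_diff x)) (diff_num x).
Proof.
have [/= d0 cop E] := reduced_formP gcdS (doubled_diff x).
by apply: (coprime_divides gcdS cop); rewrite mulrC -rnum_diff;
   apply: divides_mullr.
Qed.

Lemma diag_rnum_diff x : diag (rnum (doubled_diff x)) = 0.
Proof.
have /(congr1 diag) := rnum_diff x.
rewrite !rmorphM rmorphB !rmorphM /= !diag_ts !diag_h.
rewrite [rnum x * _]mulrC subrr mul0r => /eqP.
by rewrite !mulf_eq0 !(negPf (rdenA_neq0 _)) !orbF => /eqP.
Qed.

(** Such an [e] divides both [p(t,s) q(h)] and [q(t,s) q(h)], where [p / q] is the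
    reduced form of [x]; the gcd of these is [q(h)]. *)
Lemma diff_num_common x e : divides e (diff_num x) -> divides e (its (rden x)) ->
  exists2 c, c != 0 & e = ih c.
Proof.
move=> eD eq; have [/= d0 cop _] := reduced_formP gcdA x.
have ep : divides e (ih (rden x) * its (rnum x)).
  rewrite mulrC -[X in divides e X](subrK (ih (rnum x) * its (rden x))).
  by apply: dividesD => //; apply: divides_mull.
have g1 : is_gcd (its (rnum x)) (its (rden x)) 1.
  split; try by apply: unit_divides; rewrite unitr1.
  by move=> d dp dq; apply/unit_divides/(its_coprime d0 cop).
have [e' ge'] := gcdS (ih (rden x) * its (rnum x)) (ih (rden x) * its (rden x)).
apply: (@divides_ih e (rden x)) => //.
have := is_gcd_mul g1 ge'; rewrite mulr1; apply: divides_trans.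
by case: ge' => _ _; apply=> //; apply: divides_mull.
Qed.

(** A factor [a] that shares only polynomials in [h] with [G] can be traded for
    such a polynomial. *)
Lemma strip_factor (G a Z : S) : a != 0 ->
  (forall e, divides e G -> divides e a -> exists2 c, c != 0 & e = ih c) ->
  divides G (a * Z) -> exists2 c, c != 0 & divides G (ih c * Z).
Proof.
move=> a0 common GaZ; have [d gd] := gcdS G a.
have [c c0 Ed] : exists2 c, c != 0 & d = ih c.
  by case: gd => dG da _; apply: common.
have d0 : d != 0 by rewrite Ed ih_eq0.
have [G' [a' [EG Ea cop]]] := gcd_cofactors gd d0.
exists c => //; rewrite -Ed EG; apply: divides_mul; first exact: divides_refl.
apply: (coprime_divides gcdS cop).
by apply: (divides_mul2l d0); rewrite mulrA -Ea -EG.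
Qed.

Lemma strip_factor_exp (G a Z : S) N : a != 0 ->
  (forall e, divides e G -> divides e a -> exists2 c, c != 0 & e = ih c) ->
  divides G (a ^+ N * Z) -> exists2 c, c != 0 & divides G (ih c * Z).
Proof.
move=> a0 common; elim: N Z => [|N IH] Z.
  by rewrite mul1r => GZ; exists 1; rewrite ?oner_neq0 // rmorph1 mul1r.
rewrite exprS -mulrA => /(strip_factor a0 common)[c c0].
rewrite mulrCA => /IH[c' c'0]; rewrite mulrA -rmorphM.
by exists (c' * c) => //; apply: mulf_neq0.
Qed.

Lemma strip_factor_prod n (G Z : S) (a : 'I_n -> S) N :
  (forall i, a i != 0) ->
  (forall i e, divides e G -> divides e (a i) -> exists2 c, c != 0 & e = ih c) ->
  divides G ((\prod_i a i) ^+ N * Z) -> exists2 c, c != 0 & divides G (ih c * Z).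
Proof.
move=> a0 common; rewrite -prodrXl; elim/big_rec: _ Z => [|i P _ IH] Z.
  by rewrite mul1r => GZ; exists 1; rewrite ?oner_neq0 // rmorph1 mul1r.
rewrite -mulrA => /(strip_factor_exp (a0 i) (common i))[c c0].
rewrite mulrCA => /IH[c' c'0]; rewrite mulrA -rmorphM.
by exists (c' * c) => //; apply: mulf_neq0.
Qed.

Definition frac_k : K -> M := @FracField.tofrac A \o k.
HB.instance Definition _ := GRing.RMorphism.copy frac_k (@FracField.tofrac A \o k).

Definition alg_independent m (phi : 'I_m -> M) :=
  forall F, mmap frac_k phi F = 0 -> F = 0.

Lemma common_den m (phi : 'I_m -> M) : exists a : 'I_m -> A, exists o : 'I_m -> A,
  [/\ forall i, \prod_j rden (phi j) = rden (phi i) * o i,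
      forall i, a i = rnum (phi i) * o i &
      forall i, (a i)%:F / (\prod_j rden (phi j))%:F = phi i].
Proof.
exists (fun i => rnum (phi i) * \prod_(j | j != i) rden (phi j)).
exists (fun i => \prod_(j | j != i) rden (phi j)).
have Eo i : \prod_j rden (phi j) = rden (phi i) * \prod_(j | j != i) rden (phi j).
  by rewrite (bigD1 i).
split; [exact: Eo | by [] | move=> i].
rewrite (Eo i) !rmorphM -mulf_div divff ?mulr1.
  by have [_ _ <-] := reduced_formP gcdA (phi i).
by rewrite tofrac_eq0; apply/prodf_neq0 => j _; apply: rdenA_neq0.
Qed.

Lemma cleared_frac m (P : {mpoly K[m]}) N (q : A) (p : 'I_m -> A) :
  (msize P <= N.+1)%N -> q != 0 ->
  (cleared k P N q p)%:F = q%:F ^+ N * mmap frac_k (fun i => (p i)%:F / q%:F) P.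
Proof.
move=> PN q0; rewrite cleared_rmorph.
by rewrite cleared_field ?tofrac_eq0.
Qed.

Section OneVariable.
Variables (X : A) (sigma : {rmorphism S -> S}) (ev : K -> {rmorphism S -> A}).
Hypotheses (sigma_X : sigma (its X) = its X) (sigma_h : forall a, sigma (ih a) = ih a).
Hypotheses (ev_X : forall c, ev c (its X) = k c) (ev_h : forall c a, ev c (ih a) = a).
Hypothesis sigma_divides : forall G U, U != 0 -> divides G U ->
  sigma U = U -> sigma G = G.
Hypothesis dependence : forall m (phi : 'I_m -> M), m = 3 ->
  exists2 P : {mpoly K[m]}, P != 0 & mmap frac_k phi P = 0.

(** A relation [P(t, chi) = 0] becomes, modulo a common factor [G] of the
    numerators of [chi(t,s) - chi(h)], the equation [P(t, chi(h)) = 0] on [G]: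
    hence [G] divides a nonzero polynomial that does not involve [s]. *)
Lemma common_factor_misses_variable (phi : 'I_2 -> M) G : alg_independent phi ->
  (forall i, divides G (diff_num (phi i))) -> sigma G = G.
Proof.
move=> indep Gphi.
have [P P0 EP] := dependence (cons_fun X%:F phi) (erefl 3).
have [a [o [Eo Ea Ephi]]] := common_den phi.
set b := \prod_j rden (phi j) in Eo Ephi.
have b0 : b != 0 by apply/prodf_neq0 => j _; apply: rdenA_neq0.
pose N := msize P; have PN : (msize P <= N.+1)%N by apply: leqnSn.
(* [W] is [P(t, chi(h))] with denominators cleared. *)
pose W := cleared (ih \o k) P N (ih b) (cons_fun (its X * ih b) (ih \o a)).
have GW : divides G (its b ^+ N * W).
  have := @cleared_congr _ _ P N PN _ (ih \o k) G (its b) (ih b)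
    (cons_fun (its X * its b) (its \o a)) (cons_fun (its X * ih b) (ih \o a)).
  have -> : cleared (ih \o k) P N (its b) (cons_fun (its X * its b) (its \o a)) = 0.
    transitivity (its (cleared k P N b (cons_fun (X * b) a))).
      rewrite cleared_rmorph; apply: eq_cleared => [c|i] /=; first by rewrite its_k.
      by rewrite /cons_fun; case: unlift => [j|] //=; rewrite rmorphM.
    rewrite (_ : cleared _ _ _ _ _ = 0) ?rmorph0 //; apply/eqP.
    rewrite -tofrac_eq0 cleared_frac // mulf_eq0 -[X in _ || X]/(_ == 0).
    apply/orP; right; apply/eqP; rewrite -[RHS]EP; apply: eq_mmap => i.
    rewrite /cons_fun; case: unlift => [j|] //=.
    by rewrite rmorphM mulfK // tofrac_eq0.
  rewrite mulr0 sub0r => H; rewrite -[its b ^+ N * W]opprK; apply: dividesN.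
  apply: H => i; rewrite /cons_fun; case: unliftP => [j|] _ /=; last first.
    by rewrite mulrAC subrr; apply: divides0.
  rewrite (Ea j) (Eo j) !rmorphM.
  have -> : its (rnum (phi j)) * its (o j) * (ih (rden (phi j)) * ih (o j)) -
     ih (rnum (phi j)) * ih (o j) * (its (rden (phi j)) * its (o j)) =
     diff_num (phi j) * (its (o j) * ih (o j)) by rewrite /diff_num; ring.
  exact: divides_mulr.
have sigmaW : sigma W = W.
  rewrite /W cleared_rmorph sigma_h; apply: eq_cleared => [c|i] /=.
    exact: sigma_h.
  rewrite /cons_fun; case: unlift => [j|] //=.
  by rewrite rmorphM /= sigma_X sigma_h.
have evW c : (ev c W)%:F = b%:F ^+ N *
    (map_poly (mmap frac_k phi) (head_poly P)).[frac_k c].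
  rewrite /W cleared_rmorph ev_h -mmap_cons.
  transitivity (cleared k P N b (cons_fun (k c * b) a))%:F.
    congr (_%:F); apply: eq_cleared => [d|i] /=; first exact: ev_h.
    rewrite /cons_fun; case: unlift => [j|] //=.
    by rewrite rmorphM /= ev_X ev_h.
  rewrite cleared_frac //; congr (_ * _); apply: eq_mmap => i.
  rewrite /cons_fun; case: unlift => [j|] //=.
  by rewrite rmorphM mulfK // tofrac_eq0.
have W0 : W != 0.
  apply/eqP => W0; set R := map_poly _ _ in evW.
  have R0 : R != 0.
    apply: contraNneq P0 => R0; rewrite -(head_polyK P).
    suff -> : head_poly P = 0 by rewrite rmorph0.
    apply/polyP => i; rewrite coef0; apply: indep.
    by rewrite -[LHS](coef_map (mmap frac_k phi)) -/R R0 coef0.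
  (* [R] cannot have all the constants as roots. *)
  have [s us ss] := closed_uniq_seq K (size R).
  have := max_poly_roots R0 (_ : all (root R) (map frac_k s)).
  rewrite map_inj_uniq //; last exact: fmorph_inj.
  rewrite size_map ss ltnn => H; suff : false by [].
  apply: H => //; apply/allP => _ /mapP[c _ ->]; rewrite /root.
  move/eqP: (evW c); rewrite W0 !rmorph0 eq_sym mulf_eq0 expf_eq0 tofrac_eq0.
  by rewrite (negPf b0) andbF.
have Wb : divides G ((\prod_i its (rden (phi i))) ^+ N * W).
  by move: GW; rewrite /b rmorph_prod.
have [||c c0 GcW] := strip_factor_prod _ _ Wb.
- by move=> i; rewrite its_eq0 rdenA_neq0.
- by move=> i e eG; apply: diff_num_common; apply: divides_trans (Gphi i).
apply: (sigma_divides _ GcW); first by rewrite mulf_neq0 // ih_eq0.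
by rewrite rmorphM /= sigma_h sigmaW.
Qed.

End OneVariable.

Lemma diff_num_eq0 x : diff_num x = 0 -> exists c, x = frac_k c.
Proof.
move=> /eqP; rewrite subr_eq0 => /eqP E.
have [/= d0 cop Ex] := reduced_formP gcdA x.
have [n0|n0] := eqVneq (rnum x) 0.
  by exists 0; rewrite Ex n0 !rmorph0 mul0r.
have cop' := its_coprime d0 cop.
have const a : a != 0 -> divides (its a) (ih a) -> exists c, a = k c.
  by move=> a0 /(divides_ih a0)[d _]; apply: its_ih.
have [c Ec] : exists c, rnum x = k c.
  apply: const => //; apply: (coprime_divides gcdS cop').
  by rewrite mulrC -E; apply: divides_mullr.
have [d Ed] : exists d, rden x = k d.
  apply: const => //; apply: (coprime_divides gcdS (coprime_eltsC cop')).
  by rewrite E; apply: divides_mulll.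
by exists (c / d); rewrite Ex Ec Ed fmorph_div.
Qed.

(** Over an algebraically closed field, [P] splits, and its value at [x] is a
    product of nonzero factors [x - z]. *)
Lemma transcendental_neq0 x (P : {mpoly K[1]}) : (forall c, x <> frac_k c) ->
  P != 0 -> mmap frac_k (fun=> x) P != 0.
Proof.
move=> xK P0; pose v0 (i : 'I_0) : M := 0.
have -> : mmap frac_k (fun=> x) P = mmap frac_k (cons_fun x v0) P.
  by apply: eq_mmap => i; rewrite /cons_fun (ord1 i) unlift_none.
rewrite mmap_cons; set R := map_poly _ _.
have ER : R = map_poly frac_k (map_poly (mcoeff 0%MM) (head_poly P)).
  apply/polyP => i; rewrite !coef_map /= [(head_poly P)`_i]nvar0_mpolyC mmapC.
  by rewrite mcoeffC eqxx mulr1.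
have [r Er] := closed_field_poly_normal (map_poly (mcoeff 0%MM) (head_poly P)).
rewrite ER Er linearZ /= hornerZ mulf_neq0 //.
  rewrite fmorph_eq0 lead_coef_eq0; apply: contraNneq P0 => E.
  rewrite -(head_polyK P) (_ : head_poly P = 0) ?rmorph0 //.
  apply/polyP => i; rewrite coef0 [LHS]nvar0_mpolyC.
  by rewrite -(coef_map (mcoeff 0%MM)) E coef0 mpolyC0.
rewrite rmorph_prod horner_prod prodf_seq_neq0; apply/allP => z _ /=.
rewrite rmorphB /= map_polyX map_polyC /= !hornerE subr_eq0.
by apply/eqP/xK.
Qed.

(** The polynomial [m(h; p/q)], with [p/q] in the variables (t,s), cleared of
    denominators. *)
Definition homog_ts (p q : A) d (m : {poly A}) : S :=
  \sum_(i < d.+1) ih m`_i * its p ^+ i * its q ^+ (d - i).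

Implicit Types (p q : A) (d : nat) (m : {poly A}).

Lemma homog_tsD p q d m m' :
  homog_ts p q d (m + m') = homog_ts p q d m + homog_ts p q d m'.
Proof.
rewrite -big_split; apply: eq_bigr => i _.
by rewrite coefD rmorphD !mulrDl.
Qed.

Lemma homog_tsZ p q d a m : homog_ts p q d (a *: m) = ih a * homog_ts p q d m.
Proof.
rewrite mulr_sumr; apply: eq_bigr => i _.
by rewrite coefZ rmorphM !mulrA.
Qed.

Lemma homog_tsX p q d m :
  homog_ts p q d.+1 (m * 'X) = its p * homog_ts p q d m.
Proof.
rewrite /homog_ts big_ord_recl coefMX /= rmorph0 !mul0r add0r mulr_sumr.
apply: eq_bigr => i _; rewrite coefMX /= subSS exprS; ring.
Qed.

Lemma homog_tsS p q d m : (size m <= d.+1)%N ->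
  homog_ts p q d.+1 m = its q * homog_ts p q d m.
Proof.
move=> sm; rewrite /homog_ts big_ord_recr /= (nth_default _ sm) rmorph0 !mul0r addr0.
rewrite mulr_sumr; apply: eq_bigr => i _.
by rewrite subSn 1?exprS -1?ltnS //; ring.
Qed.

Lemma homog_tsC p q d c : homog_ts p q d c%:P = ih c * its q ^+ d.
Proof.
rewrite /homog_ts big_ord_recl big1 => [|i _]; last first.
  by rewrite coefC /= rmorph0 !mul0r.
by rewrite addr0 coefC /= mulr1 subn0.
Qed.

(** A polynomial in [y(t,s)] over [K(h)] is a power of [y(t,s) - y(h)] times a
    polynomial that does not vanish on the diagonal: as long as it does vanish
    there, [y(h)] is a root of [m] and a factor [y(t,s) - y(h)] splits off. *)
Lemma homog_ts_factor y d (m : {poly A}) : m != 0 -> (size m <= d.+1)%N ->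
  exists (j : nat) (c : A) (V : S), [/\ c != 0, diag V != 0 &
    ih c * homog_ts (rnum y) (rden y) d m = diff_num y ^+ j * V].
Proof.
set p := rnum y; set q := rden y; have q0 : q != 0 by apply: rdenA_neq0.
elim: d m => [|d IH] m m0 sm.
  exists 0%N, 1, (homog_ts p q 0 m); rewrite oner_neq0 rmorph1 expr0 !mul1r.
  split=> //; apply: contra_neq m0.
  by rewrite (size1_polyC sm) homog_tsC mulr1 diag_h => ->; rewrite polyC0.
have [dz|dnz] := eqVneq (diag (homog_ts p q d.+1 m)) 0; last first.
  by exists 0%N, 1, (homog_ts p q d.+1 m); rewrite oner_neq0 rmorph1 expr0 !mul1r.
pose D := q *: 'X - p%:P.
have sD : size D = 2%N.
  rewrite size_polyDl size_scale ?size_polyX // size_polyN size_polyC.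
  by case: (p != 0).
have D0 : D != 0 by rewrite -size_poly_gt0 sD.
have homD m' : (size m' <= d.+1)%N ->
    homog_ts p q d.+1 (m' * D) = diff_num y * homog_ts p q d m'.
  move=> sm'; rewrite mulrBr -scalerAr [m' * p%:P]mulrC mul_polyC -scaleNr.
  rewrite homog_tsD !homog_tsZ homog_tsX homog_tsS // rmorphN /diff_num -/p -/q.
  by ring.
have E := Pdiv.Idomain.divp_eq m D.
set a := lead_coef D ^+ _ in E.
have a0 : a != 0 by rewrite expf_neq0 // lead_coef_eq0.
have sr : (size (m %% D)%R <= 1)%N by rewrite -ltnS -sD ltn_modp.
set m' := (m %/ D)%R in E; set r := (m %% D)%R in E sr.
have sm'D : (size m' <= d.+1)%N.
  have : (size (m' * D)%R <= d.+2)%N.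
    have -> : m' * D = a *: m - r by rewrite E addrK.
    rewrite (leq_trans (size_polyD _ _)) // geq_max size_scale // sm size_polyN.
    by rewrite (leq_trans sr).
  have [->|m'0] := eqVneq m' 0; first by rewrite size_poly0.
  by rewrite size_mul // sD addn2.
have r0 : r = 0.
  have /(congr1 (diag \o homog_ts p q d.+1)) := E; rewrite /= homog_tsZ homog_tsD.
  rewrite homD // (size1_polyC sr) homog_tsC rmorphD !rmorphM /= dz mulr0.
  rewrite /diff_num rmorphB !rmorphM rmorphXn /= !diag_h !diag_ts.
  rewrite [rnum y * _]mulrC subrr mul0r add0r => /esym/eqP.
  by rewrite mulf_eq0 (negPf (expf_neq0 _ q0)) orbF => /eqP ->.
rewrite r0 addr0 in E.
have m'0 : m' != 0.
  apply/eqP => m'0; move/eqP: E; rewrite m'0 mul0r scale_poly_eq0.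
  by rewrite (negPf a0) (negPf m0).
have [j [c [V [c0 V0 EV]]]] := IH m' m'0 sm'D.
exists j.+1, (c * a), V; split=> //; first exact: mulf_neq0.
rewrite rmorphM -mulrA -homog_tsZ E homD // mulrCA EV exprS.
by rewrite mulrA.
Qed.

(** Suppose [F(y, x) = 0] with [x] transcendental. Modulo the numerator of
    [x(t,s) - x(h)], the polynomial [F(y(t,s), x(h))] vanishes, and it is a power
    of [y(t,s) - y(h)] up to a factor that does not vanish on the diagonal.
    The numerator of [x(t,s) - x(h)] vanishes on the diagonal, so it cannot be
    prime to that of [y(t,s) - y(h)]. *)
Lemma dependent_common_factor (phi : 'I_2 -> M) F G :
  F != 0 -> mmap frac_k phi F = 0 ->
  (forall c, phi (lift ord0 ord0) <> frac_k c) ->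
  is_gcd (rnum (doubled_diff (phi ord0)))
         (rnum (doubled_diff (phi (lift ord0 ord0)))) G ->
  forall c, G <> ih c.
Proof.
set y := phi ord0; set x := phi (lift ord0 ord0) => F0 EF xK gG C EC.
set px := rnum x; set qx := rden x; set py := rnum y; set qy := rden y.
have qx0 : qx != 0 := rdenA_neq0 x; have qy0 : qy != 0 := rdenA_neq0 y.
have Ex : px%:F / qx%:F = x by have [_ _ <-] := reduced_formP gcdA x.
have Ey : py%:F / qy%:F = y by have [_ _ <-] := reduced_formP gcdA y.
pose H := head_poly F; pose n := size H.
pose N := (\max_(i < n) msize H`_i)%N.
have HN i : (msize H`_i <= N.+1)%N.
  case: (ltnP i n) => [lin|/leq_sizeP/(_ _ (leqnn i)) ->]; last by rewrite msize0.
  by rewrite leqW // (bigmax_sup (Ordinal lin)).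
pose mi i := cleared k H`_i N qx (fun=> px).
have Emi i : (mi i)%:F = qx%:F ^+ N * mmap frac_k (fun=> x) H`_i.
  by rewrite cleared_frac //; congr (_ * _); apply: eq_mmap => j; rewrite Ex.
(* [m] is [F] with its second variable replaced by [x(h)], and [U] below is its
   value at [y(t,s)], both cleared of denominators. *)
pose m := \poly_(i < n) mi i.
have mE i : m`_i = mi i.
  rewrite coef_poly; case: ltnP => // /leq_sizeP/(_ _ (leqnn i)) Hi.
  by rewrite /mi Hi /cleared msupp0 big_nil.
have H0 : H != 0.
  by apply: contraNneq F0 => E; rewrite -(head_polyK F) -/H E rmorph0.
have m0 : m != 0.
  apply/eqP => E; have /eqP := Emi n.-1; rewrite -mE E coef0 rmorph0 eq_sym.
  rewrite mulf_eq0 expf_eq0 tofrac_eq0 (negPf qx0) andbF /=.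
  by apply/negP/transcendental_neq0 => //; rewrite -lead_coefE lead_coef_eq0.
have sm : (size m <= n.+1)%N by rewrite leqW // size_poly.
set U := homog_ts py qy n m.
have U1 : \sum_(i < n.+1) its m`_i * its py ^+ i * its qy ^+ (n - i) = 0.
  transitivity (its (\sum_(i < n.+1) m`_i * py ^+ i * qy ^+ (n - i))).
    by rewrite rmorph_sum; apply: eq_bigr => i _; rewrite !rmorphM !rmorphXn.
  rewrite (_ : \sum_(i < _) _ = 0) ?rmorph0 //; apply/eqP.
  rewrite -tofrac_eq0 rmorph_sum /=.
  have yE := cons_fun_eta phi.
  have /esym := EF; rewrite -(eq_mmap _ _ yE) mmap_cons -/H -/y.
  have -> : map_poly (mmap frac_k (fun j : 'I_1 => phi (lift ord0 j))) H =
            map_poly (mmap frac_k (fun=> x)) H.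
    apply/polyP => i; rewrite !coef_map /=; apply: eq_mmap => j.
    by rewrite (ord1 j).
  rewrite (@horner_coef_wide _ n.+1); last first.
    by rewrite (leq_trans (size_poly _ _)) // leqW.
  move/(congr1 (fun z => qx%:F ^+ N * qy%:F ^+ n * z)); rewrite mulr0 => E0.
  apply/eqP; rewrite [RHS]E0 mulr_sumr; apply: eq_bigr => i _.
  rewrite !rmorphM !rmorphXn /= mE Emi coef_map /= -Ey expr_div_n.
  have lein : (i <= n)%N by rewrite -ltnS.
  have -> : qy%:F ^+ n = qy%:F ^+ (n - i) * qy%:F ^+ i by rewrite -exprD subnK.
  by apply: cancel_denominator; rewrite expf_neq0 // tofrac_eq0.
have gxU : divides (rnum (doubled_diff x)) (its qx ^+ N * U).
  apply: divides_trans (rnum_diff_divides x) _.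
  have -> : its qx ^+ N * U = its qx ^+ N * U - ih qx ^+ N *
      (\sum_(i < n.+1) its m`_i * its py ^+ i * its qy ^+ (n - i)).
    by rewrite U1 mulr0 subr0.
  rewrite /U /homog_ts !mulr_sumr -sumrB; apply: divides_sum => i _.
  rewrite -!mulrA !(mulrA (_ ^+ N)) -mulrBl; apply: divides_mulr.
  have -> : its m`_i = cleared (ih \o k) H`_i N (its qx) (fun=> its px).
    by rewrite mE cleared_rmorph; apply: eq_cleared => // c; rewrite /= its_k.
  have -> : ih m`_i = cleared (ih \o k) H`_i N (ih qx) (fun=> ih px).
    by rewrite mE cleared_rmorph.
  apply: cleared_congr => // _.
  have -> : ih px * its qx - its px * ih qx = - diff_num x.
    by rewrite /diff_num opprB.
  by apply: dividesN; apply: divides_refl.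
have [j [c [V [c0 V0 EV]]]] := homog_ts_factor y m0 sm.
have C0 : C != 0.
  apply/eqP => C0; have [_ [r Er] _] := gG.
  have /eqP := rnum_diff x; rewrite Er EC C0 rmorph0 mulr0 mul0r eq_sym.
  rewrite mulf_eq0 => /orP[/eqP /diff_num_eq0[z /xK]//|].
  by have [/= /negPf -> _ _] := reduced_formP gcdS (doubled_diff x).
have G0 : G != 0 by rewrite EC ih_eq0.
have [gy' [gx' [Egy Egx cop]]] := gcd_cofactors gG G0.
pose Z := its qx ^+ N * G ^+ j * (its qy * ih qy) ^+ j * V.
have : divides gx' Z.
  apply: (coprime_divides gcdS (q := gy' ^+ j)).
    by apply: (coprime_exp gcdS); apply: coprime_eltsC.
  apply: (@divides_trans _ (rnum (doubled_diff x))).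
    by rewrite Egx; apply: divides_mulll.
  have -> : gy' ^+ j * Z =
      rden (doubled_diff y) ^+ j * ih c * (its qx ^+ N * U).
    by apply: (clear_denominators _ _ EV); rewrite -Egy rnum_diff.
  exact: divides_mull.
move/(divides_rmorph diag).
have -> : diag gx' = 0.
  have := diag_rnum_diff x; rewrite Egx EC rmorphM /= diag_h => /eqP.
  by rewrite mulf_eq0 (negPf C0) => /eqP.
move=> [r]; rewrite mulr0 /Z EC !rmorphM !rmorphXn !rmorphM /= !diag_h !diag_ts.
by apply/eqP; rewrite !mulf_neq0 ?expf_neq0 ?mulf_neq0.
Qed.

End Doubling.

Lemma factor_polyC (R : idomainType) (p q : {poly R}) c :
  c != 0 -> p * q = c%:P -> exists d, q = d%:P.
Proof.
move=> c0 E; have : p * q != 0 by rewrite E polyC_eq0.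
rewrite mulf_eq0 negb_or => /andP[p0 q0].
have : size (p * q)%R = 1%N by rewrite E size_polyC c0.
rewrite size_mul // => Esz; exists q`_0; apply: size1_polyC.
by rewrite -[X in (_ <= X)%N]Esz -(prednK (_ : 0 < size p)%N)
           ?size_poly_gt0 //= leq_addl.
Qed.

Lemma divides_mpolyC (R : idomainType) n (p : {mpoly R[n]}) c : c != 0 ->
  divides p c%:MP -> exists2 d, d != 0 & p = d%:MP.
Proof.
move=> c0 [r E].
have : c%:MP != 0 :> {mpoly R[n]} by rewrite mpolyC_eq0.
rewrite E mulf_eq0 negb_or => /andP[r0 p0].
have : msize (r * p) = 1%N by rewrite -E msizeC c0.
rewrite msizeM // (mpolySpred _ r0) (mpolySpred _ p0) addnS /= => Esz.
have /msize_poly1P[d d0 ->] : msize p == 1%N.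
  by rewrite (mpolySpred _ p0) eqSS -leqn0 -ltnS -[X in (_ < X)%N]Esz ltnS leq_addl.
by exists d.
Qed.

Section KillVariable.
Variables (R : idomainType) (n : nat) (v : 'I_n).

Definition kill_var : {mpoly R[n]} -> {mpoly R[n]} :=
  mmap (@mpolyC n R) (fun i => if i == v then 0 else 'X_i).
HB.instance Definition _ := GRing.RMorphism.copy kill_var
  (mmap (@mpolyC n R) (fun i => if i == v then 0 else 'X_i)).

Lemma kill_varC c : kill_var c%:MP = c%:MP.
Proof. by rewrite /kill_var mmapC. Qed.

Lemma kill_varX i : i != v -> kill_var 'X_i = 'X_i.
Proof. by rewrite /kill_var mmapXU => /negPf ->. Qed.

Definition poly_in_var : {mpoly R[n]} -> {poly {mpoly R[n]}} :=
  mmap (polyC \o @mpolyC n R) (fun i => if i == v then 'X else ('X_i)%:P).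
HB.instance Definition _ := GRing.RMorphism.copy poly_in_var
  (mmap (polyC \o @mpolyC n R) (fun i => if i == v then 'X else ('X_i)%:P)).

Lemma poly_in_varC c : poly_in_var c%:MP = c%:MP%:P.
Proof. by rewrite /poly_in_var mmapC. Qed.

Lemma poly_in_varX i : poly_in_var 'X_i = if i == v then 'X else ('X_i)%:P.
Proof. by rewrite /poly_in_var mmapXU. Qed.

Lemma horner_poly_in_var p : (poly_in_var p).['X_v] = p.
Proof.
apply: (mpoly_rmorph_ext (f := horner_eval 'X_v \o poly_in_var) (g := idfun)) => [c|i] /=.
  by rewrite poly_in_varC /horner_eval hornerC.
rewrite poly_in_varX /horner_eval.
by case: eqP => [->|_]; rewrite ?hornerX ?hornerC.
Qed.

Lemma horner0_poly_in_var p : (poly_in_var p).[0] = kill_var p.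
Proof.
apply: (mpoly_rmorph_ext (f := horner_eval 0 \o poly_in_var) (g := kill_var)) => [c|i] /=.
  by rewrite poly_in_varC kill_varC /horner_eval hornerC.
rewrite poly_in_varX /kill_var mmapXU /horner_eval.
by case: eqP => _; rewrite ?hornerX ?hornerC.
Qed.

Lemma poly_in_var_kill p : poly_in_var (kill_var p) = (kill_var p)%:P.
Proof.
apply: (mpoly_rmorph_ext (f := poly_in_var \o kill_var)
  (g := polyC \o kill_var)) => [c|i] /=.
  by rewrite kill_varC poly_in_varC.
rewrite /kill_var mmapXU; case: ifP => [_|iv]; first by rewrite !rmorph0.
by rewrite poly_in_varX iv.
Qed.

(** The degrees in [v] add up in a product, so a divisor of a nonzero polynomial
    without [v] does not involve [v] either. *)
Lemma kill_var_divides G U : U != 0 -> divides G U -> kill_var U = U ->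
  kill_var G = G.
Proof.
move=> U0 [W EU] kU; have : poly_in_var U = U%:P by rewrite -kU poly_in_var_kill.
rewrite {1}EU rmorphM => /(factor_polyC U0)[c EG].
by rewrite -horner0_poly_in_var -[RHS]horner_poly_in_var EG !hornerC.
Qed.

End KillVariable.

Lemma kill_both_const (R : idomainType) (p : {mpoly R[2]}) :
  kill_var 0 p = p -> kill_var 1 p = p -> (msize p <= 1)%N.
Proof.
move=> p0 p1; suff -> : p = (p.@[fun=> 0])%:MP by rewrite msizeC leq_b1.
rewrite -{1}p0 -{1}p1.
apply: (mpoly_rmorph_ext (f := kill_var 0 \o kill_var 1)
  (g := @mpolyC 2 R \o meval (fun=> 0))) => [c|i] /=.
  by rewrite !kill_varC mevalC.
rewrite mevalXU mpolyC0 {2}/kill_var mmapXU; case: eqP => [_|i1].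
  by rewrite rmorph0.
rewrite /kill_var mmapXU; case: eqP => // i0.
by case: i i0 i1 => [[|[|]]] //= lt i0 i1; [case: i0|case: i1]; apply: val_inj.
Qed.

Section Gpoly.
Variable K : closedFieldType.
Local Notation RH := {mpoly K[2]}.
Local Notation S := {mpoly {mpoly K[2]}[2]}.
Local Notation in_ts := (@in_ts K).
Local Notation in_h := (@in_h K).

HB.instance Definition _ := GRing.RMorphism.copy in_ts (map_mpoly (@mpolyC 2 K)).
HB.instance Definition _ := GRing.RMorphism.copy in_h (@mpolyC 2 RH).

Definition diag : S -> RH := meval (fun i => 'X_i).
HB.instance Definition _ := GRing.RMorphism.copy diag (meval (fun i => 'X_i : RH)).

Definition swap_ts_h : S -> S := mmap in_ts (fun i => in_h 'X_i).
HB.instance Definition _ := GRing.RMorphism.copy swap_ts_h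
  (mmap in_ts (fun i => in_h 'X_i)).

Definition eval_ts (v : 'I_2) (c : K) : S -> RH :=
  meval (fun i => if i == v then c%:MP else 0).
HB.instance Definition _ v c := GRing.RMorphism.copy (eval_ts v c)
  (meval (fun i => if i == v then c%:MP else 0 : RH)).

Lemma gcd_domain_S : gcd_domain S.
Proof. exact/gcd_domain_mpoly/gcd_domain_mpolyF. Qed.

Lemma in_tsC c : in_ts c%:MP = in_h c%:MP.
Proof. exact: map_mpolyC. Qed.

Lemma in_tsX i : in_ts 'X_i = 'X_i.
Proof. exact: map_mpolyX. Qed.

Lemma diag_h : cancel in_h diag.
Proof. by move=> p; apply: mevalC. Qed.

Lemma diag_ts : cancel in_ts diag.
Proof.
apply: (mpoly_rmorph_ext (f := diag \o in_ts) (g := idfun)) => [c|i] /=.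
  by rewrite in_tsC diag_h.
by rewrite in_tsX /diag mevalXU.
Qed.

Lemma swap_h p : swap_ts_h (in_h p) = in_ts p.
Proof. exact: mmapC. Qed.

Lemma swap_ts p : swap_ts_h (in_ts p) = in_h p.
Proof.
apply: (mpoly_rmorph_ext (f := swap_ts_h \o in_ts) (g := in_h)) => [c|i] /=.
  by rewrite in_tsC swap_h in_tsC.
by rewrite in_tsX /swap_ts_h mmapXU.
Qed.

Lemma swapK : involutive swap_ts_h.
Proof.
move=> p; apply: (mpoly_rmorph_ext (f := swap_ts_h \o swap_ts_h) (g := idfun)) => [c|i] /=.
  by rewrite [swap_ts_h c%:MP]swap_h swap_ts.
by rewrite {2}/swap_ts_h mmapXU swap_h in_tsX.
Qed.

Lemma in_ts_in_h a b : in_ts a = in_h b -> exists c, a = c%:MP.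
Proof.
move=> E; exists a@_0%MM; apply/mpolyP => m; rewrite mcoeffC.
case: eqVneq => [->|m0]; rewrite ?mulr1 ?mulr0 //.
have := congr1 (mcoeff m) E; rewrite mcoeff_map_mpoly /= mcoeffC (negPf m0) mulr0.
by move/eqP; rewrite mpolyC_eq0 => /eqP.
Qed.

Lemma eval_tsh v c a : eval_ts v c (in_h a) = a.
Proof. exact: mevalC. Qed.

Lemma eval_tsX v c : eval_ts v c (in_ts 'X_v) = c%:MP.
Proof. by rewrite in_tsX /eval_ts mevalXU eqxx. Qed.

(* The same maps between the integral domains [A0] and [S0], whose ring structures
   unfold to the ones above. *)
Let A0 : idomainType := RH.
Let S0 : idomainType := S.
Definition in_ts_idomain : {rmorphism A0 -> S0}.
Proof. exact_no_check (in_ts : {rmorphism RH -> S}). Defined.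
Definition in_h_idomain : {rmorphism A0 -> S0}.
Proof. exact_no_check (in_h : {rmorphism RH -> S}). Defined.
Definition diag_idomain : {rmorphism S0 -> A0}.
Proof. exact_no_check (diag : {rmorphism S -> RH}). Defined.
Definition swap_idomain : {rmorphism S0 -> S0}.
Proof. exact_no_check (swap_ts_h : {rmorphism S -> S}). Defined.
Definition eval_ts_idomain (v : 'I_2) (c : K) : {rmorphism S0 -> A0}.
Proof. exact_no_check (eval_ts v c : {rmorphism S -> RH}). Defined.
Definition kill_idomain (v : 'I_2) : {rmorphism S0 -> S0}.
Proof. exact_no_check (kill_var v : {rmorphism S -> S}). Defined.

Lemma divides_in_h (e : S0) (c : A0) : c != 0 -> divides e (in_h_idomain c) ->
  exists2 d, d != 0 & e = in_h_idomain d.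
Proof. exact: divides_mpolyC. Qed.

Lemma dependence3 m (phi : 'I_m -> {fraction A0}) : m = 3 ->
  exists2 P : {mpoly K[m]}, P != 0 & mmap (frac_k (@mpolyC 2 K)) phi P = 0.
Proof. by move=> E; move: phi; rewrite E => phi; apply: algebraic_dependence. Qed.

Definition rat_independent (phi : ratmap K 2 2) :=
  forall F, mmap (@fracC K 2) phi F = 0 -> F = 0.

Lemma common_factor_const (phi : ratmap K 2 2) (G : S0) : rat_independent phi ->
  (forall i, divides G (rnum (ts_minus_h (phi i)))) -> (msize G <= 1)%N.
Proof.
move=> indep Gphi.
have GD i : divides G (diff_num in_ts_idomain in_h_idomain (phi i)).
  apply: (divides_trans (Gphi i)).
  exact: (@rnum_diff_divides A0 S0 (@gcd_domain_mpolyF K 2) gcd_domain_S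
    in_ts_idomain in_h_idomain diag_idomain diag_h diag_ts (phi i)).
have miss (v w : 'I_2) : v != w -> kill_idomain w G = G.
  move=> vw.
  have kX : kill_idomain w (in_ts_idomain 'X_v) = in_ts_idomain 'X_v.
    by rewrite [in_ts_idomain _]in_tsX; apply: kill_varX.
  exact: (@common_factor_misses_variable K A0 S0 (@mpolyC 2 K)
    (@gcd_domain_mpolyF K 2) gcd_domain_S in_ts_idomain in_h_idomain diag_idomain
    swap_idomain diag_h diag_ts swap_h swap_ts swapK in_tsC divides_in_h 'X_v
    (kill_idomain w) (eval_ts_idomain v) kX (@kill_varC _ _ w) (eval_tsX v)
    (eval_tsh v) (@kill_var_divides RH 2 w) dependence3 phi G indep GD).
by apply: kill_both_const; [apply: (miss 1) | apply: (miss 0)].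
Qed.

Lemma gpoly_independent (phi : ratmap K 2 2) : rat_independent phi ->
  gpoly phi = 1.
Proof.
move=> indep; rewrite /gpoly; set G := gcd_elt _ _.
have [G0 G1 _] : is_gcd (rnum (ts_minus_h (phi 0))) (rnum (ts_minus_h (phi 1))) G.
  exact: gcd_eltP gcd_domain_S _ _.
rewrite ltnNge (common_factor_const indep) // => -[[|[|]] // lt].
  by rewrite (_ : Ordinal lt = 0) //; apply: val_inj.
by rewrite (_ : Ordinal lt = 1) //; apply: val_inj.
Qed.

Lemma gcd_msize_gt1 (phi : ratmap K 2 2) F G : F != 0 ->
  mmap (@fracC K 2) phi F = 0 -> (forall c, phi 1 <> fracC 2 c) ->
  is_gcd (rnum (ts_minus_h (phi 0))) (rnum (ts_minus_h (phi 1))) G ->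
  (1 < msize G)%N.
Proof.
move=> F0 EF phi1 gG; rewrite ltnNge; apply/negP => /msize1_polyC.
have E1 : lift ord0 ord0 = 1 :> 'I_2 by apply: val_inj.
move: phi1 gG; rewrite -E1 => phi1 gG.
exact: (@dependent_common_factor K A0 S0 (@mpolyC 2 K)
    (@gcd_domain_mpolyF K 2) gcd_domain_S in_ts_idomain in_h_idomain diag_idomain
    swap_idomain diag_h diag_ts
    swap_h swap_ts swapK in_tsC in_ts_in_h divides_in_h phi F G F0 EF phi1 gG).
Qed.

Lemma gpoly_dependent (phi : ratmap K 2 2) F i : F != 0 ->
  mmap (@fracC K 2) phi F = 0 -> (forall c, phi i <> fracC 2 c) -> gpoly phi <> 1.
Proof.
move=> F0 EF phii; rewrite /gpoly; set G := gcd_elt _ _.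
have gG : is_gcd (rnum (ts_minus_h (phi 0))) (rnum (ts_minus_h (phi 1))) G.
  exact: gcd_eltP gcd_domain_S _ _.
suff G1 : (1 < msize G)%N by rewrite G1 => E; rewrite E msize1 in G1.
case: i phii => [[|[|]]] // lt phii.
  pose swap_var (i : 'I_2) : {mpoly K[2]} := 'X_(rev_ord i).
  have swap_varK F' : mmap (@mpolyC 2 K) swap_var (mmap (@mpolyC 2 K) swap_var F') = F'.
    apply: (mpoly_rmorph_ext (f := mmap _ swap_var \o mmap _ swap_var)
      (g := idfun)) => [c|j] /=; first by rewrite !mmapC.
    by rewrite mmapXU /swap_var mmapXU rev_ordK.
  apply: (@gcd_msize_gt1 (fun j => phi (rev_ord j)) (mmap (@mpolyC 2 K) swap_var F)).
  - by apply: contraNneq F0 => E; rewrite -(swap_varK F) E rmorph0.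
  - rewrite -[RHS]EF.
    apply: (mpoly_rmorph_ext (f := mmap (@fracC K 2) (fun j => phi (rev_ord j)) \o
      mmap _ swap_var) (g := mmap (@fracC K 2) phi)) => [c|j] /=; first by rewrite !mmapC.
    by rewrite !mmapXU /= rev_ordK.
  - by move=> c; rewrite (_ : rev_ord 1 = Ordinal lt) //; apply: val_inj.
  - rewrite (_ : rev_ord 1 = 0 :> 'I_2); last exact: val_inj.
    rewrite (_ : rev_ord 0 = 1 :> 'I_2); last exact: val_inj.
    exact: is_gcdC.
apply: (@gcd_msize_gt1 phi F G F0 EF) => // c.
by rewrite (_ : 1 = Ordinal lt) //; apply: val_inj.
Qed.

End Gpoly.

(** * Degree and multiplicity in the blowup chart *)

Section Chart.
Variables (K : fieldType) (n : nat).

(** The pullback under the chart (lambda, u) |-> (lambda, lambda u) of the blowup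
    of the origin: the homogeneous component of degree [d] becomes the coefficient
    of lambda^d. *)
Definition chart : {mpoly K[n.+1]} -> {poly {mpoly K[n]}} :=
  mmap (polyC \o @mpolyC n K) (cons_fun 'X (fun j => ('X_j)%:P * 'X)).
HB.instance Definition _ := GRing.RMorphism.copy chart
  (mmap (polyC \o @mpolyC n K) (cons_fun 'X (fun j => ('X_j)%:P * 'X))).

Lemma chartC c : chart c%:MP = c%:MP%:P.
Proof. by rewrite /chart mmapC. Qed.

Lemma chartX i : chart 'X_i = cons_fun 'X (fun j => ('X_j)%:P * 'X) i.
Proof. by rewrite /chart mmapXU. Qed.

Lemma chart_value (S : comNzRingType) (k : {rmorphism K -> S}) x (u : 'I_n -> S) w :
  (map_poly (mmap k u) (chart w)).[x] = mmap k (cons_fun x (fun j => u j * x)) w.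
Proof.
apply: (mpoly_rmorph_ext (f := horner_eval x \o map_poly (mmap k u) \o chart)
  (g := mmap k (cons_fun x (fun j => u j * x)))) => [c|i] /=.
  by rewrite chartC map_polyC /horner_eval hornerC /= !mmapC.
rewrite chartX mmapXU /cons_fun /horner_eval; case: unlift => [j|].
  by rewrite rmorphM /= map_polyC map_polyX hornerM hornerC hornerX /= mmapXU.
by rewrite map_polyX hornerX.
Qed.

Let tail_mon (m : 'X_{1..n.+1}) : 'X_{1..n} := [multinom m (lift ord0 j) | j < n].

Lemma chart_mon m : chart 'X_[m] = ('X_[tail_mon m])%:P * 'X^(mdeg m).
Proof.
rewrite /chart mmapX /mmap1 big_ord_recl /cons_fun unlift_none.
rewrite mdegE big_ord_recl exprD mulrCA; congr (_ * _).
rewrite mpolyXE_id rmorph_prod -prodrXr -big_split /=; apply: eq_bigr => j _.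
by rewrite liftK mnmE exprMn rmorphXn.
Qed.

(** A monomial is determined by its degree and its exponents in all variables but
    the first, so the components of [w] can be read off its chart. *)
Lemma mcoeff_chart w m : ((chart w)`_(mdeg m))@_(tail_mon m) = w@_m.
Proof.
have tail_inj m' : mdeg m' = mdeg m -> tail_mon m' = tail_mon m -> m' = m.
  move=> Ed Et; have El j : m' (lift ord0 j) = m (lift ord0 j).
    by move/mnmP: Et => /(_ j); rewrite !mnmE.
  apply/mnmP => i; case: (unliftP ord0 i) => [j|] -> //.
  move: Ed; rewrite !mdegE !big_ord_recl (eq_bigr _ (fun j _ => El j)).
  by move/addIn.
rewrite [w in LHS]mpolyE rmorph_sum coef_sum raddf_sum /=.
rewrite [w in RHS]mpolyE raddf_sum /=; apply: eq_bigr => m' _.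
rewrite -mul_mpolyC rmorphM /= chartC chart_mon coefCM coefCM mcoeffCM coefXn.
rewrite mul_mpolyC mcoeffZ mcoeffX; congr (_ * _).
have [E|ne] := eqVneq (mdeg m) (mdeg m'); last first.
  rewrite mulr0 mcoeff0; case: (eqVneq m' m) => // Em.
  by rewrite Em eqxx in ne.
rewrite mulr1 mcoeffX; case: (eqVneq m' m) => [->|ne]; first by rewrite eqxx.
by case: (tail_mon m' =P _) => // /tail_inj Et; rewrite Et ?eqxx in ne.
Qed.

Lemma chart_coef_eq0 w d :
  (chart w)`_d = 0 <-> forall m, mdeg m = d -> w@_m = 0.
Proof.
split=> [E m dm|H]; first by rewrite -mcoeff_chart dm E mcoeff0.
rewrite (mpolyE w) rmorph_sum coef_sum big1 // => m _.
rewrite -mul_mpolyC rmorphM /= chartC chart_mon !coefCM coefXn.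
case: eqP => [E|_]; last by rewrite !mulr0.
by rewrite H // mpolyC0 mul0r.
Qed.

Lemma mcoeff_pihomog (p : {mpoly K[n.+1]}) d m :
  (pihomog mdeg d p)@_m = if mdeg m == d then p@_m else 0.
Proof.
have -> : p@_m = \sum_(m' <- msupp p) (p@_m' *: 'X_[m'])@_m.
  by rewrite {1}(mpolyE p) raddf_sum.
rewrite pihomogE raddf_sum big_mkcond /=.
rewrite (eq_bigr (fun m' => if mdeg m == d then (p@_m' *: 'X_[m'])@_m else 0)).
  by case: ifP => _ //; rewrite big1.
move=> m' _; rewrite mcoeffZ mcoeffX.
by case: (eqVneq m' m) => [->//|ne]; rewrite mulr0; case: ifP; case: ifP.
Qed.

Lemma pihomog_eq0 (p : {mpoly K[n.+1]}) d :
  (pihomog mdeg d p == 0) = ((chart p)`_d == 0).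
Proof.
apply/eqP/eqP => [E|/chart_coef_eq0 E].
  apply/chart_coef_eq0 => m dm; have := mcoeff_pihomog p d m.
  by rewrite E mcoeff0 dm eqxx.
by apply/mpolyP => m; rewrite mcoeff_pihomog mcoeff0; case: eqP => // /E.
Qed.

Lemma size_chart w : size (chart w) = msize w.
Proof.
have [->|w0] := eqVneq w 0; first by rewrite rmorph0 size_poly0 msize0.
apply/eqP; rewrite eqn_leq; apply/andP; split.
  apply/leq_sizeP => d led; apply/chart_coef_eq0 => m dm.
  by apply: memN_msupp_eq0; apply: msize_mdeg_ge; rewrite dm.
rewrite -mlead_deg // ltnNge; apply/negP => /leq_sizeP/(_ _ (leqnn _)).
move/chart_coef_eq0/(_ _ erefl)/eqP; rewrite mleadc_eq0.
by apply/negP.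
Qed.

(** Homogenization inverts the chart up to a power of lambda. *)
Lemma chart_surjective (T : {poly {mpoly K[n]}}) :
  exists N w, chart w = T * 'X^N.
Proof.
pose good P := exists N w, chart w = P * 'X^N.
have goodM P Q : good P -> good Q -> good (P * Q).
  move=> [N [w Ew]] [N' [w' Ew']]; exists (N + N')%N, (w * w').
  by rewrite rmorphM /= Ew Ew' exprD mulrACA.
have goodD P Q : good P -> good Q -> good (P + Q).
  move=> [N [w Ew]] [N' [w' Ew']]; exists (N + N')%N.
  exists (w * 'X_ord0 ^+ N' + w' * 'X_ord0 ^+ N).
  rewrite rmorphD !rmorphM !rmorphXn /= chartX /cons_fun unlift_none Ew Ew'.
  by rewrite exprD mulrDl -!mulrA ['X^N' * _]mulrC.
have goodX : good 'X.
  by exists 0%N, 'X_ord0; rewrite chartX /cons_fun unlift_none mulr1.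
have goodC c : good c%:MP%:P.
  by exists 0%N, c%:MP; rewrite chartC mulr1.
have goodU j : good ('X_j)%:P.
  by exists 1%N, 'X_(lift ord0 j); rewrite chartX /cons_fun liftK expr1.
have goodXn Q e : good Q -> good (Q ^+ e).
  move=> gQ; elim: e => [|e IH]; first by rewrite expr0 -[1]/(1%:P) -mpolyC1.
  by rewrite exprS; apply: (goodM).
have good_coef (a : {mpoly K[n]}) : good a%:P.
  rewrite (mpolyE a) rmorph_sum; apply: (big_ind good) => [|Q Q'|m _].
  - by have := goodC 0; rewrite mpolyC0.
  - exact: (goodD).
  rewrite -mul_mpolyC rmorphM; apply: (goodM); first exact: goodC.
  rewrite mpolyXE_id rmorph_prod; apply: (big_ind good) => [|Q Q'|j _].
  - by have := goodC 1; rewrite mpolyC1.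
  - exact: (goodM).
  - by rewrite rmorphXn; apply: (goodXn); apply: (goodU).
elim/poly_ind: T => [|P a IH]; first by have := good_coef 0.
by apply: (goodD) => //; apply: (goodM).
Qed.

End Chart.

Section Translate.
Variables (K : fieldType) (n : nat).
Implicit Types (A : affpt K n) (f : {mpoly K[n]}).

HB.instance Definition _ A := GRing.RMorphism.copy (translate A)
  (comp_mpoly [tuple 'X_i + (A i)%:MP | i < n]).

Lemma translateC A c : translate A c%:MP = c%:MP.
Proof. exact: comp_mpolyC. Qed.

Lemma translateX A i : translate A 'X_i = 'X_i + (A i)%:MP.
Proof. by rewrite /translate comp_mpolyXU -tnth_nth tnth_mktuple. Qed.

Lemma translate_value (S : comNzRingType) (k : {rmorphism K -> S}) A (u : 'I_n -> S) f :
  mmap k u (translate A f) = mmap k (fun i => u i + k (A i)) f.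
Proof.
apply: (mpoly_rmorph_ext (f := mmap k u \o translate A)
  (g := mmap k (fun i => u i + k (A i)))) => [c|i] /=.
  by rewrite translateC !mmapC.
by rewrite translateX rmorphD /= !mmapXU mmapC.
Qed.

Lemma translateK A : cancel (translate A) (translate [ffun i => - A i]).
Proof.
move=> f; apply: (mpoly_rmorph_ext (f := translate _ \o translate A)
  (g := idfun)) => [c|i] /=; first by rewrite !translateC.
by rewrite translateX rmorphD /= translateX translateC ffunE mpolyCN subrK.
Qed.

Lemma translateNK A : cancel (translate [ffun i => - A i]) (translate A).
Proof.
move=> f; have := translateK [ffun i => - A i] f.
rewrite (_ : [ffun i => - [ffun j => - A j] i] = A) //.
by apply/ffunP => i; rewrite !ffunE opprK.
Qed.

Lemma divides_translate A f g :
  divides f (translate [ffun i => - A i] g) <-> divides (translate A f) g.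
Proof.
split=> [[w E]|[w E]]; first by exists (translate A w); rewrite -rmorphM -E /= translateNK.
by exists (translate [ffun i => - A i] w); rewrite E rmorphM /= translateK.
Qed.

Lemma msize_translate_le A f : (msize (translate A f) <= msize f)%N.
Proof.
have [->|f0] := eqVneq f 0; first by rewrite rmorph0 msize0.
rewrite /translate comp_mpolyEX; apply: leq_trans (msize_sum _ _ _) _.
apply/bigmax_leqP_seq => m mf _; apply: leq_trans (msizeZ_le _ _) _.
rewrite comp_mpolyX; apply: leq_trans (msize_mdeg_lt mf).
rewrite mdegE; apply: msize_prod_bound => i; rewrite tnth_mktuple.
rewrite -[X in (_ <= X.+1)%N]muln1; apply: msizeXn_bound.
apply: leq_trans (msizeD_le _ _) _; rewrite geq_max msizeX mdeg1 leqnn /=.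
by rewrite msizeC (leq_trans (leq_b1 _)).
Qed.

Lemma msize_translate A f : msize (translate A f) = msize f.
Proof.
apply/eqP; rewrite eqn_leq msize_translate_le /=.
by rewrite -{1}(translateK A f) msize_translate_le.
Qed.

End Translate.

(** The degree of [f] and its multiplicity at [A] are the degree and the order in
    lambda of its pullback to the blowup of [A]. The remaining factor [h] is the
    strict transform of the surface. *)
Lemma multiplicity_chart (K : fieldType) n (A : affpt K n.+1)
    (f : {mpoly K[n.+1]}) : f != 0 ->
  exists h : {poly {mpoly K[n]}},
  [/\ chart (translate A f) = h * 'X^(multiplicity A f), h`_0 != 0,
      size h = (total_degree f - multiplicity A f).+1 &
      (multiplicity A f <= total_degree f)%N].
Proof.
move=> f0; set mu := multiplicity A f.
have Esz := size_chart (translate A f); rewrite msize_translate in Esz.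
set P := chart (translate A f) in Esz *.
have szf := mpolySpred mdeg f0.
have Emu : mu = find (fun d => P`_d != 0) (iota 0 (msize f)).
  rewrite /mu /multiplicity msize_translate; apply: eq_find => d.
  by rewrite pihomog_eq0.
have hasP : has (fun d => P`_d != 0) (iota 0 (msize f)).
  apply/hasP; exists (total_degree f).
    by rewrite mem_iota /= /total_degree szf.
  rewrite /total_degree -Esz -lead_coefE lead_coef_eq0 -size_poly_gt0 Esz.
  by rewrite szf.
have lt_mu : (mu < msize f)%N by rewrite Emu -{2}(size_iota 0 (msize f)) -has_find.
have Pmu : P`_mu != 0.
  by have := nth_find 0%N hasP; rewrite -Emu nth_iota.
have P0 i : (i < mu)%N -> P`_i = 0.
  move=> imu; have := before_find 0%N (_ : (i < find _ _)%N).
  move/(_ (fun d => P`_d != 0) (iota 0 (msize f))); rewrite -Emu => /(_ imu).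
  by rewrite nth_iota ?(ltn_trans imu) // => /negbFE/eqP.
exists (drop_poly mu P); split.
- rewrite -{1}(poly_take_drop mu P) (_ : take_poly mu P = 0) ?add0r //.
  by apply/polyP => i; rewrite coef_take_poly coef0; case: ifP => // /P0.
- by rewrite coef_drop_poly.
- by rewrite size_drop_poly Esz szf subSn // -ltnS -szf.
- by rewrite -ltnS /total_degree -szf.
Qed.

(** * Primitive elements and generic fibres *)

Section FractionSubfield.
Variables (R : comNzRingType) (M : fieldType) (ev : {rmorphism R -> M}).

(** The field of fractions of the image of [ev], as a subfield of [M]; it is made a
    type in order to speak of algebraic elements over it. *)
Definition quotients : {pred M} :=
  fun x => `[< exists a b, ev b != 0 /\ x = ev a / ev b >].

Lemma quotientsP x :
  reflect (exists a b, ev b != 0 /\ x = ev a / ev b) (x \in quotients).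
Proof. exact: asboolP. Qed.

Lemma quotients_divring : divring_closed quotients.
Proof.
split=> [|x y|x y].
- by apply/quotientsP; exists 1, 1; rewrite rmorph1 oner_neq0 divr1.
- move=> /quotientsP[a [b [b0 ->]]] /quotientsP[c [d [d0 ->]]].
  apply/quotientsP; exists (a * d - c * b), (b * d).
  rewrite rmorphM mulf_neq0 //; split=> //.
  by rewrite -mulNr addf_div // rmorphB !rmorphM mulNr.
move=> /quotientsP[a [b [b0 ->]]] /quotientsP[c [d [d0 ->]]].
apply/quotientsP; have [c0|c0] := eqVneq (ev c) 0.
  by exists 0, 1; rewrite rmorph1 rmorph0 oner_neq0 c0 mul0r invr0 mulr0 mul0r.
by exists (a * d), (b * c); rewrite !rmorphM mulf_neq0 // invf_div mulf_div.
Qed.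

HB.instance Definition _ := GRing.isDivringClosed.Build M quotients quotients_divring.

Record quotient_field := QuotientField {
  quotient_val : M; quotient_valP : quotient_val \in quotients }.
HB.instance Definition _ := [isSub for quotient_val].
HB.instance Definition _ := [Choice of quotient_field by <:].
HB.instance Definition _ := [SubChoice_isSubIntegralDomain of quotient_field by <:].
HB.instance Definition _ := [SubIntegralDomain_isSubField of quotient_field by <:].

Local Notation L := quotient_field.
Definition quotient_in : L -> M := val.
HB.instance Definition _ := GRing.RMorphism.copy quotient_in val.
Local Notation iota := quotient_in.

Lemma quotients_ev a : ev a \in quotients.
Proof. by apply/quotientsP; exists a, 1; rewrite rmorph1 oner_neq0 divr1. Qed.

Definition to_quotient (a : R) : L := QuotientField (quotients_ev a).

Lemma map_to_quotient (P : {poly R}) :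
  map_poly iota (\poly_(i < size P) to_quotient P`_i) = map_poly ev P.
Proof.
apply/polyP => i; rewrite !coef_map coef_poly /=.
case: ltnP => // /leq_sizeP/(_ i (leqnn i)) ->.
by rewrite !rmorph0.
Qed.

Lemma clear_quotient (x : L) : exists a b, ev b != 0 /\ ev a = ev b * iota x.
Proof.
have /quotientsP[a [b [b0 E]]] := quotient_valP x.
by exists a, b; split=> //; rewrite [iota x]E mulrC divfK.
Qed.

Lemma clear_quotient_poly (P : {poly L}) : exists (P' : {poly R}) b,
  [/\ ev b != 0, map_poly ev P' = ev b *: map_poly iota P & (size P' <= size P)%N].
Proof.
have /choice[f Hf] : forall i, exists ab : R * R,
    ev ab.2 != 0 /\ ev ab.1 = ev ab.2 * iota P`_i.
  by move=> i; have [a [b [b0 E]]] := clear_quotient P`_i; exists (a, b).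
exists (\poly_(i < size P) ((f i).1 * \prod_(j < size P | j != i :> nat) (f j).2)).
exists (\prod_(j < size P) (f j).2); split; last exact: size_poly.
  by rewrite rmorph_prod; apply/prodf_neq0 => j _; case: (Hf j).
apply/polyP => i; rewrite coefZ !coef_map coef_poly /=.
case: ltnP => [lti|/leq_sizeP/(_ i (leqnn i)) ->]; last first.
  by rewrite !rmorph0 mulr0.
rewrite [in RHS](bigD1 (Ordinal lti)) //= !rmorphM /=.
by case: (Hf i) => _ ->; rewrite mulrAC.
Qed.

End FractionSubfield.

(** [mu] is the minimal polynomial of [theta] over the field of fractions of the
    image of [ev], with denominators cleared. The last two properties say that it
    generates the ideal of [theta] and that this ideal is maximal. *)
Definition primitive_data (R : comNzRingType) (M : fieldType)
    (ev : {rmorphism R -> M}) (theta : M) (mu : {poly R}) : Prop :=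
  [/\ (1 < size mu)%N, ev (lead_coef mu) != 0, (map_poly ev mu).[theta] = 0,
      forall P : {poly R}, (map_poly ev P).[theta] = 0 -> exists c q,
        ev c != 0 /\ map_poly ev (c *: P) = map_poly ev (q * mu) &
      forall P : {poly R}, (map_poly ev P).[theta] != 0 -> exists a b c,
        ev c != 0 /\ map_poly ev (a * mu + b * P) = (ev c)%:P].

Section PrimitiveElement.
Variables (R : comNzRingType) (M : fieldType) (ev : {rmorphism R -> M}).
Hypothesis charM : [pchar M] =i pred0.
Local Notation L := (quotient_field ev).
Local Notation iota := (@quotient_in R M ev).

Lemma minimal_data theta : algebraicOver iota theta ->
  exists mu : {poly R}, primitive_data ev theta mu.
Proof.
case=> p p0 rp.
pose good n := `[< exists q : {poly L},
  [/\ q != 0, root (map_poly iota q) theta & size q = n] >].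
have exg : exists n, good n by exists (size p); apply/asboolP; exists p.
case: (ex_minnP exg) => n /asboolP[m [m0 rm <-]] min_m.
have {min_m} mmin q : q != 0 -> (map_poly iota q).[theta] = 0 -> (size m <= size q)%N.
  by move=> q0 rq; apply: min_m; apply/asboolP; exists q; split=> //; apply/eqP.
have mt : (map_poly iota m).[theta] = 0 by apply/eqP.
have m_gt1 : (1 < size m)%N.
  rewrite ltnNge; apply/negP => /size1_polyC Em; move: mt m0.
  rewrite Em map_polyC hornerC => /eqP; rewrite fmorph_eq0 => /eqP ->.
  by rewrite eqxx.
have m_dvd q : (map_poly iota q).[theta] = 0 -> exists r, q = r * m.
  move=> qt; exists (q %/ m)%R; rewrite {1}(divp_eq q m).
  suff -> : (q %% m)%R = 0 by rewrite addr0.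
  apply/eqP/negPn/negP => r0; have := ltn_modp q m; rewrite m0 ltnNge.
  rewrite mmin //; have := congr1 (fun p => (map_poly iota p).[theta]) (divp_eq q m).
  by rewrite /= rmorphD rmorphM /= hornerD hornerM mt mulr0 add0r qt => <-.
have [mu [b0 [b00 Emu smu]]] := clear_quotient_poly m.
have mu_lead : ev mu`_(size m).-1 = ev b0 * iota (lead_coef m).
  by rewrite -[LHS](coef_map ev) Emu coefZ coef_map.
have mu_lead0 : ev mu`_(size m).-1 != 0.
  by rewrite mu_lead mulf_neq0 // fmorph_eq0 lead_coef_eq0.
have szmu : size mu = size m.
  apply/eqP; rewrite eqn_leq smu /= leqNgt; apply: contra mu_lead0 => lt.
  rewrite nth_default ?rmorph0 // -ltnS prednK // ?size_poly_gt0 //.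
exists mu; split.
- by rewrite szmu.
- by rewrite lead_coefE szmu.
- by rewrite Emu hornerZ mt mulr0.
- move=> P; rewrite -(map_to_quotient ev) => /m_dvd[r Er].
  have [q [b [b_neq0 Eq _]]] := clear_quotient_poly r.
  exists (b * b0), q; rewrite rmorphM mulf_neq0 //; split=> //.
  rewrite rmorphM /= Eq Emu map_polyZ /= rmorphM -(map_to_quotient ev) Er.
  by rewrite rmorphM /= -scalerAl -scalerAr scalerA.
move=> P; set PL := \poly_(i < size P) to_quotient ev P`_i.
have EPL : map_poly iota PL = map_poly ev P by exact: map_to_quotient.
rewrite -EPL => PLt.
have : coprimep m PL.
  rewrite /coprimep; have [[r Er] [r' Er']] : (exists r, m = r * gcdp m PL) /\
      (exists r, PL = r * gcdp m PL).
    by split; apply/dvdpP; rewrite ?dvdp_gcdl ?dvdp_gcdr.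
  have g0 : gcdp m PL != 0 by rewrite gcdp_eq0 (negPf m0).
  have r0 : r != 0 by apply: contraNneq m0 => r0; rewrite Er r0 mul0r.
  have gt : (map_poly iota (gcdp m PL)).[theta] != 0.
    apply: contraNneq PLt => gt.
    by rewrite Er' rmorphM /= hornerM gt mulr0.
  have rt : (map_poly iota r).[theta] = 0.
    move/eqP: mt; rewrite {1}Er rmorphM /= hornerM mulf_eq0 (negPf gt) orbF.
    by move/eqP.
  have := mmin _ r0 rt; rewrite {1}Er size_mul // eqn_leq size_poly_gt0 g0 andbT.
  have : (0 < size r)%N by rewrite size_poly_gt0.
  by case: (size r) => // k _; rewrite addSn /= -[k.+1]addn1 leq_add2l.
move/Bezout_coprimepP => [[u v] /=]; rewrite -size_poly_eq1 => /size_poly1P[k k0 Ek].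
have [u' [bu [bu0 Eu _]]] := clear_quotient_poly u.
have [v' [bv [bv0 Ev _]]] := clear_quotient_poly v.
have [a [bk [bk0 Ea]]] := clear_quotient k.
exists (bk *: (bv *: u')), (bk *: (bu *: (b0 *: v'))), (bu * bv * b0 * a).
rewrite !rmorphM !mulf_neq0 //; last by rewrite Ea mulf_neq0 // fmorph_eq0.
split=> //; rewrite rmorphD !rmorphM /= !map_polyZ /= Eu Ev Emu -EPL.
have := congr1 (map_poly iota) Ek.
rewrite rmorphD !rmorphM /= map_polyC /= => Ek'.
by rewrite Ea polyCM -Ek' -!mul_polyC; ring.
Qed.

(** By the primitive element theorem, [t] and [s] are polynomials over the fraction
    field in [theta = e s - t]; [A] and [B] are these polynomials over the common
    denominator [delta]. *)
Lemma primitive_element t s : algebraicOver iota t -> algebraicOver iota s ->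
  exists (e : nat) (mu A B : {poly R}) (delta : R),
  [/\ primitive_data ev (s *+ e - t) mu, ev delta != 0,
      (map_poly ev A).[s *+ e - t] = ev delta * t &
      (map_poly ev B).[s *+ e - t] = ev delta * s].
Proof.
move=> At As; have [p p0 rp] := At; have [q q0 rq] := As.
have charL : [pchar L] =i pred0 by move=> c; rewrite -(fmorph_pchar iota) charM.
have [e /= [[qt Et] [qs Es]]] := pchar0_PET p0 rp q0 rq charL.
have At' : algebraicOver iota (s *+ e - t).
  apply: algebraic_sub => //; elim: e {Et Es} => [|e IH].
    by rewrite mulr0n; apply: algebraic0.
  by rewrite mulrS; apply: algebraic_add.
have [mu mu_data] := minimal_data At'.
have [A [a [a0 EA _]]] := clear_quotient_poly qt.
have [B [b [b0 EB _]]] := clear_quotient_poly qs.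
exists e, mu, (b *: A), (a *: B), (a * b); split=> //.
- by rewrite rmorphM mulf_neq0.
- by rewrite map_polyZ /= EA !hornerZ Et rmorphM; ring.
- by rewrite map_polyZ /= EB !hornerZ Es rmorphM; ring.
Qed.
End PrimitiveElement.

Lemma ord2_cases (i : 'I_2) : i = 0 \/ i = 1.
Proof. by case: i => [[|[|//]]] lt; [left|right]; apply: val_inj. Qed.

Lemma cleared_value (K : nzRingType) (A : comNzRingType) (F : fieldType)
    (h : {rmorphism A -> F}) (k : K -> A) (kF : K -> F) m (P : {mpoly K[m]}) N q
    (p : 'I_m -> A) (w : 'I_m -> F) :
  (msize P <= N.+1)%N -> h \o k =1 kF -> h q != 0 ->
  (forall i, h (p i) = h q * w i) ->
  h (cleared k P N q p) = h q ^+ N * mmap kF w P.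
Proof.
move=> PN hk q0 hp; rewrite cleared_rmorph cleared_field //; congr (_ * _).
rewrite /mmap; apply: eq_bigr => e _; rewrite -hk /=; congr (_ * _).
by apply: mmap1_eq => i /=; rewrite hp mulrC mulKf.
Qed.

(** [P'] arises by substituting [A_i / d] for the variables of [P] and clearing
    denominators; it serves at the generic point of the surface and, for another
    [h], at its closed points. *)
Lemma cleared_horner (K : nzRingType) (R : comNzRingType) (k : K -> R) m
    (P : {mpoly K[m]}) N (d : R) (AB : 'I_m -> {poly R}) : (msize P <= N.+1)%N ->
  exists P' : {poly R}, forall (F : fieldType) (h : {rmorphism R -> F}) (kF : K -> F)
    (x : F) (w : 'I_m -> F),
    (forall c, h (k c) = kF c) -> h d != 0 ->
    (forall i, (map_poly h (AB i)).[x] = h d * w i) ->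
    (map_poly h P').[x] = h d ^+ N * mmap kF w P.
Proof.
move=> PN; exists (cleared (polyC \o k) P N d%:P AB) => F h kF x w hk d0 hAB.
have E : (map_poly h d%:P).[x] = h d by rewrite map_polyC hornerC.
rewrite -E; apply: (@cleared_value _ _ _ (horner_eval x \o map_poly h)) => //=.
- by move=> c; rewrite /= map_polyC /horner_eval hornerC /= hk.
- by rewrite /horner_eval E.
- by move=> i; rewrite /horner_eval E hAB.
Qed.

Lemma separable_roots (K : closedFieldType) (p u v : {poly K}) c : c != 0 ->
  u * p + v * p^`() = c%:P -> exists rs : seq K,
  [/\ uniq rs, size rs = (size p).-1 & forall x, root p x = (x \in rs)].
Proof.
move=> c0 E; have p0 : p != 0.
  apply: contraNneq c0 => p0; move: E; rewrite p0 derivC !mulr0 addr0.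
  by move/esym/eqP; rewrite polyC_eq0.
have [rs Ep] := closed_field_poly_normal p; exists rs.
have lc0 : lead_coef p != 0 by rewrite lead_coef_eq0.
split=> [||x].
- rewrite -separable_prod_XsubC -(eqp_separable (eqp_scale _ lc0)) -Ep unlock.
  apply/Bezout_coprimepP; exists (u, v) => /=.
  by rewrite E -size_poly_eq1 size_polyC c0.
- by rewrite {1}Ep size_scale // size_prod_XsubC.
- by rewrite {1}Ep rootZ // root_prod_XsubC.
Qed.

Lemma bezout_neq0 (R S : comNzRingType) (h : {rmorphism R -> S}) (u v p q : {poly R})
    r x : map_poly h (u * p + v * q) = (h r)%:P -> h r != 0 ->
  (map_poly h p).[x] = 0 -> (map_poly h q).[x] != 0.
Proof.
move=> E r0 px; apply: contraNneq r0 => qx.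
have := congr1 (horner^~ x) E; rewrite rmorphD !rmorphM /= hornerD !hornerM px qx.
by rewrite !mulr0 addr0 hornerC => <-.
Qed.

Lemma horner_map_linear (R S : comNzRingType) (h : {rmorphism R -> S}) a
    (p q : {poly R}) x :
  (map_poly h (a%:P * p - q)).[x] = h a * (map_poly h p).[x] - (map_poly h q).[x].
Proof. by rewrite rmorphB rmorphM /= map_polyC hornerD hornerN hornerM hornerC. Qed.

Lemma horner_map_combination (R S : comNzRingType) (h : {rmorphism R -> S}) a
    (p q : {poly R}) e x :
  (map_poly h (a%:P * 'X - (q *+ e - p))).[x] =
  h a * x - ((map_poly h q).[x] *+ e - (map_poly h p).[x]).
Proof.
by rewrite horner_map_linear map_polyX hornerX rmorphB rmorphMn /= hornerD hornerN
           hornerMn.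
Qed.

Lemma horner_map_relation (R S : comNzRingType) (h : {rmorphism R -> S}) a
    (p q r : {poly R}) x : map_poly h (a *: p) = map_poly h (q * r) ->
  (map_poly h r).[x] = 0 -> h a * (map_poly h p).[x] = 0.
Proof.
move=> /(congr1 (horner^~ x)) + rx; rewrite map_polyZ rmorphM /= hornerZ hornerM rx.
by rewrite mulr0.
Qed.

Lemma deriv_neq0 (F : fieldType) (p : {poly F}) : [pchar F] =i pred0 ->
  (1 < size p)%N -> p^`() != 0.
Proof.
move=> /pcharf0P char0; case Esz : (size p) => [|[|d]] // _.
have lp : p`_d.+1 != 0.
  have -> : p`_d.+1 = lead_coef p by rewrite lead_coefE Esz.
  by rewrite lead_coef_eq0 -size_poly_gt0 Esz.
apply: contraNneq lp => /(congr1 (fun q : {poly F} => q`_d)); rewrite coef_deriv coef0.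
by rewrite -mulr_natr => /eqP; rewrite mulf_eq0 char0 orbF.
Qed.

Lemma spec_toMn (K M : fieldType) (k : {rmorphism K -> M}) n (Q : 'I_n -> M)
    (p : 'I_n -> K) x c e : specializes k Q p ->
  spec_to k Q p x c -> spec_to k Q p (x *+ e) (c *+ e).
Proof.
move=> sp xc; rewrite -mulr_natr -[c *+ e]mulr_natr -(rmorph_nat k).
by apply: spec_toM => //; apply: spec_toC.
Qed.

Section GenericFibre.
Variables (K : closedFieldType) (M : fieldType) (k : {rmorphism K -> M}).
Variables (gX : 'I_2 -> M) (n : nat) (Q : 'I_n -> M) (nu de : 'I_n -> {mpoly K[2]}).
Hypothesis charK : [pchar K] =i pred0.
Hypothesis gX_free : forall v : affpt K 2, specializes k gX v.
Hypothesis de_neq0 : forall i, mmap k gX (de i) != 0.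
Hypothesis QE : forall i, Q i = mmap k gX (nu i) / mmap k gX (de i).
Local Notation R := {mpoly K[n]}.

Let ev : {rmorphism R -> M} := mmap k Q.
Hypothesis alg_t : forall i, algebraicOver (@quotient_in _ _ ev) (gX i).

Lemma specialize_poly (p : affpt K n) (P P' : {poly R}) : specializes k Q p ->
  map_poly ev P = map_poly ev P' -> map_poly (meval p) P = map_poly (meval p) P'.
Proof.
move=> sp E; apply/polyP => i; rewrite !coef_map /=; apply/eqP.
rewrite -subr_eq0 -mevalB; apply/eqP/sp.
have := congr1 (fun T : {poly M} => T`_i) E; rewrite !coef_map => E'.
by rewrite -[LHS]/(ev _) rmorphB /= E' subrr.
Qed.

(** Above a general point [p] of the image, a point [v] of the fibre is
    determined by the value of the primitive element, which is a root of its
    minimal polynomial specialized at [p]; conversely every root occurs. *)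
Lemma generic_fibre : exists (d : nat) (beta : R),
  [/\ (0 < d)%N, mmap k Q beta != 0 &
  forall p : affpt K n, specializes k Q p -> beta.@[p] != 0 ->
    exists vs : seq (affpt K 2),
      [/\ uniq vs, size vs = d &
        forall v : affpt K 2, (forall i, spec_to k gX v (Q i) (p i)) <-> v \in vs]].
Proof.
have charM : [pchar M] =i pred0.
  by move=> c; rewrite (fmorph_pchar k) charK.
have [e [mu [A [B [dl [mu_data dl0 EA EB]]]]]] :=
  primitive_element charM (alg_t 0) (alg_t 1).
set theta := _ - _ in mu_data EA EB.
have [sz_mu lc_mu mu_theta mu_ideal mu_max] := mu_data.
pose AB (i : 'I_2) := if i == 0 then A else B.
have EAB i : (map_poly ev (AB i)).[theta] = ev dl * gX i.
  by rewrite /AB; have [->|->] := ord2_cases i.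
pose N := (\max_i maxn (msize (nu i)) (msize (de i)))%N.
have nN i : (msize (nu i) <= N.+1)%N.
  by rewrite leqW // (bigmax_sup i) // leq_maxl.
have dN i : (msize (de i) <= N.+1)%N.
  by rewrite leqW // (bigmax_sup i) // leq_maxr.
have /choice[num num_at] : forall i, _ := fun i =>
  cleared_horner (@mpolyC n K) dl AB (nN i).
have /choice[den den_at] : forall i, _ := fun i =>
  cleared_horner (@mpolyC n K) dl AB (dN i).
have evC c : ev c%:MP = k c by exact: mmapC.
have den_val i : (map_poly ev (den i)).[theta] = ev dl ^+ N * mmap k gX (de i).
  exact: (den_at i M ev k theta gX).
have num_val i : (map_poly ev (num i)).[theta] = ev dl ^+ N * mmap k gX (nu i).
  exact: (num_at i M ev k theta gX).
have evX i : ev 'X_i = Q i by exact: mmapXU.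
have den_theta i : (map_poly ev (den i)).[theta] != 0.
  by rewrite den_val mulf_neq0 ?expf_neq0.
have num_theta i : (map_poly ev (('X_i)%:P * den i - num i)).[theta] = 0.
  rewrite (horner_map_linear ev 'X_i (den i) (num i) theta).
  rewrite (den_val i) (num_val i) (evX i) QE.
  by rewrite mulrCA divfK // subrr.
have tau_theta : (map_poly ev (dl%:P * 'X - (B *+ e - A))).[theta] = 0.
  by rewrite horner_map_combination EA EB -mulrnAr -mulrBr subrr.
have mu'_theta : (map_poly ev mu^`()).[theta] != 0.
  apply/negP => /eqP /mu_ideal[c [q [c0 E]]].
  set p := map_poly ev mu in E mu_theta *.
  have sz_p : size p = size mu by rewrite size_map_poly_id0.
  have p0 : p != 0 by rewrite -size_poly_gt0 sz_p ltnW.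
  have p'0 : p^`() != 0 by apply: deriv_neq0; rewrite ?sz_p.
  have := lt_size_deriv p0; rewrite ltnNge => /negP; apply.
  have E' : ev c *: p^`() = map_poly ev q * p.
    by rewrite /p deriv_map -map_polyZ E rmorphM.
  have qp0 : map_poly ev q * p != 0 by rewrite -E' scale_poly_eq0 negb_or c0.
  rewrite -(size_scale (p^`()) c0) E'; move: qp0; rewrite mulf_eq0 negb_or => /andP[q0 _].
  rewrite size_mul //; have : (0 < size (map_poly ev q))%N by rewrite size_poly_gt0.
  by case: (size (map_poly ev q)) => // j _; rewrite addSn /= leq_addl.
have /choice[cd Hcd] : forall i, exists abc : {poly R} * {poly R} * R,
    ev abc.2 != 0 /\
    map_poly ev (abc.1.1 * mu + abc.1.2 * den i) = (ev abc.2)%:P.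
  by move=> i; have [a [b [c H]]] := mu_max _ (den_theta i); exists (a, b, c).
have /choice[cn Hcn] : forall i, exists cq : R * {poly R},
    ev cq.1 != 0 /\
    map_poly ev (cq.1 *: (('X_i)%:P * den i - num i)) = map_poly ev (cq.2 * mu).
  by move=> i; have [c [q H]] := mu_ideal _ (num_theta i); exists (c, q).
have [ct [qt [ct0 Ect]]] := mu_ideal _ tau_theta.
have [a' [b' [c' [c'0 Ec']]]] := mu_max _ mu'_theta.
(* Where [beta] does not vanish, the point [(A / dl, B / dl)] is defined, [mu] keeps
   its degree, its roots are simple ([c']), the relation [tau_theta] that recovers
   [theta] holds at them ([ct]), the denominators of [Q] do not vanish ([cd]) and
   [Q] takes the value [p] there ([cn]). *)
exists (size mu).-1, (dl * lead_coef mu * c' * ct * \prod_i (cd i).2 * \prod_i (cn i).1).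
split; first by rewrite -subn1 subn_gt0.
  rewrite -[mmap k Q _]/(ev _) !rmorphM !rmorph_prod !mulf_neq0 //.
    by apply/prodf_neq0 => i _; case: (Hcd i).
  by apply/prodf_neq0 => i _; case: (Hcn i).
move=> p sp; rewrite !mevalM !mulf_eq0 !negb_or -!andbA.
case/and5P=> dlp lcp c'p ctp; rewrite !rmorph_prod /=.
move=> /andP[/prodf_neq0 cdp /prodf_neq0 cnp].
pose ep : {rmorphism R -> K} := meval p.
have sz_mup : size (map_poly ep mu) = size mu by rewrite size_map_poly_id0.
have Bez : map_poly ep a' * map_poly ep mu + map_poly ep b' * (map_poly ep mu)^`() =
    (ep c')%:P.
  rewrite deriv_map -!rmorphM -rmorphD /= -map_polyC /=.
  by apply: specialize_poly => //; rewrite Ec' map_polyC.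
have [rs [urs srs rsP]] := separable_roots c'p Bez.
pose pt tau : affpt K 2 := [ffun i => (map_poly ep (AB i)).[tau] / ep dl].
have epC c : ep c%:MP = c by exact: mevalC.
have AB_tau tau i : (map_poly ep (AB i)).[tau] = ep dl * pt tau i.
  by rewrite ffunE mulrCA divff // mulr1.
have den_tau i tau : (map_poly ep (den i)).[tau] = ep dl ^+ N * (de i).@[pt tau].
  exact: (den_at i K ep idfun tau (pt tau)).
have num_tau i tau : (map_poly ep (num i)).[tau] = ep dl ^+ N * (nu i).@[pt tau].
  exact: (num_at i K ep idfun tau (pt tau)).
have tauE tau : (map_poly ep mu).[tau] = 0 -> tau = pt tau 1 *+ e - pt tau 0.
  move=> mut; have := horner_map_relation (specialize_poly sp Ect) mut.
  move/eqP; rewrite mulf_eq0 (negPf ctp) horner_map_combination subr_eq0 => /eqP E.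
  apply: (mulfI dlp); rewrite mulrBr mulrnAr !ffunE ![ep dl * _]mulrC !divfK //.
  by rewrite mulrC.
have pt_inj : {in rs &, injective pt}.
  move=> x y; rewrite -!rsP => /eqP rx /eqP ry Exy.
  by rewrite (tauE _ rx) (tauE _ ry) Exy.
exists (map pt rs); split.
- by rewrite map_inj_in_uniq.
- by rewrite size_map srs sz_mup.
move=> v; split=> [sv|/mapP[tau]].
  pose tau := v 1 *+ e - v 0.
  have gv : specializes k gX v by exact: gX_free.
  have st : spec_to k gX v theta tau.
    by apply: spec_toB => //; [apply: spec_toMn => // |]; apply: spec_toX.
  have s_poly (P : {poly R}) : spec_to k gX v (map_poly ev P).[theta] (map_poly ep P).[tau].
    exact: spec_to_horner.
  have mut : (map_poly ep mu).[tau] = 0.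
    apply: (spec_to_inj gv (s_poly mu)); rewrite mu_theta -(rmorph0 k).
    exact: spec_toC.
  apply/mapP; exists tau; first by rewrite -rsP; apply/eqP.
  apply/ffunP => i; apply: (mulfI dlp); rewrite -[RHS](AB_tau tau i).
  apply/esym; apply: (spec_to_inj gv (s_poly (AB i))); rewrite EAB.
  by apply: spec_toM => //; [apply: spec_to_mpoly | apply: spec_toX].
rewrite -rsP => /eqP mut -> i.
have den_v : (de i).@[pt tau] != 0.
  have [cd0 Ecd] := Hcd i.
  have E : map_poly ep ((cd i).1.1 * mu + (cd i).1.2 * den i) = (ep (cd i).2)%:P.
    by rewrite -map_polyC; apply: specialize_poly => //; rewrite Ecd map_polyC.
  have := bezout_neq0 E (cdp i isT) mut.
  by rewrite den_tau mulf_eq0 negb_or => /andP[].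
have [cn0 Ecn] := Hcn i.
have := horner_map_relation (specialize_poly sp Ecn) mut.
move/eqP; rewrite mulf_eq0 (negPf (cnp i isT)) (horner_map_linear ep) (den_tau i) (num_tau i).
rewrite /= mulrCA -mulrBr mulf_eq0 expf_eq0 (negPf dlp) andbF /= subr_eq0 mevalXU.
move/eqP => E; exists (nu i), (de i); split=> //.
by rewrite -E mulfK.
Qed.

End GenericFibre.

(** * Degrees of rational maps *)

Lemma card_eq_seq (T : eqType) (s : seq T) (B : set T) : uniq s ->
  (forall x, B x <-> x \in s) -> (B #= `I_(size s))%card.
Proof.
case: s => [|x0 s] us Bs.
  rewrite (_ : B = set0); first by rewrite II0; apply: card_eq00.
  by apply/seteqP; split=> x // /Bs.
move: (x0 :: s) us Bs => {}s us Bs.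
have -> : B = nth x0 s @` `I_(size s).
  apply/seteqP; split=> [x /Bs xs|_ [i lti <-]]; last by apply/Bs; apply: mem_nth.
  exists (index x s); last exact: nth_index.
  by change (index x s < size s)%N; rewrite index_mem.
apply: inj_card_eq => i j; rewrite !inE => lti ltj /eqP.
by rewrite nth_uniq // => /eqP.
Qed.

Section MapDegree.
Variables (K : fieldType) (m n : nat) (phi : ratmap K m n) (Z : set (affpt K n)).

Lemma nonzero_open (w : {mpoly K[n]}) :
  zariski_open [set p : affpt K n | w.@[p] != 0].
Proof.
exists [set w]; apply/seteqP; split=> p /=.
  by move=> wp q ->; apply/eqP/negPn/negP.
by move=> /(_ _ erefl) ->; rewrite eqxx.
Qed.

Lemma open_nonzero (U : set (affpt K n)) p : zariski_open U -> U p ->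
  exists w : {mpoly K[n]}, w.@[p] != 0 /\ forall q : affpt K n, w.@[q] != 0 -> U q.
Proof.
move=> [S ES] Up.
have [w [Sw wp]] : exists w, S w /\ w.@[p] != 0.
  apply: contrapT => H; have : (~` U) p.
    rewrite ES => q Sq /=; apply/eqP/negPn/negP => qp.
    by apply: H; exists q.
  exact.
exists w; split=> // q wq; apply: contrapT => nUq.
by have : (~` U) q by []; rewrite ES => /(_ _ Sw) /eqP; rewrite (negPf wq).
Qed.

Hypothesis irreducible_Z : forall w w' : {mpoly K[n]},
  (exists2 p : affpt K n, Z p & w.@[p] != 0) ->
  (exists2 p : affpt K n, Z p & w'.@[p] != 0) ->
  exists p : affpt K n, [/\ Z p, w.@[p] != 0 & w'.@[p] != 0].

(** Two nonempty open subsets of an irreducible set meet. *)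
Lemma map_degreeE d : generic_fibre_card phi Z d -> map_degree phi Z = d.
Proof.
move=> gd; apply: xget_unique => // d' [U' [oU' [p' [Zp' Up']] HU']].
have [U [oU [p [Zp Up]] HU]] := gd.
have [w [wp wU]] := open_nonzero oU Up.
have [w' [wp' wU']] := open_nonzero oU' Up'.
have [q [Zq wq w'q]] := irreducible_Z (ex_intro2 _ _ p Zp wp)
  (ex_intro2 _ _ p' Zp' wp').
apply/card_eq_II.
have c1 := HU q (conj Zq (wU _ wq)).
have c2 := HU' q (conj Zq (wU' _ w'q)).
by apply: card_eq_trans c1; rewrite card_eq_sym.
Qed.

Lemma generic_fibre_card_seq d (w : {mpoly K[n]}) :
  (exists2 p : affpt K n, Z p & w.@[p] != 0) ->
  (forall p : affpt K n, Z p -> w.@[p] != 0 -> exists vs : seq (affpt K m),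
     [/\ uniq vs, size vs = d & forall v, fibre phi p v <-> v \in vs]) ->
  generic_fibre_card phi Z d.
Proof.
move=> [p0 Zp0 wp0] H; exists [set p : affpt K n | w.@[p] != 0]; split.
- exact: nonzero_open.
- by exists p0.
move=> p [Zp wp]; have [vs [uvs <- Hvs]] := H p Zp wp.
exact: card_eq_seq.
Qed.

End MapDegree.

Section Dominance.
Variables (K : closedFieldType) (m n : nat) (phi : ratmap K m n).

(** The numerator of [w(phi)] vanishes wherever the denominators do not, hence
    everywhere. *)
Lemma mmap_eq0_on_dom w :
  (forall v, ratmap_dom phi v -> w.@[ratmap_val phi v] = 0) ->
  mmap (@fracC K m) phi w = 0.
Proof.
move=> H; set x := mmap _ _ _; rewrite -[x]rnum_div_rden.
suff : rnum x * (rden x * \prod_i rden (phi i)) = 0.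
  move/eqP; rewrite mulf_eq0 [_ * \prod_i _ == 0]mulf_eq0 (negPf (rden_neq0 x)) /=.
  rewrite (negPf (_ : \prod_i rden (phi i) != 0)) ?orbF.
    by move=> /eqP ->; rewrite rmorph0 mul0r.
  by apply/prodf_neq0 => i _; apply: rden_neq0.
apply: mpoly_eq0_points => v; rewrite !mevalM; apply/eqP/negPn/negP.
rewrite !mulf_eq0 !negb_or rmorph_prod => /and3P[nx dx /prodf_neq0 dphi].
have dom_v : ratmap_dom phi v by move=> i; apply: dphi.
have sx : spec_to (@fracC K m) (@fracX K m) v x 0.
  rewrite -(H v dom_v); apply: spec_to_mpoly => [|i]; first exact: fracX_specializes.
  by move: i; apply/fibreP.
case/spec_to_rden: sx => _ /eqP; rewrite mulf_eq0 invr_eq0 (negPf dx) orbF.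
by rewrite (negPf nx).
Qed.

Lemma mmap_eq0_vanishes (Z : set (affpt K n)) w : dominant_onto phi Z ->
  mmap (@fracC K m) phi w = 0 -> forall p, Z p -> w.@[p] = 0.
Proof.
move=> [_ dense] w0; have closedC : zariski_closed (zeros w).
  exists [set w]; apply/seteqP; split=> [p wp q ->//|p]; exact.
apply: (dense _ closedC) => _ [v dv <-]; rewrite /zeros /=.
apply: (spec_to_inj (@fracX_specializes K m v) (x := 0)).
  rewrite -w0; apply: spec_to_mpoly => [|i]; first exact: fracX_specializes.
  by move: i; apply/fibreP.
by rewrite -(rmorph0 (@fracC K m)); apply: spec_toC.
Qed.

End Dominance.

Lemma strip_root0 (R : idomainType) (p : {poly R}) : p != 0 ->
  exists (q : {poly R}) (j : nat), q`_0 != 0 /\ p = q * 'X^j.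
Proof.
move=> p0; have [j [q]] := multiplicity_XsubC p 0.
rewrite p0 subr0 /= /root horner_coef0 => q0 ->.
by exists q, j.
Qed.

(** If [chi] is algebraically independent, the locus where [y] vanishes is mapped
    by [chi] into a curve: a minimal relation between [y] and [chi] has a constant
    term, which vanishes there. *)
Lemma vanishing_locus_image (K : closedFieldType) n
    (chi : ratmap K n n) (y : {fraction {mpoly K[n]}}) :
  (forall F, mmap (@fracC K n) chi F = 0 -> F = 0) -> y != 0 ->
  exists F : {mpoly K[n]}, F != 0 /\
  forall m (Q : 'I_m -> {fraction {mpoly K[n]}}) (p : 'I_m -> K) (u : affpt K n),
    specializes (@fracC K n) Q p ->
    (forall i, spec_to (@fracC K n) Q p (chi i) (u i)) ->
    spec_to (@fracC K n) Q p y 0 -> F.@[u] = 0.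
Proof.
move=> indep y0; have [P P0 EP] := algebraic_dependence (cons_fun y chi).
have R0 : head_poly P != 0.
  by apply: contraNneq P0 => E; rewrite -(head_polyK P) E rmorph0.
have [q [j [q0 Eq]]] := strip_root0 R0.
exists q`_0; split=> // m Q p u sp schi sy.
move: EP; rewrite mmap_cons Eq rmorphM /= map_polyXn hornerM hornerXn => /eqP.
rewrite mulf_eq0 (negPf (expf_neq0 _ y0)) orbF => /eqP qy.
have := spec_to_horner sp q schi sy; rewrite qy => s0.
have := spec_to_inj sp s0; rewrite -(rmorph0 (@fracC K n)).
move/(_ 0 (spec_toC _ Q p 0)); rewrite horner_coef0 coef_map => <-.
by [].
Qed.

(** * Projecting a parametrized surface from a point *)

Lemma divides_linear (K : fieldType) n (f l : {mpoly K[n]}) :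
  f \isn't a GRing.unit -> msize l = 2%N -> divides f l ->
  exists2 c, c != 0 & l = c *: f.
Proof.
move=> nUf sl [r El]; have : l != 0 by rewrite -msize_poly_eq0 sl.
rewrite El mulf_eq0 negb_or => /andP[r0 f0].
have f_gt1 : (1 < msize f)%N.
  rewrite ltnNge; apply: contra nUf => /msize1_polyC Ef; rewrite Ef.
  by apply: rmorph_unit; rewrite unitfE -(mpolyC_eq0 n) -Ef.
have : msize (r * f) = 2%N by rewrite -El.
rewrite msizeM // (mpolySpred mdeg r0) addSn /= => sr.
have /msize_poly1P[c c0 Er] : msize r == 1%N.
  rewrite (mpolySpred mdeg r0) eqSS -leqn0 -(leq_add2r (msize f)) sr add0n.
  exact: f_gt1.
by exists c => //; rewrite Er mul_mpolyC.
Qed.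

Lemma msize_linear (K : fieldType) n (i : 'I_n) (p : {mpoly K[n]}) :
  (msize p <= 2)%N -> p@_(U_(i))%MM = 1 -> msize p = 2%N.
Proof.
move=> sp pi; apply/eqP; rewrite eqn_leq sp /=.
have : U_(i)%MM \in msupp p by rewrite mcoeff_msupp pi oner_neq0.
by move/msize_mdeg_lt; rewrite mdeg1.
Qed.

(** Comparing constant terms, ['X] divides the cofactor. *)
Lemma divides_stripX (R : idomainType) (h P : {poly R}) N :
  h`_0 != 0 -> divides h (P * 'X^N) -> divides h P.
Proof.
move=> h0; elim: N => [|N IH]; first by rewrite mulr1.
move=> [q E]; apply: IH.
have q0 : q`_0 = 0.
  apply/eqP; have := congr1 (fun p : {poly R} => p`_0) E.
  rewrite exprS mulrCA coefXM eqxx coef0M => /esym/eqP.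
  by rewrite mulf_eq0 (negPf h0) orbF.
have Eq : q = drop_poly 1 q * 'X.
  rewrite -{1}(poly_take_drop 1 q) expr1 -[RHS]add0r; congr (_ + _).
  apply/polyP => i; rewrite coef_take_poly coef0.
  by case: i => // _; rewrite q0.
exists (drop_poly 1 q); have X0 : ('X : {poly R}) != 0 by rewrite polyX_eq0.
apply: (mulIf X0); rewrite -[LHS]mulrA -exprSr E {1}Eq.
by rewrite mulrAC.
Qed.

(** A relation between the components of [Q] holds on the image, hence on its closure
    [zeros f], and is then divisible by [f]. *)
Lemma ideal_of_dominant (K : closedFieldType) n m (f : {mpoly K[n]})
    (Q : ratmap K m n) w : irreducible_elt f -> dominant_onto Q (zeros f) ->
  mmap (@fracC K m) Q w = 0 <-> divides f w.
Proof.
move=> irr_f dominant_Q; split=> [E|[r ->]].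
  by apply: (vanishing_divides irr_f); apply: mmap_eq0_vanishes dominant_Q E.
rewrite rmorphM /= (_ : mmap _ Q f = 0) ?mulr0 //.
apply: mmap_eq0_on_dom => v dv; apply: dominant_Q.1.
by exists v.
Qed.

Section Projection.
Variables (K : closedFieldType) (M : fieldType) (k : {rmorphism K -> M}).
Variables (f : {mpoly K[3]}) (Q : 'I_3 -> M) (A : affpt K 3).
Hypothesis irr_f : irreducible_elt f.
Hypothesis ideal_of_image : forall w, mmap k Q w = 0 <-> divides f w.
Hypothesis not_coord_plane : forall c, zeros f <> coord_plane 0 c.

Lemma specializes_zeros (p : affpt K 3) : f.@[p] = 0 -> specializes k Q p.
Proof. by move=> fp w /ideal_of_image[r ->]; rewrite mevalM fp mulr0. Qed.

Lemma zeros_nonvanishing w : mmap k Q w != 0 ->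
  exists2 p : affpt K 3, zeros f p & w.@[p] != 0.
Proof.
move=> w0; apply: contrapT => H; case/negP: w0; apply/eqP/ideal_of_image.
apply: (vanishing_divides irr_f) => p fp; apply/eqP/negPn/negP => wp.
by apply: H; exists p.
Qed.

Lemma zeros_irreducible w w' :
  (exists2 p : affpt K 3, zeros f p & w.@[p] != 0) ->
  (exists2 p : affpt K 3, zeros f p & w'.@[p] != 0) ->
  exists p : affpt K 3, [/\ zeros f p, w.@[p] != 0 & w'.@[p] != 0].
Proof.
have nz u : (exists2 p : affpt K 3, zeros f p & u.@[p] != 0) -> mmap k Q u != 0.
  by move=> [p /specializes_zeros sp]; apply: contraNneq => /sp ->.
move=> /nz w0 /nz w'0; have [|p Zp] := @zeros_nonvanishing (w * w').
  by rewrite rmorphM mulf_neq0.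
by rewrite mevalM mulf_eq0 negb_or => /andP[]; exists p.
Qed.

Lemma not_unit_f : f \isn't a GRing.unit.
Proof. by case: irr_f. Qed.

Let x : M := Q 0 - k (A 0).

(** Otherwise [f] divides, and so is proportional to, the equation of a plane parallel
    to a coordinate plane. *)
Lemma abscissa_neq0 : x != 0.
Proof.
apply/eqP => x0; set l := 'X_0 - (A 0)%:MP : {mpoly K[3]}.
have sl : msize l = 2%N.
  apply: (@msize_linear _ _ 0).
    rewrite (leq_trans (msizeD_le _ _)) // msizeN msizeX mdeg1 geq_max leqnn.
    by rewrite msizeC (leq_trans (leq_b1 _)).
  by rewrite mcoeffB mcoeffX mcoeffC eqxx mnm1_eq0 mulr0 subr0.
have [|c c0 El] := divides_linear not_unit_f sl.
  by apply/ideal_of_image; rewrite rmorphB /= mmapXU mmapC.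
apply: (@not_coord_plane (A 0)); apply/seteqP; split=> p; rewrite /zeros /coord_plane /=.
  move=> fp; have := congr1 (meval p) El; rewrite mevalZ fp mulr0 mevalB mevalXU mevalC.
  by move/eqP; rewrite subr_eq0 => /eqP.
move=> pA; have := congr1 (meval p) El; rewrite mevalZ mevalB mevalXU mevalC pA subrr.
by move/esym/eqP; rewrite mulf_eq0 (negPf c0) => /eqP.
Qed.

Definition projection (j : 'I_2) : M :=
  (Q (lift ord0 j) - k (A (lift ord0 j))) / (Q 0 - k (A 0)).
Local Notation chi := projection.

Lemma projectionM j : chi j * x = Q (lift ord0 j) - k (A (lift ord0 j)).
Proof. by rewrite divfK // abscissa_neq0. Qed.

Lemma chart_translate w :
  (map_poly (mmap k chi) (chart (translate A w))).[x] = mmap k Q w.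
Proof.
rewrite chart_value translate_value; apply: eq_mmap => i.
rewrite /cons_fun; case: unliftP => [j|] ->; last by rewrite subrK.
by rewrite projectionM subrK.
Qed.

(** The generic point of the surface is the point of parameter [x] on the line
    through [A] with direction [(1, chi)], so that the relations between [x] and
    [chi] are the equations of the surface in the chart. *)
Lemma chart_relation w :
  (map_poly (mmap k chi) (chart w)).[x] = 0 <-> divides (translate A f) w.
Proof.
by rewrite -{1}(translateNK A w) chart_translate ideal_of_image divides_translate.
Qed.

(** If both components were constant, [f] would divide two linear forms that are not
    proportional. *)
Lemma projection_nonconstant : exists i, forall c, chi i <> k c.
Proof.
apply: contrapT => H.
have const i : exists c, chi i = k c.
  apply: contrapT => Hi; apply: H; exists i => c Ec; apply: Hi; by exists c.
pose l (i : 'I_2) c : {mpoly K[3]} := 'X_(lift ord0 i) - c *: 'X_0.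
have l_rel i c : chi i = k c -> divides (translate A f) (l i c).
  move=> Ec; apply/chart_relation; rewrite chart_value rmorphB /= mmapZ !mmapXU.
  by rewrite /cons_fun liftK unlift_none Ec subrr.
have nU : translate A f \isn't a GRing.unit.
  apply: contra not_unit_f => U; rewrite -(translateK A f).
  exact: rmorph_unit.
have l_coef i c j : (l i c)@_(U_(lift ord0 j))%MM = (i == j)%:R.
  rewrite mcoeffB mcoeffZ !mcoeffX !eq_mnm1 (inj_eq lift_inj).
  by rewrite [ord0 == _]negbTE ?neq_lift // mulr0 subr0.
have sl i c : msize (l i c) = 2%N.
  apply: (@msize_linear _ _ (lift ord0 i)); last by rewrite l_coef eqxx.
  rewrite (leq_trans (msizeD_le _ _)) // msizeN msizeX mdeg1 geq_max leqnn /=.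
  by rewrite (leq_trans (msizeZ_le _ _)) // msizeX mdeg1.
have [c0 E0] := const 0; have [c1 E1] := const 1.
have [a a0 Ea] := divides_linear nU (sl 0 c0) (l_rel _ _ E0).
have [b b0 Eb] := divides_linear nU (sl 1 c1) (l_rel _ _ E1).
have : b *: l 0 c0 = a *: l 1 c1 by rewrite Ea Eb !scalerA mulrC.
pose j0 : 'I_2 := 0; move/(congr1 (mcoeff U_(lift ord0 j0)%MM)).
rewrite !mcoeffZ !l_coef (_ : (0 == j0) = true) // (_ : (1 == j0) = false) //.
by rewrite mulr1 mulr0 => /eqP; rewrite (negPf b0).
Qed.

Variables (h : {poly {mpoly K[2]}}) (mu : nat).
Hypotheses (Eh : chart (translate A f) = h * 'X^mu) (h0 : h`_0 != 0).

Lemma chart_factor_relation : (map_poly (mmap k chi) h).[x] = 0.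
Proof.
have /eqP : (map_poly (mmap k chi) (chart (translate A f))).[x] = 0.
  by apply/chart_relation; apply: divides_refl.
rewrite Eh rmorphM /= map_polyXn hornerM hornerXn mulf_eq0 expf_eq0.
by rewrite (negPf abscissa_neq0) andbF orbF => /eqP.
Qed.

(** [h] generates the relations satisfied by [x] over [K(chi)]: homogenizing such
    a relation yields an equation of the surface, which [f] divides. *)
Lemma chart_factor_divides P : (map_poly (mmap k chi) P).[x] = 0 -> divides h P.
Proof.
move=> Px; have [N [w Ew]] := chart_surjective P.
apply: (@divides_stripX _ _ _ N) => //; rewrite -Ew.
have : divides (translate A f) w.
  by apply/chart_relation; rewrite Ew rmorphM /= hornerM Px mul0r.
move=> [r ->]; rewrite rmorphM /= Eh.
by exists (chart r * 'X^mu); rewrite -mulrA ['X^mu * _]mulrC.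
Qed.

Lemma constant_factor_dependent : size h = 1%N ->
  exists F, F != 0 /\ mmap k chi F = 0.
Proof.
move=> sh; exists h`_0; split=> //; have := chart_factor_relation.
by rewrite (size1_polyC (_ : (size h <= 1)%N)) ?sh // map_polyC hornerC coefC.
Qed.

Lemma dependent_constant_factor F : F != 0 -> mmap k chi F = 0 -> size h = 1%N.
Proof.
move=> F0 EF; have [|q Eq] := @chart_factor_divides F%:P.
  by rewrite map_polyC hornerC.
have [d Ed] := factor_polyC F0 (esym Eq).
rewrite Ed size_polyC (_ : d != 0) //.
by apply: contraNneq h0 => d0; rewrite Ed d0 coefC.
Qed.

Hypothesis charK : [pchar K] =i pred0.
Hypothesis indep : forall F, mmap k chi F = 0 -> F = 0.

Lemma chart_factor_size : (1 < size h)%N.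
Proof.
rewrite ltn_neqAle eq_sym size_poly_gt0; apply/andP; split.
  apply/eqP => /constant_factor_dependent[F [F0 /indep E]].
  by rewrite E eqxx in F0.
by apply: contraNneq h0 => ->; rewrite coef0.
Qed.

(** Being a minimal relation in characteristic zero, [h] is prime to its
    derivative. *)
Lemma chart_factor_separable : exists (u v : {poly {mpoly K[2]}}) r,
  r != 0 /\ u * h + v * h^`() = r%:P.
Proof.
have hn0 : h != 0 by rewrite -size_poly_gt0 ltnW ?chart_factor_size.
case: (common_factor_or_bezout h^`() hn0) => // -[e [y [z [a [b [se a0 b0 Ea Eb]]]]]].
exfalso.
have minimal P : P != 0 -> divides h P -> (size h <= size P)%N.
  move=> P0 [q Eq]; move: P0; rewrite Eq mulf_eq0 negb_or => /andP[q0 _].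
  rewrite size_mul //; have : (0 < size q)%N by rewrite size_poly_gt0.
  by case: (size q) => // j _; rewrite addSn /= leq_addl.
have ye0 : y * e != 0 by rewrite -Ea scale_poly_eq0 negb_or a0.
have : size (y * e) = size h by rewrite -Ea size_scale.
move: ye0; rewrite mulf_eq0 negb_or => /andP[y0 e0]; rewrite size_mul // => sye.
have /eqP : (map_poly (mmap k chi) (y * e)).[x] = 0.
  by rewrite -Ea map_polyZ hornerZ chart_factor_relation mulr0.
rewrite rmorphM /= hornerM mulf_eq0 => /orP[]/eqP /chart_factor_divides.
  move=> /(minimal _ y0); rewrite -sye leqNgt.
  by case: (size e) se => [|[|j]] // _; rewrite !addnS /= ltnS leq_addr.
move=> /(minimal _ e0); rewrite leqNgt => /negP; apply.
have h'0 : h^`() != 0.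
  have [d Ed] : exists d, size h = d.+2.
    by case: (size h) chart_factor_size => [|[|d]] // _; exists d.
  have lh : h`_d.+1 != 0.
    have -> : h`_d.+1 = lead_coef h by rewrite lead_coefE Ed.
    by rewrite lead_coef_eq0.
  apply: contraNneq lh => /(congr1 (fun q : {poly _} => q`_d)).
  rewrite coef_deriv coef0 -mulr_natr -mpolyC_nat => /eqP.
  by rewrite mulf_eq0 mpolyC_eq0; move/pcharf0P: charK => ->; rewrite orbF.
apply: leq_ltn_trans (lt_size_deriv hn0); rewrite -(size_scale (h^`()) b0) Eb.
have : z * e != 0 by rewrite -Eb scale_poly_eq0 negb_or b0.
rewrite mulf_eq0 negb_or => /andP[z0 _]; rewrite size_mul //.
have : (0 < size z)%N by rewrite size_poly_gt0.
by case: (size z) => // j _; rewrite addSn /= leq_addl.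
Qed.

Lemma projection_quotients F :
  mmap k chi F \in quotients (mmap k Q : {rmorphism {mpoly K[3]} -> M}).
Proof.
have Qq i : Q i \in quotients (mmap k Q : {rmorphism _ -> M}).
  by rewrite -(mmapXU k Q); apply: quotients_ev.
have kq c : k c \in quotients (mmap k Q : {rmorphism {mpoly K[3]} -> M}).
  by rewrite -(mmapC Q k); apply: quotients_ev.
rewrite /mmap; apply: rpred_sum => e _; apply: rpredM => //.
apply: rpred_prod => i _; apply: rpredX; rewrite /projection.
by apply: rpred_div; apply: rpredB.
Qed.

Variable gX : 'I_2 -> M.
Hypothesis dependence : forall y : 'I_3 -> M,
  exists2 P : {mpoly K[3]}, P != 0 & mmap k y P = 0.

(** The coordinate [gX i] is algebraic over [K(chi)], which lies in [K(Q)]. *)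
Lemma coordinates_algebraic i :
  algebraicOver (@quotient_in _ _ (mmap k Q : {rmorphism {mpoly K[3]} -> M})) (gX i).
Proof.
have [P P0 EP] := dependence (cons_fun (gX i) chi).
have R0 : head_poly P != 0.
  by apply: contraNneq P0 => E; rewrite -(head_polyK P) E rmorph0.
set R := head_poly P in R0.
pose p := \poly_(j < size R) QuotientField (projection_quotients R`_j).
have Ep : map_poly (@quotient_in _ _ (mmap k Q : {rmorphism {mpoly K[3]} -> M})) p =
    map_poly (mmap k chi) R.
  apply/polyP => j; rewrite !coef_map coef_poly /=.
  by case: ltnP => // /leq_sizeP/(_ j (leqnn j)) ->; rewrite !rmorph0.
exists p; last by rewrite Ep /root -mmap_cons EP.
apply: contraNneq R0 => p0; apply/eqP/polyP => j; rewrite coef0; apply: indep.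
have := congr1 (fun q : {poly M} => q`_j) Ep; rewrite p0 rmorph0 coef0 coef_map.
by move=> /esym.
Qed.

End Projection.

Lemma seq_disjoint_union (T U : eqType) (ls : seq T) (r : T -> U -> Prop) e :
  uniq ls ->
  (forall l, l \in ls -> exists vs : seq U,
     [/\ uniq vs, size vs = e & forall v, r l v <-> v \in vs]) ->
  (forall l l' v, r l v -> r l' v -> l = l') ->
  exists vs : seq U, [/\ uniq vs, size vs = (size ls * e)%N &
    forall v, (exists2 l, l \in ls & r l v) <-> v \in vs].
Proof.
move=> + + r_inj; elim: ls => [_ _|l ls IH /= /andP[l_ls uls] H].
  by exists [::]; split=> // v; split=> // -[].
have [vs [uvs svs Hvs]] := H l (mem_head _ _).
have [|vs' [uvs' svs' Hvs']] := IH uls.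
  by move=> l' l'ls; apply: H; rewrite inE l'ls orbT.
exists (vs ++ vs'); split.
- rewrite cat_uniq uvs uvs' andbT /=; apply/hasPn => v /Hvs'[l' l'ls rl'v].
  apply/negP => /Hvs rlv; case/negP: l_ls.
  by rewrite (r_inj _ _ _ rlv rl'v).
- by rewrite size_cat svs svs' mulSn.
move=> v; rewrite mem_cat; split=> [[l']|/orP[/Hvs|/Hvs'[l' l'ls]]].
- rewrite inE => /predU1P[->|l'ls] rv; apply/orP; first by left; apply/Hvs.
  by right; apply/Hvs'; exists l'.
- by exists l; rewrite ?mem_head.
- by exists l' => //; rewrite inE l'ls orbT.
Qed.

Section ProjectionFibre.
Variables (K : closedFieldType) (M : fieldType) (k : {rmorphism K -> M}).
Variables (f : {mpoly K[3]}) (Q : 'I_3 -> M) (A : affpt K 3).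
Hypothesis irr_f : irreducible_elt f.
Hypothesis ideal_of_image : forall w, mmap k Q w = 0 <-> divides f w.
Hypothesis not_coord_plane : forall c, zeros f <> coord_plane 0 c.
Local Notation chi := (projection k Q A).
Variables (h : {poly {mpoly K[2]}}) (mu : nat).
Hypotheses (Eh : chart (translate A f) = h * 'X^mu) (h0 : h`_0 != 0).
Hypothesis charK : [pchar K] =i pred0.
Hypothesis indep : forall F, mmap k chi F = 0 -> F = 0.
Variable gX : 'I_2 -> M.
Hypothesis gX_free : forall v : affpt K 2, specializes k gX v.
Hypothesis vanishing_locus : forall y, y != 0 -> exists F : {mpoly K[2]}, F != 0 /\
  forall m (Q' : 'I_m -> M) (p : 'I_m -> K) (u : affpt K 2), specializes k Q' p ->
    (forall i, spec_to k Q' p (chi i) (u i)) -> spec_to k Q' p y 0 -> F.@[u] = 0.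

(** The point of the line through [A] with direction (1, u) at parameter
    [lambda]. *)
Definition line_pt (u : affpt K 2) (lambda : K) : affpt K 3 :=
  [ffun i => cons_fun lambda (fun j => u j * lambda) i + A i].

Lemma spec_to_projection n (Q' : 'I_n -> M) p (z : 'I_3 -> K) j :
  specializes k Q' p -> (forall i, spec_to k Q' p (Q i) (z i)) -> z 0 != A 0 ->
  spec_to k Q' p (chi j)
    ((z (lift ord0 j) - A (lift ord0 j)) / (z 0 - A 0)).
Proof.
move=> sp sQ zA; apply: spec_to_div => //; first by rewrite subr_eq0.
  by apply: spec_toB => //; apply: spec_toC.
by apply: spec_toB => //; apply: spec_toC.
Qed.

Lemma line_pt_projection (u : affpt K 2) lambda j : lambda != 0 ->
  (line_pt u lambda (lift ord0 j) - A (lift ord0 j)) / (line_pt u lambda 0 - A 0) = u j.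
Proof.
move=> l0; rewrite !ffunE /cons_fun liftK unlift_none !addrK.
by rewrite mulfK.
Qed.

Lemma line_pt_zeros (u : affpt K 2) lambda : (map_poly (meval u) h).[lambda] = 0 ->
  f.@[line_pt u lambda] = 0.
Proof.
move=> hl; have E := chart_value (idfun : {rmorphism K -> K}) lambda u (translate A f).
have {E} : (map_poly (meval u) (chart (translate A f))).[lambda] = f.@[line_pt u lambda].
  rewrite [LHS]E translate_value; apply: eq_mmap => i.
  by rewrite ffunE.
by rewrite Eh rmorphM /= hornerM hl mul0r => <-.
Qed.

Variables (e : nat) (beta : {mpoly K[3]}) (B : {mpoly K[2]}).
Hypothesis beta_neq0 : mmap k Q beta != 0.
Hypothesis fibreQ : forall p : affpt K 3, specializes k Q p -> beta.@[p] != 0 ->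
    exists vs : seq (affpt K 2), [/\ uniq vs, size vs = e &
      forall v : affpt K 2, (forall i, spec_to k gX v (Q i) (p i)) <-> v \in vs].
Hypothesis B_neq0 : mmap k gX B != 0.
Hypothesis Q_regular : forall v : affpt K 2, B.@[v] != 0 ->
  exists z : 'I_3 -> K, (forall i, spec_to k gX v (Q i) (z i)) /\ z 0 != A 0.

(** The line through [A] over a general [u] meets the surface, outside [A], in
    the points given by the roots of [h]; the fibre of [chi] over [u] is the
    disjoint union of the fibres of [Q] over these points. *)
Lemma projection_fibre : exists F : {mpoly K[2]}, F != 0 /\
  forall u : affpt K 2, F.@[u] != 0 -> exists vs : seq (affpt K 2),
    [/\ uniq vs, size vs = ((size h).-1 * e)%N &
      forall v : affpt K 2, (forall j, spec_to k gX v (chi j) (u j)) <-> v \in vs].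
Proof.
have h_rel := chart_factor_relation irr_f ideal_of_image not_coord_plane Eh.
have [a [b [r [r0 Er]]]] := chart_factor_separable irr_f ideal_of_image
  not_coord_plane Eh h0 charK indep.
have h_gt1 := chart_factor_size irr_f ideal_of_image not_coord_plane Eh h0 indep.
have lh0 : lead_coef h != 0 by rewrite lead_coef_eq0 -size_poly_gt0 ltnW.
have [Fb [Fb0 HFb]] := vanishing_locus beta_neq0.
have [FB [FB0 HFB]] := vanishing_locus B_neq0.
(* The factors ensure that [h] specialized at [u] has simple roots, keeps its degree
   and has no root at [A], that [beta] does not vanish at the points of the surface
   over [u], and that [Q] is regular with [z 0 != A 0] on the fibre over [u]. *)
exists (r * lead_coef h * h`_0 * Fb * FB); split; first by rewrite !mulf_neq0.
move=> u; rewrite !mevalM !mulf_eq0 !negb_or -!andbA => /and5P[ru lu h0u Fbu FBu].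
set hu := map_poly (meval u) h.
have sz_hu : size hu = size h by rewrite size_map_poly_id0.
have Ehu : map_poly (meval u) a * hu + map_poly (meval u) b * hu^`() = (r.@[u])%:P.
  by rewrite deriv_map -!rmorphM -rmorphD /= Er map_polyC.
have [ls [uls sls lsP]] := separable_roots ru Ehu.
have ls0 l : l \in ls -> l != 0.
  rewrite -lsP; apply: contraTneq => ->.
  by rewrite /root horner_coef0 coef_map.
have zl l : l \in ls -> specializes k Q (line_pt u l).
  rewrite -lsP => /eqP hl; apply: (specializes_zeros ideal_of_image).
  exact: line_pt_zeros.
have chi_l l j : l \in ls -> spec_to k Q (line_pt u l) (chi j) (u j).
  move=> lls; rewrite -(line_pt_projection u j (ls0 l lls)).
  apply: spec_to_projection; first exact: zl.
    by move=> i; apply: spec_toX.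
  by rewrite ffunE /cons_fun unlift_none -subr_eq0 addrK ls0.
have beta_l l : l \in ls -> beta.@[line_pt u l] != 0.
  move=> lls; apply: contraNneq Fbu => bl.
  apply/eqP; apply: (HFb _ Q (line_pt u l) u (zl l lls)).
    by move=> j; apply: chi_l.
  by rewrite -bl; apply: spec_to_mmap.
pose rel l (v : affpt K 2) := forall i, spec_to k gX v (Q i) (line_pt u l i).
have rel_inj l l' v : rel l v -> rel l' v -> l = l'.
  move=> /(_ 0) sl /(_ 0) /(spec_to_inj (@gX_free v) sl).
  by rewrite !ffunE /cons_fun unlift_none => /addIr.
have [|vs [uvs svs Hvs]] := seq_disjoint_union uls _ rel_inj (e := e).
  by move=> l lls; apply: fibreQ; [apply: zl | apply: beta_l].
exists vs; split; rewrite // ?svs ?sls ?sz_hu //.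
move=> v; rewrite -Hvs; split=> [chi_v|[l lls rl j]]; last first.
  rewrite -(line_pt_projection u j (ls0 l lls)).
  apply: spec_to_projection => //.
  by rewrite ffunE /cons_fun unlift_none -subr_eq0 addrK ls0.
have Bv : B.@[v] != 0.
  apply: contraNneq FBu => Bv; apply/eqP.
  by apply: (HFB _ gX v u) => //; rewrite -Bv; apply: spec_to_mmap.
have [z [Qz zA]] := Q_regular Bv.
have sx : spec_to k gX v (Q 0 - k (A 0)) (z 0 - A 0).
  by apply: spec_toB => //; apply: spec_toC.
have zE i : z i = line_pt u (z 0 - A 0) i.
  rewrite ffunE /cons_fun; case: unliftP => [j|] ->; last by rewrite subrK.
  have := spec_to_projection j (@gX_free v) Qz zA.
  move/(spec_to_inj (@gX_free v) (chi_v j)) => ->.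
  by rewrite divfK ?subrK // subr_eq0.
exists (z 0 - A 0); last by move=> i; rewrite -zE.
rewrite -lsP; apply/eqP.
have := spec_to_horner (@gX_free v) h chi_v sx; rewrite h_rel => s0.
apply: (spec_to_inj (@gX_free v) s0); rewrite -(rmorph0 k); exact: spec_toC.
Qed.

End ProjectionFibre.

(** * The degree formula *)

Lemma quotient_difference (M : fieldType) (n0 d0 nj dj a0 aj : M) :
  d0 != 0 -> dj != 0 ->
  (nj - aj * dj) / (n0 - a0 * d0) * (d0 / dj) = (nj / dj - aj) / (n0 / d0 - a0).
Proof.
move=> d00 dj0.
have -> : nj / dj - aj = (nj - aj * dj) / dj by rewrite mulrBl mulfK.
have -> : n0 / d0 - a0 = (n0 - a0 * d0) / d0 by rewrite mulrBl mulfK.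
rewrite invf_div !mulf_div; congr (_ / _); exact: mulrC.
Qed.

Section Surface.
Variables (K : closedFieldType) (f : {mpoly K[3]}).
Variables (N D : 'I_3 -> {mpoly K[2]}) (A : affpt K 3).
Hypothesis D_neq0 : forall i, D i != 0.
Local Notation k := (@fracC K 2).
Local Notation Q := (param N D).
Local Notation chi := (projection k Q A).
Local Notation "x %:F" := (@FracField.tofrac _ x).

Lemma tofrac_difference i :
  (N i - A i *: D i)%:F = (N i)%:F - k (A i) * (D i)%:F.
Proof.
rewrite -mul_mpolyC /fracC /=; rewrite -rmorphM; exact: rmorphB.
Qed.

Lemma param_difference i : Q i - k (A i) = (N i - A i *: D i)%:F / (D i)%:F.
Proof.
have Di : (D i)%:F != 0 by rewrite tofrac_eq0.
rewrite tofrac_difference mulrBl; congr (_ - _); exact/esym/mulfK.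
Qed.

Lemma Phi23_projection : Phi23 N D A = chi.
Proof.
apply: funext => j; rewrite /Phi23 /projection /param !tofrac_difference.
by apply: quotient_difference; rewrite tofrac_eq0.
Qed.

Lemma param_regular (v : affpt K 2) : (\prod_i D i).@[v] != 0 ->
  forall i, spec_to k (@fracX K 2) v (Q i) ((N i).@[v] / (D i).@[v]).
Proof.
rewrite rmorph_prod => /prodf_neq0 Dv i; exists (N i), (D i).
by rewrite !mmap_fracX; split=> //; apply: Dv.
Qed.

Hypothesis charK : [pchar K] =i pred0.
Hypothesis irr_f : irreducible_elt f.
Hypothesis not_coord_plane : forall c, zeros f <> coord_plane 0 c.
Hypothesis dominant_Q : dominant_onto Q (zeros f).

Let ideal_of_image w : mmap k Q w = 0 <-> divides f w.
Proof. exact: ideal_of_dominant irr_f dominant_Q. Qed.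

Lemma irreducible_plane (w w' : {mpoly K[2]}) :
  (exists2 p : affpt K 2, setT p & w.@[p] != 0) ->
  (exists2 p : affpt K 2, setT p & w'.@[p] != 0) ->
  exists p : affpt K 2, [/\ setT p, w.@[p] != 0 & w'.@[p] != 0].
Proof.
have nz u : (exists2 p : affpt K 2, setT p & u.@[p] != 0) -> u != 0.
  by move=> [p _]; apply: contraNneq => ->; rewrite meval0.
move=> /nz w0 /nz w'0; have [|p] := @mpoly_neq0_point K 2 (w * w').
  by rewrite mulf_neq0.
by rewrite mevalM mulf_eq0 negb_or => /andP[]; exists p.
Qed.

(** The components of [chi] are not both constant, so if they are dependent they
    factor through a curve, and points of a common fibre give a common factor. *)
Lemma gpoly1_independent : gpoly chi = 1 <-> rat_independent chi.
Proof.
split=> [g1 F EF|]; last exact: gpoly_independent.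
apply/eqP/negPn/negP => F0.
have [i nc] := projection_nonconstant A irr_f ideal_of_image not_coord_plane.
exact: gpoly_dependent F0 EF nc g1.
Qed.

(** Both sides say that [chi] is algebraically dependent: as [h] generates the
    relations between [x] and [chi], it is free of [x] exactly in this case. *)
Lemma multiplicity_eq_degree :
  multiplicity A f = total_degree f <-> gpoly chi <> 1.
Proof.
have f0 : f != 0 by case: irr_f.
have [h [Eh h0 szh le_mu]] := multiplicity_chart A f0.
rewrite gpoly1_independent.
have -> : multiplicity A f = total_degree f <-> size h = 1%N.
  rewrite szh; split=> [->|[/eqP]]; first by rewrite subnn.
  by rewrite subn_eq0 => ge_mu; apply/eqP; rewrite eqn_leq le_mu.
split=> [sh indep|dep].
  have [F [F0 EF]] := constant_factor_dependent irr_f ideal_of_image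
    not_coord_plane Eh h0 sh.
  by case/eqP: F0; apply: indep.
apply: contrapT => sh; apply: dep => F EF; apply/eqP/negPn/negP => F0.
apply: sh; exact (dependent_constant_factor irr_f ideal_of_image
  not_coord_plane Eh h0 F0 EF).
Qed.

(** Over a general [u] the surface has [deg - mult] points outside [A] on the line of
    direction [(1, u)], and each of them has [e] preimages under [Q]. *)
Lemma degree_formula : gpoly chi = 1 -> exists2 e, (0 < e)%N &
  map_degree Q (zeros f) = e /\
  map_degree chi setT = ((total_degree f - multiplicity A f) * e)%N.
Proof.
move=> /gpoly1_independent indep.
have f0 : f != 0 by case: irr_f.
have [h [Eh h0 szh _]] := multiplicity_chart A f0.
have alg i : algebraicOver (@quotient_in _ _
    (mmap k Q : {rmorphism {mpoly K[3]} -> _})) (@fracX K 2 i).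
  exact (coordinates_algebraic indep (@fracX K 2) (@algebraic_dependence K 2) i).
have [|i|e [beta [e_gt0 beta0 fibreQ]]] := generic_fibre charK
    (@fracX_specializes K 2) (nu := fun i => rnum (Q i)) (de := fun i => rden (Q i))
    _ _ alg.
- by move=> i; rewrite mmap_fracX tofrac_eq0 rden_neq0.
- by rewrite !mmap_fracX rnum_div_rden.
exists e => //; split.
  apply: map_degreeE.
    exact: (zeros_irreducible irr_f ideal_of_image).
  apply: (generic_fibre_card_seq (w := beta)).
    exact: (zeros_nonvanishing irr_f ideal_of_image).
  move=> p fp bp.
  have [vs [uvs svs Hvs]] := fibreQ p (specializes_zeros ideal_of_image fp) bp.
  by exists vs; split=> // v; rewrite fibreP.
have x0 : N 0 - A 0 *: D 0 != 0.
  apply: contraTneq (abscissa_neq0 A irr_f ideal_of_image not_coord_plane) => E.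
  by rewrite negbK param_difference E rmorph0 mul0r.
set B := (N 0 - A 0 *: D 0) * \prod_i D i.
have B0 : mmap k (@fracX K 2) B != 0.
  rewrite mmap_fracX tofrac_eq0; apply: mulf_neq0 => //.
  by apply/prodf_neq0.
have [|F [F0 HF]] := projection_fibre irr_f ideal_of_image not_coord_plane Eh h0
  charK indep (@fracX_specializes K 2) (fun y => vanishing_locus_image (y := y) indep)
  beta0 fibreQ B0.
  move=> v; rewrite mevalM mulf_eq0 negb_or => /andP[xv Dv].
  exists (fun i => (N i).@[v] / (D i).@[v]); split; first exact: param_regular.
  have D0v : (D 0).@[v] != 0.
    by move: Dv; rewrite rmorph_prod => /prodf_neq0; apply.
  apply: contraNneq xv => E.
  by rewrite mevalB mevalZ -E divfK // subrr.
apply: map_degreeE; first exact: irreducible_plane.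
rewrite szh in HF.
apply: (generic_fibre_card_seq (w := F)).
  by have [p] := mpoly_neq0_point F0; exists p.
move=> u _ Fu; have [vs [uvs svs Hvs]] := HF u Fu.
by exists vs; split=> // v; rewrite fibreP.
Qed.

End Surface.

Theorem theorem3p2 (K : closedFieldType) (charK : [pchar K] =i pred0)
    (f : {mpoly K[3]}) (irr_f : irreducible_elt f)
    (not_coord_plane : forall (i : 'I_3) (c : K),
       zeros f <> coord_plane i c)
    (N D : 'I_3 -> {mpoly K[2]})
    (D_neq0 : forall i, D i != 0)
    (reduced_ND : forall i, coprime_elts (N i) (D i))
    (dominant_Q : dominant_onto (param N D) (zeros f))
    (A : affpt K 3)
    (avoids_ND : forall i, avoids_010 (N i) /\ avoids_010 (D i))
    (avoids_A : forall i, avoids_010 (N i - A i *: D i)) :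
  let g := gpoly (Phi23 N D A) in
  (multiplicity A f = total_degree f <-> g <> 1) /\
  (((multiplicity A f < total_degree f)%N <-> g = 1) /\
   (g = 1 ->
      (total_degree f)%:R - (multiplicity A f)%:R =
      (map_degree (Phi23 N D A) [set: affpt K 2])%:R /
      (map_degree (param N D) (zeros f))%:R :> rat)).
Proof.
move=> g; have Eg : g = gpoly (projection (@fracC K 2) (param N D) A).
  by rewrite /g Phi23_projection.
rewrite Phi23_projection // {}Eg => {g}.
have eq_deg := multiplicity_eq_degree A irr_f (not_coord_plane 0) dominant_Q.
have f0 : f != 0 by case: irr_f.
have le_mu : (multiplicity A f <= total_degree f)%N.
  by have [h []] := multiplicity_chart A f0.
split=> //; split=> [|g1].
  rewrite ltn_neqAle le_mu andbT; split=> [/eqP ne|g1].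
    by apply: contrapT => /eq_deg.
  by apply/eqP => /eq_deg.
have [e e_gt0 [-> ->]] :=
  degree_formula D_neq0 charK irr_f (not_coord_plane 0) dominant_Q g1.
by rewrite natrM natrB // mulfK // Num.Theory.pnatr_eq0 -lt0n.
Qed.
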